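(* Assume that $a,b\in\mathbb{C}$, $c\in\mathbb{C}\setminus\mathbb{Z}_{\leqslant 0}$ and $a-b\in\mathbb{C}\setminus\mathbb{Z}$. Then $$\Phi_1[a,b;c;x,y]=\frac{\Gamma(c)\Gamma(b-a)}{\Gamma(b)\Gamma(c-a)}(-x)^{-a}\sum_{k=0}^{\infty}{}_1F_1\left[\begin{matrix}-k\\ c-a-k\end{matrix};y\right]\frac{(a)_k(a-c+1)_k}{(a-b+1)_k}\frac{x^{-k}}{k!}+\frac{\Gamma(c)\Gamma(a-b)}{\Gamma(a)\Gamma(c-b)}(-x)^{-b}\sum_{k=0}^{\infty}{}_1F_1\left[\begin{matrix}a-b-k\\ c-b-k\end{matrix};y\right]\frac{(b)_k(b-c+1)_k}{(b-a+1)_k}\frac{x^{-k}}{k!}$$ holds for $|\arg(-x)|<\pi$, $|x|>1$ and $|y|<\infty$.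
   Context: $(\alpha)_n=\Gamma(\alpha+n)/\Gamma(\alpha)$ is the Pochhammer symbol, ${}_pF_q$ the generalized hypergeometric function, and powers take principal values. The Humbert function $\Phi_1$ is defined for $|x|<1$, $y\in\mathbb{C}$ by $$\Phi_1[a,b;c;x,y]=\sum_{m,n=0}^{\infty}\frac{(a)_{m+n}(b)_m}{(c)_{m+n}}\frac{x^m}{m!}\frac{y^n}{n!},$$ and is continued analytically to all $x\in\mathbb{C}\setminus[1,\infty)$, $y\in\mathbb{C}$ by $$\Phi_1[a,b;c;x,y]=\sum_{n=0}^{\infty}\frac{(a)_n}{(c)_n}\,{}_2F_1\left[\begin{matrix}a+n,b\\ c+n\end{matrix};x\right]\frac{y^n}{n!}$$ (with the principal branch of ${}_2F_1$). Convention for exceptional parameters: since $\frac{(1-B)_k}{\Gamma(B)}\,{}_1F_1[A;B-k;z]=\frac{(-1)^k}{\Gamma(B-k)}\,{}_1F_1[A;B-k;z]$ is an analytic (entire) function of $B\in\mathbb{C}$, the products $\frac{(a-c+1)_k}{\Gamma(c-a)}{}_1F_1[-k;c-a-k;y]$ and $\frac{(b-c+1)_k}{\Gamma(c-b)}{}_1F_1[a-b-k;c-b-k;y]$ are understood in this sense (by continuity in the parameters) when $c-a\in\mathbb{Z}$ or $c-b\in\mathbb{Z}$. *)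

(* Defs.v *)
From Stdlib Require Import Reals ZArith.
From Coquelicot Require Import Coquelicot.

Open Scope C_scope.

(** * Complex sequences, series and analytic functions *)

(* The unique complex number satisfying [P]; meaningful only when there is
   exactly one, so e.g. [Csum u] is meaningful only for a convergent series. *)
Definition Ciota (P : C -> Prop) : C := @iota C_CompleteNormedModule P.

Definition Clim_seq (u : nat -> C) : C :=
  Ciota (fun l : C => filterlim u eventually (locally l)).

Definition Csum (u : nat -> C) : C := Ciota (fun l : C => is_series u l).

Definition analytic_on (U : C -> Prop) (f : C -> C) : Prop :=
  forall z0 : C, U z0 ->
    exists (r : R) (coef : nat -> C), (0 < r)%R /\
      forall z : C, (Cmod (z - z0) < r)%R -> is_pseries coef (z - z0) (f z).

(** * Principal argument, logarithm and powers *)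

(* Values in (-PI, PI]; the value at 0 is a dummy. *)
Definition Carg (z : C) : R :=
  if Rle_dec 0 (Im z) then acos (Re z / Cmod z) else (- acos (Re z / Cmod z))%R.

Definition Clog (z : C) : C := (ln (Cmod z), Carg z).

Definition Cexp (z : C) : C :=
  ((exp (Re z) * cos (Im z))%R, (exp (Re z) * sin (Im z))%R).

Definition Cpower (z w : C) : C := Cexp (w * Clog z).

(** * Gamma function and Pochhammer symbol *)

Definition is_int (z : C) : Prop := exists n : Z, z = IZR n.

Definition is_nonpos_int (z : C) : Prop := exists n : nat, z = - INR n.

(* Written as a product, which is Gamma (a + n) / Gamma a wherever that
   quotient makes sense and its continuous extension at the poles of Gamma. *)
Fixpoint poch (a : C) (n : nat) : C :=
  match n with
  | O => 1
  | S m => poch a m * (a + INR m)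
  end.

(* The entire function 1 / Gamma, by the Euler-Gauss formula
     Gamma z = lim_n n! n^z / (z (z + 1) ... (z + n)).
   It vanishes exactly at the nonpositive integers, where Gamma has poles. *)
Definition rGamma (z : C) : C :=
  Clim_seq (fun n => poch z (S n) / (INR (fact n) * Cpower (INR n) z)).

(* Meaningful off the nonpositive integers. *)
Definition Gamma (z : C) : C := / rGamma z.

(** * Hypergeometric functions *)

Definition hyp1F1 (A B z : C) : C :=
  Csum (fun m => poch A m / poch B m * (z ^ m / INR (fact m))).

Definition hyp2F1_term (a b c z : C) (m : nat) : C :=
  poch a m * poch b m / poch c m * (z ^ m / INR (fact m)).

(* The complex plane cut along [1, +oo). *)
Definition cut_plane (z : C) : Prop := ~ (Im z = 0%R /\ (1 <= Re z)%R).

Definition is_hyp2F1_branch (a b c : C) (F : C -> C) : Prop :=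
  analytic_on cut_plane F /\
  forall z : C, (Cmod z < 1)%R -> is_series (hyp2F1_term a b c z) (F z).

(* Principal branch, for z in [cut_plane] and c not a nonpositive integer:
   the value at z of the analytic continuation of the Gauss series. *)
Definition hyp2F1 (a b c z : C) : C :=
  Ciota (fun v : C => exists F : C -> C, is_hyp2F1_branch a b c F /\ F z = v).

Definition Phi1_term (a b c x y : C) (n : nat) : C :=
  poch a n / poch c n * hyp2F1 (a + INR n) b (c + INR n) x
  * (y ^ n / INR (fact n)).

(* Humbert's Phi_1 on x in [cut_plane], y in C: the analytic continuation in x
   of the double series, which converges for |x| < 1. *)
Definition Phi1 (a b c x y : C) : C := Csum (Phi1_term a b c x y).

(* The product (1 - B)_k / Gamma(B) * 1F1[A; B - k; z]. *)
Definition scaled1F1_raw (k : nat) (A z B : C) : C :=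
  poch (1 - B) k * rGamma B * hyp1F1 A (B - INR k) z.

(* The same product, extended by continuity in B to the integers, where
   1F1[A; B - k; z] may be undefined. *)
Definition scaled1F1 (k : nat) (A z B : C) : C :=
  Ciota (fun v : C =>
    (~ is_int B -> v = scaled1F1_raw k A z B) /\
    (is_int B ->
       filterlim (scaled1F1_raw k A z) (locally' B) (locally v))).

(* Main.v *)
Require Import Defs.
From Stdlib Require Import Reals ZArith Lra Lia.
From Coquelicot Require Import Coquelicot.
Open Scope C_scope.

(** Phi_1 is by definition a power series in y whose n-th coefficient contains
    the Gauss function 2F1[a+n, b; c+n; x].  The theorem is the classical
    inversion formula for 2F1, which expresses 2F1[a, b; c; x] through two
    Gauss series in 1/x ([hyp2F1_inversion]), applied to every coefficient
    ([Phi1_term_rows]) and followed by a rearrangement of two double series.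
    In the first one the terms x^(-n-j) y^n are collected along the diagonals
    n + j = k; a diagonal is a polynomial in y, namely the terminating
    1F1[-k; c-a-k; y] ([double1_diag]).  In the second one the columns are
    summed, and a column is 1F1[a-b-k; c-b-k; y] ([double2_col]).  Both double
    series converge absolutely, because quotients of Pochhammer symbols and of
    Gamma functions along the integers grow more slowly than every geometric
    sequence, whereas |1/x| < 1 and y^n / n! is summable.  Exceptional
    parameters cause no trouble when everything is written with the entire
    function 1/Gamma: scaled1F1 is a power series with coefficients
    1/Gamma (B - k + m), and these are continuous in B ([scaled1F1_eq]).

    The inversion formula needs three things.

    Continuation.  For Re p >= 1/2 the map z -> p z / (p z - 1) sends the half
    plane Re (p z) < 1/2 onto the unit disc.  In the new variable the Gauss
    function is a binomial factor times a power series whose coefficients are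
    terminating 2F1's at 1/p ([pfaff_fun_gauss]); a two-term recursion shows
    that they grow subexponentially ([subexp_diff_tab]), so the expansion holds
    on the whole half plane.  These half planes cover the plane cut along
    [1, +oo), and any two of them meet in a convex set containing 0, so the
    identity theorem glues the expansions ([branch_analytic]).  The case p = 1
    is Pfaff's transformation ([branch_pfaff]).

    Connection.  By Pfaff's transformation the formula on the negative axis is
    a linear relation on (0, 1) between the solution of the hypergeometric
    equation regular at one end and the two local solutions at the other end.
    It exists because Wronskians are constant up to an explicit factor
    ([connected_ex]).  Raising c by 1 multiplies its first coefficient by an
    explicit rational function of c, and that coefficient tends to 1 when c is
    raised indefinitely ([connected_raise], [connection_coef_lim]); with the
    Euler-Gauss product for 1/Gamma this determines it
    ([connection_coef_value]).  The other coefficient follows from the symmetry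
    between a and b ([connection_neg_axis]).

    Extension.  With s = log (-x) the domain |x| > 1, |arg (-x)| < pi becomes
    the half strip Re s > 0, |Im s| < pi.  It is convex and both sides are
    analytic in s, so the formula spreads from the real axis to all of it. *)

(** * Series of complex numbers *)

(** Finite sums and series carry the carrier of an algebraic structure as the
    type of their equations; [ring] must be told that it is C. *)
Ltac cring := match goal with |- @eq _ ?a ?b => change (@eq C a b); ring end.

Ltac rring := match goal with |- @eq _ ?a ?b => change (@eq R a b); ring end.

Lemma csum_0 (u : nat -> C) : sum_n u 0 = u 0%nat.
Proof. exact (sum_O u). Qed.

Lemma csum_S (u : nat -> C) n : sum_n u (S n) = sum_n u n + u (S n).
Proof. exact (sum_Sn u n). Qed.

Lemma rsum_0 (u : nat -> R) : sum_n u 0 = u 0%nat.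
Proof. exact (sum_O u). Qed.

Lemma rsum_S (u : nat -> R) n : sum_n u (S n) = (sum_n u n + u (S n))%R.
Proof. exact (sum_Sn u n). Qed.

Lemma inv_lt_1 (r : R) : (1 < r)%R -> (0 < / r < 1)%R.
Proof.
  intros H. split; [apply Rinv_0_lt_compat; lra|].
  rewrite <- Rinv_1. apply Rinv_lt_contravar; lra.
Qed.

(** The topology of C is the product topology of R * R; estimates use the
    modulus instead. *)
Lemma filterlim_C_iff {T} (F : (T -> Prop) -> Prop) {FF : Filter F} (f : T -> C) (l : C) :
  filterlim f F (locally l) <->
  forall eps : R, (0 < eps)%R -> F (fun x => (Cmod (f x - l) < eps)%R).
Proof.
  split.
  - intros H eps He.
    exact (proj1 (@filterlim_locally_ball_norm C_AbsRing T C_NormedModule F FF f l) H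
             (mkposreal eps He)).
  - intros H.
    apply (@filterlim_locally_ball_norm C_AbsRing T C_NormedModule F FF f l).
    intros eps. exact (H eps (cond_pos eps)).
Qed.

Lemma filterlim_R_iff {T} (F : (T -> Prop) -> Prop) {FF : Filter F} (f : T -> R) (l : R) :
  filterlim f F (locally l) <->
  forall eps : R, (0 < eps)%R -> F (fun x => (Rabs (f x - l) < eps)%R).
Proof.
  split.
  - intros H eps He. exact (proj1 (filterlim_locally f l) H (mkposreal eps He)).
  - intros H. apply filterlim_locally. intros eps. exact (H eps (cond_pos eps)).
Qed.

Lemma Csum_unique (u : nat -> C) (l : C) : is_series u l -> Csum u = l.
Proof.
  intros H. unfold Csum, Ciota.
  apply (@iota_unique C_AbsRing C_CompleteNormedModule); [|exact H].
  intros y Hy.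
  apply (@filterlim_locally_unique nat C_AbsRing C_NormedModule eventually _ (sum_n u)); assumption.
Qed.

Lemma is_series_C_unique (u : nat -> C) (l l' : C) :
  is_series u l -> is_series u l' -> l = l'.
Proof.
  intros H H'. rewrite <- (Csum_unique u l H). apply Csum_unique; exact H'.
Qed.

Lemma Clim_seq_unique (u : nat -> C) (l : C) :
  filterlim u eventually (locally l) -> Clim_seq u = l.
Proof.
  intros H. unfold Clim_seq, Ciota.
  apply (@iota_unique C_AbsRing C_CompleteNormedModule); [|exact H].
  intros y Hy.
  apply (@filterlim_locally_unique nat C_AbsRing C_NormedModule eventually _ u); assumption.
Qed.

Lemma Csum_correct (u : nat -> C) : ex_series u -> is_series u (Csum u).
Proof.
  intros [l Hl]. rewrite (Csum_unique u l Hl). exact Hl.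
Qed.

Definition abs_summable (u : nat -> C) : Prop := ex_series (fun n => Cmod (u n)).

Lemma abs_summable_ex (u : nat -> C) : abs_summable u -> ex_series u.
Proof.
  intros H.
  apply (@ex_series_le C_AbsRing C_CompleteNormedModule u (fun n => Cmod (u n))); [|exact H].
  intros n. apply Rle_refl.
Qed.

Lemma abs_summable_is (u : nat -> C) : abs_summable u -> is_series u (Csum u).
Proof. intros H. apply Csum_correct, abs_summable_ex, H. Qed.

Lemma ex_series_le_pos (a b : nat -> R) :
  (forall n, (0 <= a n <= b n)%R) -> ex_series b -> ex_series a.
Proof.
  intros H Hb.
  apply (@ex_series_le R_AbsRing R_CompleteNormedModule a b); [|exact Hb].
  intros n. destruct (H n). change (norm (a n)) with (Rabs (a n)). rewrite Rabs_pos_eq; lra.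
Qed.

Lemma abs_summable_le (u : nat -> C) (b : nat -> R) :
  (forall n, (Cmod (u n) <= b n)%R) -> ex_series b -> abs_summable u.
Proof.
  intros H Hb. apply ex_series_le_pos with b; [|exact Hb].
  intros n; split; [apply Cmod_ge_0 | apply H].
Qed.

Lemma rsum_pos (a : nat -> R) : (forall n, (0 <= a n)%R) -> forall N, (0 <= sum_n a N)%R.
Proof.
  intros H N. induction N as [|N IH].
  - rewrite rsum_0. apply H.
  - rewrite rsum_S. specialize (H (S N)). lra.
Qed.

Lemma rsum_le (a b : nat -> R) N :
  (forall n, (n <= N)%nat -> (a n <= b n)%R) -> (sum_n a N <= sum_n b N)%R.
Proof.
  induction N as [|N IH]; intros H.
  - rewrite !rsum_0. apply H; lia.
  - rewrite !rsum_S. apply Rplus_le_compat; [apply IH; intros; apply H; lia | apply H; lia].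
Qed.

Lemma Cmod_sum_le (u : nat -> C) N : (Cmod (sum_n u N) <= sum_n (fun n => Cmod (u n)) N)%R.
Proof.
  induction N as [|N IH].
  - rewrite csum_0, rsum_0. lra.
  - rewrite csum_S, rsum_S. eapply Rle_trans; [apply Cmod_triangle|lra].
Qed.

Lemma rsum_le_Series (a : nat -> R) : (forall n, (0 <= a n)%R) -> ex_series a ->
  forall N, (sum_n a N <= Series a)%R.
Proof.
  intros H Ha N.
  apply (is_lim_seq_incr_compare (sum_n a)).
  - exact (Series_correct a Ha).
  - intros n. rewrite rsum_S. specialize (H (S n)). lra.
Qed.

Lemma ex_series_bounded (a : nat -> R) (M : R) : (forall n, (0 <= a n)%R) ->
  (forall N, (sum_n a N <= M)%R) -> ex_series a.
Proof.
  intros H HM.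
  destruct (ex_finite_lim_seq_incr (sum_n a) M) as [l Hl].
  - intros n. rewrite rsum_S. specialize (H (S n)). lra.
  - exact HM.
  - exists l. exact Hl.
Qed.

Lemma is_series_R_lim (a : nat -> R) (l : R) : is_series a l -> is_lim_seq (sum_n a) l.
Proof. intros H. exact H. Qed.

Lemma Series_bound (a : nat -> R) (M : R) : ex_series a ->
  (forall N, (sum_n a N <= M)%R) -> (Series a <= M)%R.
Proof.
  intros H HM.
  assert (H1 := is_series_R_lim _ _ (Series_correct a H)).
  assert (H2 := is_lim_seq_le (sum_n a) (fun _ => M) (Series a) M HM H1 (is_lim_seq_const M)).
  exact H2.
Qed.

Lemma Series_nonneg (a : nat -> R) : ex_series a -> (forall n, (0 <= a n)%R) -> (0 <= Series a)%R.
Proof.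
  intros H Ha. eapply Rle_trans; [|apply (rsum_le_Series a Ha H 0)].
  rewrite rsum_0. apply Ha.
Qed.

Lemma filterlim_C_le {T} (F : (T -> Prop) -> Prop) {FF : ProperFilter F} (f : T -> C) (l : C) (M : R) :
  filterlim f F (locally l) -> F (fun x => (Cmod (f x) <= M)%R) -> (Cmod l <= M)%R.
Proof.
  intros H HM. apply Rnot_lt_le. intros Hl.
  assert (He : (0 < Cmod l - M)%R) by lra.
  apply (proj1 (filterlim_C_iff F f l)) with (eps := (Cmod l - M)%R) in H; [|exact He].
  destruct (filter_ex _ (filter_and _ _ H HM)) as [x [H1 H2]].
  assert (H3 := Cmod_triangle (f x) (- (f x - l))).
  replace (f x + - (f x - l)) with l in H3 by ring. rewrite Cmod_opp in H3. lra.
Qed.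

Lemma Cmod_series_le (u : nat -> C) (b : nat -> R) (l : C) :
  is_series u l -> (forall n, (Cmod (u n) <= b n)%R) -> ex_series b -> (Cmod l <= Series b)%R.
Proof.
  intros H Hb Hex.
  apply (filterlim_C_le eventually (sum_n u) l); [exact H|].
  exists 0%nat. intros n _. eapply Rle_trans; [apply Cmod_sum_le|].
  eapply Rle_trans; [|apply rsum_le_Series; [|exact Hex]].
  - apply rsum_le. intros; apply Hb.
  - intros k. eapply Rle_trans; [apply Cmod_ge_0|apply Hb].
Qed.

Lemma Cmod_Csum_le (u : nat -> C) : abs_summable u ->
  (Cmod (Csum u) <= Series (fun n => Cmod (u n)))%R.
Proof.
  intros H. apply (Cmod_series_le u); [apply abs_summable_is, H | intros; lra | exact H].
Qed.

Lemma is_series_C_plus (u v : nat -> C) (a b : C) :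
  is_series u a -> is_series v b -> is_series (fun n => u n + v n) (a + b).
Proof. exact (is_series_plus u v a b). Qed.

Lemma is_series_C_scal (k : C) (u : nat -> C) (a : C) :
  is_series u a -> is_series (fun n => k * u n) (k * a).
Proof. exact (is_series_scal k u a). Qed.

Lemma is_series_C_minus (u v : nat -> C) (a b : C) :
  is_series u a -> is_series v b -> is_series (fun n => u n - v n) (a - b).
Proof. exact (is_series_minus u v a b). Qed.

Lemma is_series_C_ext (u v : nat -> C) (a : C) :
  (forall n, u n = v n) -> is_series u a -> is_series v a.
Proof. exact (is_series_ext u v a). Qed.

Lemma Csum_ext (u v : nat -> C) : (forall n, u n = v n) -> abs_summable u -> Csum u = Csum v.
Proof.
  intros H Hu. symmetry. apply Csum_unique.
  apply is_series_C_ext with u; [exact H|]. apply abs_summable_is, Hu.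
Qed.

Lemma abs_summable_ext (u v : nat -> C) : (forall n, u n = v n) -> abs_summable u -> abs_summable v.
Proof.
  intros H. apply ex_series_ext. intros n; rewrite H; reflexivity.
Qed.

Lemma abs_summable_scal (k : C) (u : nat -> C) : abs_summable u -> abs_summable (fun n => k * u n).
Proof.
  intros Hu. apply abs_summable_le with (fun n => (Cmod k * Cmod (u n))%R).
  - intros n; rewrite Cmod_mult; lra.
  - exact (ex_series_scal (Cmod k) (fun n => Cmod (u n)) Hu).
Qed.

Lemma ex_series_tail (M : nat -> R) : ex_series M ->
  forall eps : R, (0 < eps)%R -> exists N, forall n m, (N <= n)%nat ->
   (Rabs (sum_n M m - sum_n M n) < eps \/ (m < n)%nat)%R.
Proof.
  intros [l Hl] eps He.
  assert (H := proj1 (filterlim_R_iff eventually (sum_n M) l) Hl (eps/2)%R ltac:(lra)).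
  destruct H as [N HN]. exists N. intros n m Hn.
  destruct (Nat.lt_ge_cases m n) as [h|h]; [right; exact h|left].
  assert (H1 := HN n Hn). assert (H2 := HN m ltac:(lia)).
  revert H1 H2. unfold Rabs. repeat destruct Rcase_abs; lra.
Qed.

Lemma Cmod_sum_diff (u : nat -> C) (M : nat -> R) n m : (n <= m)%nat ->
  (forall k, (Cmod (u k) <= M k)%R) ->
  (Cmod (sum_n u m - sum_n u n) <= sum_n M m - sum_n M n)%R.
Proof.
  intros Hnm H. induction Hnm as [|m Hm IH].
  - replace (sum_n u n - sum_n u n) with (RtoC 0) by ring. rewrite Cmod_0. lra.
  - rewrite csum_S, rsum_S.
    replace (sum_n u m + u (S m) - sum_n u n) with ((sum_n u m - sum_n u n) + u (S m)) by ring.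
    eapply Rle_trans; [apply Cmod_triangle|]. specialize (H (S m)). lra.
Qed.

Lemma series_tail_le (u : nat -> C) (M : nat -> R) (U : C) (N : nat) (eps : R) :
  is_series u U -> (forall k, (Cmod (u k) <= M k)%R) ->
  (forall m, (N <= m)%nat -> (sum_n M m - sum_n M N <= eps)%R) ->
  (Cmod (U - sum_n u N) <= eps)%R.
Proof.
  intros HU HM Ht.
  apply (filterlim_C_le eventually (fun m => sum_n u m - sum_n u N)).
  - apply (filterlim_C_iff eventually). intros e He.
    assert (H := proj1 (filterlim_C_iff eventually (sum_n u) U) HU e He).
    destruct H as [K HK]. exists K. intros m Hm.
    replace (sum_n u m - sum_n u N - (U - sum_n u N)) with (sum_n u m - U) by ring.
    apply HK, Hm.
  - exists N. intros m Hm. eapply Rle_trans; [apply Cmod_sum_diff with (M:=M); assumption|].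
    apply Ht, Hm.
Qed.

Lemma filterlim_C_plus {T} (F : (T -> Prop) -> Prop) {FF : Filter F} (f g : T -> C) (a b : C) :
  filterlim f F (locally a) -> filterlim g F (locally b) ->
  filterlim (fun x => f x + g x) F (locally (a + b)).
Proof.
  intros Hf Hg. apply (filterlim_C_iff F). intros eps He.
  apply (proj1 (filterlim_C_iff F _ _)) with (eps := (eps / 2)%R) in Hf; [|lra].
  apply (proj1 (filterlim_C_iff F _ _)) with (eps := (eps / 2)%R) in Hg; [|lra].
  refine (filter_imp _ _ _ (filter_and _ _ Hf Hg)).
  intros x [h1 h2]. replace (f x + g x - (a + b)) with ((f x - a) + (g x - b)) by ring.
  eapply Rle_lt_trans; [apply Cmod_triangle|lra].
Qed.

Lemma filterlim_C_sum {T} (F : (T -> Prop) -> Prop) {FF : Filter F} (u : T -> nat -> C) (v : nat -> C) :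
  (forall n, filterlim (fun x => u x n) F (locally (v n))) ->
  forall N, filterlim (fun x => sum_n (u x) N) F (locally (sum_n v N)).
Proof.
  intros H N. induction N as [|N IH].
  - rewrite csum_0. eapply filterlim_ext; [|apply (H 0%nat)].
    intros x; cbv beta; rewrite csum_0; reflexivity.
  - rewrite csum_S. eapply filterlim_ext; [|apply (filterlim_C_plus F); [apply IH|apply (H (S N))]].
    intros x; cbv beta; rewrite csum_S; reflexivity.
Qed.

(** Dominated convergence for series.  A filter on an arbitrary type is allowed
    because the limit is taken over partial sums in [fubini] and over a complex
    parameter in [scaled1F1_eq]. *)
Lemma tannery {T} (F : (T -> Prop) -> Prop) {FF : ProperFilter F}
  (u : T -> nat -> C) (v : nat -> C) (M : nat -> R) (U : T -> C) (V : C) :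
  ex_series M ->
  F (fun x => forall n, (Cmod (u x n) <= M n)%R) ->
  (forall n, filterlim (fun x => u x n) F (locally (v n))) ->
  F (fun x => is_series (u x) (U x)) -> is_series v V ->
  filterlim U F (locally V).
Proof.
  intros HM Hu Hlim HU HV.
  assert (Hv : forall n, (Cmod (v n) <= M n)%R).
  { intros n. apply (filterlim_C_le F (fun x => u x n)); [apply Hlim|].
    refine (filter_imp _ _ _ Hu); intros x Hx; apply Hx. }
  apply (filterlim_C_iff F). intros eps He.
  destruct (ex_series_tail M HM (eps/4)%R ltac:(lra)) as [N HN].
  assert (Ht : forall m, (N <= m)%nat -> (sum_n M m - sum_n M N <= eps/4)%R).
  { intros m Hm. destruct (HN N m (le_n _)) as [h|h]; [|lia].
    revert h; unfold Rabs; destruct Rcase_abs; lra. }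
  assert (H1 := proj1 (filterlim_C_iff F _ _) (filterlim_C_sum F u v Hlim N) (eps/4)%R ltac:(lra)).
  assert (H2 := series_tail_le v M V N _ HV Hv Ht).
  refine (filter_imp _ _ _ (filter_and _ _ (filter_and _ _ Hu HU) H1)).
  intros x [[h1 h2] h3].
  assert (h4 := series_tail_le (u x) M (U x) N _ h2 h1 Ht).
  replace (U x - V) with ((U x - sum_n (u x) N) + (sum_n (u x) N - sum_n v N) + - (V - sum_n v N)) by ring.
  eapply Rle_lt_trans; [apply Cmod_triangle|]. rewrite Cmod_opp.
  eapply Rle_lt_trans; [apply Rplus_le_compat_r, Cmod_triangle|]. lra.
Qed.

Lemma is_series_sum_n (u : nat -> nat -> C) (l : nat -> C) N :
  (forall n, is_series (u n) (l n)) ->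
  is_series (fun m => sum_n (fun n => u n m) N) (sum_n l N).
Proof.
  intros H. induction N as [|N IH].
  - rewrite csum_0. eapply is_series_C_ext; [|apply (H 0%nat)].
    intros m; cbv beta; rewrite csum_0; reflexivity.
  - rewrite csum_S. eapply is_series_C_ext; [|apply is_series_C_plus; [apply IH | apply (H (S N))]].
    intros m; cbv beta; rewrite csum_S; reflexivity.
Qed.

Lemma Series_sum_n (a : nat -> nat -> R) N :
  (forall n, ex_series (a n)) ->
  ex_series (fun m => sum_n (fun n => a n m) N) /\
  Series (fun m => sum_n (fun n => a n m) N) = sum_n (fun n => Series (a n)) N.
Proof.
  intros H. induction N as [|N [IH1 IH2]].
  - rewrite rsum_0. split.
    + eapply ex_series_ext; [|apply (H 0%nat)]. intros m; cbv beta; rewrite rsum_0; reflexivity.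
    + apply Series_ext. intros m; rewrite rsum_0; reflexivity.
  - rewrite rsum_S. split.
    + eapply ex_series_ext; [|apply ex_series_plus; [apply IH1 | apply (H (S N))]].
      intros m; cbv beta; rewrite rsum_S; reflexivity.
    + rewrite <- IH2, <- Series_plus; [|exact IH1|apply H].
      apply Series_ext. intros m; rewrite rsum_S; reflexivity.
Qed.

Lemma tonelli (a : nat -> nat -> R) :
  (forall n m, (0 <= a n m)%R) -> (forall n, ex_series (a n)) ->
  ex_series (fun n => Series (a n)) ->
  (forall m, ex_series (fun n => a n m)) /\ ex_series (fun m => Series (fun n => a n m)).
Proof.
  intros Hp H1 H2.
  assert (H3 : forall m, ex_series (fun n => a n m)).
  { intros m. apply ex_series_le_pos with (fun n => Series (a n)); [|exact H2].
    intros n; split; [apply Hp|].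
    eapply Rle_trans; [|apply (rsum_le_Series (a n) (Hp n) (H1 n) m)].
    destruct m; [rewrite rsum_0; lra|rewrite rsum_S].
    assert (H := rsum_pos (a n) (Hp n) m). lra. }
  split; [exact H3|].
  apply ex_series_bounded with (Series (fun n => Series (a n))).
  - intros m. apply Series_nonneg; [apply H3 | intros; apply Hp].
  - intros M. destruct (Series_sum_n (fun m n => a n m) M H3) as [E1 E2].
    rewrite <- E2. apply Series_le; [|exact H2].
    intros n; split; [apply rsum_pos; intros; apply Hp|].
    apply (rsum_le_Series (a n)); [apply Hp|apply H1].
Qed.

(** The partial sums over n are series in m dominated by the row sums of the
    absolute values, so [tannery] exchanges limit and sum. *)
Lemma fubini (u : nat -> nat -> C) :
  (forall n, abs_summable (u n)) ->
  ex_series (fun n => Series (fun m => Cmod (u n m))) ->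
  (forall m, abs_summable (fun n => u n m)) /\
  abs_summable (fun n => Csum (u n)) /\
  abs_summable (fun m => Csum (fun n => u n m)) /\
  exists S : C, is_series (fun n => Csum (u n)) S /\ is_series (fun m => Csum (fun n => u n m)) S.
Proof.
  intros H1 H2.
  destruct (tonelli (fun n m => Cmod (u n m)) (fun n m => Cmod_ge_0 _) H1 H2) as [H3 H4].
  assert (A1 : abs_summable (fun n => Csum (u n))).
  { eapply abs_summable_le; [|exact H2]. intros n. apply Cmod_Csum_le, H1. }
  assert (A2 : abs_summable (fun m => Csum (fun n => u n m))).
  { eapply abs_summable_le; [|exact H4]. intros n; cbv beta. apply Cmod_Csum_le, H3. }
  split; [exact H3|]. split; [exact A1|]. split; [exact A2|].
  exists (Csum (fun m => Csum (fun n => u n m))). split; [|apply abs_summable_is, A2].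
  apply (tannery eventually (fun N m => sum_n (fun n => u n m) N)
           (fun m => Csum (fun n => u n m)) (fun m => Series (fun n => Cmod (u n m)))).
  - exact H4.
  - exists 0%nat. intros N _ m. eapply Rle_trans; [apply Cmod_sum_le|].
    apply (rsum_le_Series (fun n => Cmod (u n m))); [intros; apply Cmod_ge_0|apply H3].
  - intros m. exact (abs_summable_is _ (H3 m)).
  - exists 0%nat. intros N _. apply is_series_sum_n. intros n. apply abs_summable_is, H1.
  - apply abs_summable_is, A2.
Qed.

(** The two hypotheses of [fubini], from a bound by a product. *)
Lemma product_bound_summable (u : nat -> nat -> C) (a b : nat -> R) :
  (forall n m, (Cmod (u n m) <= a n * b m)%R) -> (forall n, (0 <= a n)%R) -> (forall m, (0 <= b m)%R) ->
  ex_series a -> ex_series b ->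
  (forall n, abs_summable (u n)) /\ ex_series (fun n => Series (fun m => Cmod (u n m))).
Proof.
  intros H Ha Hb Ea Eb.
  assert (A : forall n, abs_summable (u n)).
  { intros n. apply abs_summable_le with (fun m => (a n * b m)%R); [apply H|].
    apply (ex_series_scal (a n) b Eb). }
  split; [exact A|].
  apply ex_series_le_pos with (fun n => (a n * Series b)%R).
  - intros n; split.
    + apply Series_nonneg; [apply A|intros; apply Cmod_ge_0].
    + rewrite <- Series_scal_l. apply Series_le; [|apply (ex_series_scal (a n) b Eb)].
      intros m; split; [apply Cmod_ge_0|apply H].
  - apply ex_series_scal_r, Ea.
Qed.

Lemma is_series_finite (u : nat -> C) N :
  (forall n, (N < n)%nat -> u n = 0) -> is_series u (sum_n u N).
Proof.
  intros H. apply (filterlim_C_iff eventually). intros eps He. exists N. intros n Hn.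
  assert (E : sum_n u n = sum_n u N).
  { induction Hn as [|m Hm IH]; [reflexivity|].
    rewrite csum_S, IH, H by lia. apply Cplus_0_r. }
  change (Cmod (sum_n u n - sum_n u N) < eps)%R.
  rewrite E. replace (sum_n u N - sum_n u N) with (RtoC 0) by ring. rewrite Cmod_0. exact He.
Qed.

Lemma is_series_C_incr_1 (u : nat -> C) (l : C) :
  is_series u l <-> is_series (fun n => u (S n)) (l - u 0%nat).
Proof.
  split; intros H.
  - apply is_series_incr_1. change (is_series u ((l - u 0%nat) + u 0%nat)).
    replace (l - u 0%nat + u 0%nat) with l by ring. exact H.
  - apply is_series_decr_1. exact H.
Qed.

Lemma is_series_shift0 (u : nat -> C) (n : nat) (l : C) :
  is_series u l <->
  is_series (fun k => if (k <? n)%nat then RtoC 0 else u (k - n)%nat) l.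
Proof.
  revert l. induction n as [|n IH]; intros l.
  - split; apply is_series_C_ext; intros k; simpl; rewrite Nat.sub_0_r; reflexivity.
  - etransitivity; [apply IH|]. symmetry. etransitivity; [apply is_series_C_incr_1|]. cbv beta.
    match goal with |- is_series _ ?e <-> _ => assert (E : e = l) end.
    { change (l - RtoC 0 = l). ring. }
    rewrite E. split; apply is_series_C_ext; intros k; simpl; reflexivity.
Qed.

Lemma abs_summable_shift0 (u : nat -> C) (n : nat) : abs_summable u ->
  abs_summable (fun k => if (k <? n)%nat then RtoC 0 else u (k - n)%nat) /\
  Series (fun k => Cmod (if (k <? n)%nat then RtoC 0 else u (k - n)%nat)) = Series (fun k => Cmod (u k)).
Proof.
  intros H. induction n as [|n [IH1 IH2]].
  - split.
    + eapply abs_summable_ext; [|apply H]. intros k; simpl; rewrite Nat.sub_0_r; reflexivity.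
    + apply Series_ext. intros k; simpl; rewrite Nat.sub_0_r; reflexivity.
  - assert (A : abs_summable (fun k => if (k <? S n)%nat then RtoC 0 else u (k - S n)%nat)).
    { apply ex_series_incr_1. eapply ex_series_ext; [|exact IH1]. intros k; simpl; reflexivity. }
    split; [exact A|]. rewrite Series_incr_1; [|exact A].
    change (Cmod (if (0 <? S n)%nat then RtoC 0 else u (0 - S n)%nat)) with (Cmod 0).
    rewrite Cmod_0, Rplus_0_l. rewrite <- IH2.
    apply Series_ext; intros k; reflexivity.
Qed.

(** Shifting the n-th row to the right by n turns diagonals into columns. *)
Lemma fubini_diag (u : nat -> nat -> C) :
  (forall n, abs_summable (u n)) ->
  ex_series (fun n => Series (fun m => Cmod (u n m))) ->
  exists S : C, is_series (fun n => Csum (u n)) S /\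
    is_series (fun k => sum_n (fun n => u n (k - n)%nat) k) S /\
    abs_summable (fun k => sum_n (fun n => u n (k - n)%nat) k).
Proof.
  intros H1 H2.
  set (w := fun n k => if (k <? n)%nat then RtoC 0 else u n (k - n)%nat).
  assert (W : forall n, abs_summable (w n) /\ Series (fun k => Cmod (w n k)) = Series (fun k => Cmod (u n k))).
  { intros n. apply (abs_summable_shift0 (u n) n (H1 n)). }
  destruct (fubini w) as [F1 [F2 [F3 [S [F4 F5]]]]].
  - intros n; apply W.
  - eapply ex_series_ext; [|exact H2]. intros n; cbv beta; symmetry; apply W.
  - assert (E : forall k, Csum (fun n => w n k) = sum_n (fun n => u n (k - n)%nat) k).
    { intros k. apply Csum_unique.
      replace (sum_n (fun n => u n (k - n)%nat) k) with (sum_n (fun n => w n k) k).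
      - apply is_series_finite. intros n Hn. unfold w.
        rewrite (proj2 (Nat.ltb_lt k n) Hn). reflexivity.
      - apply sum_n_ext_loc. intros n Hn. unfold w.
        rewrite (proj2 (Nat.ltb_ge k n) Hn). reflexivity. }
    exists S. split; [|split].
    + eapply is_series_C_ext; [|exact F4]. intros n; cbv beta. apply Csum_unique.
      apply (is_series_shift0 (u n) n). apply abs_summable_is, H1.
    + eapply is_series_C_ext; [|exact F5]. intros k; apply E.
    + eapply abs_summable_ext; [|exact F3]. intros k; apply E.
Qed.

Definition cauchy_prod (a b : nat -> C) (n : nat) : C := sum_n (fun k => a k * b (n - k)%nat) n.

Lemma is_series_cauchy (a b : nat -> C) (la lb : C) :
  abs_summable a -> abs_summable b -> is_series a la -> is_series b lb ->
  is_series (cauchy_prod a b) (la * lb) /\ abs_summable (cauchy_prod a b).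
Proof.
  intros Ha Hb La Lb.
  destruct (product_bound_summable (fun n m => a n * b m) (fun n => Cmod (a n)) (fun n => Cmod (b n))) as [P1 P2];
    try (intros; apply Cmod_ge_0); try assumption.
  { intros; rewrite Cmod_mult; lra. }
  destruct (fubini_diag _ P1 P2) as [S [S1 [S2 S3]]].
  split; [|exact S3].
  assert (E : S = la * lb).
  { apply (is_series_C_unique _ _ _ S1).
    apply is_series_C_ext with (fun n => lb * a n).
    - intros n. symmetry. apply Csum_unique. rewrite Cmult_comm. apply is_series_C_scal, Lb.
    - rewrite Cmult_comm. apply is_series_C_scal, La. }
  rewrite <- E. exact S2.
Qed.

(** * Power series and analytic functions *)

Lemma is_pseries_C (a : nat -> C) (h v : C) :
  is_pseries a h v <-> is_series (fun n => a n * h ^ n) v.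
Proof.
  unfold is_pseries. split; apply is_series_C_ext; intros n.
  - exact (Cmult_comm (h ^ n) (a n)).
  - exact (Cmult_comm (a n) (h ^ n)).
Qed.

Lemma ex_series_geom_scal (M q : R) : (0 <= q < 1)%R -> ex_series (fun n => M * q ^ n)%R.
Proof.
  intros Hq. apply (ex_series_scal M (fun n => q ^ n)%R).
  apply ex_series_geom. rewrite Rabs_pos_eq; lra.
Qed.

Lemma eventually_bounded (u : nat -> C) (M : R) (N : nat) :
  (forall n, (N <= n)%nat -> (Cmod (u n) <= M)%R) -> exists M', (0 < M')%R /\ forall n, (Cmod (u n) <= M')%R.
Proof.
  revert M. induction N as [|N IH]; intros M H.
  - exists (Rmax M 1). split; [assert (h := Rmax_r M 1); lra|].
    intros n. eapply Rle_trans; [apply H; lia|apply Rmax_l].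
  - apply (IH (Rmax M (Cmod (u N)))). intros n Hn.
    destruct (Nat.eq_dec n N) as [->|h]; [apply Rmax_r|].
    eapply Rle_trans; [apply H; lia|apply Rmax_l].
Qed.

Lemma ex_series_terms_bounded (u : nat -> C) : ex_series u ->
  exists M, (0 < M)%R /\ forall n, (Cmod (u n) <= M)%R.
Proof.
  intros [l Hl].
  assert (H := proj1 (filterlim_C_iff eventually (sum_n u) l) Hl 1%R ltac:(lra)).
  destruct H as [N HN]. apply (eventually_bounded u 2 (S N)).
  intros n Hn. destruct n as [|n]; [lia|].
  replace (u (S n)) with ((sum_n u (S n) - l) + - (sum_n u n - l)).
  2:{ rewrite csum_S. cring. }
  eapply Rle_trans; [apply Cmod_triangle|]. rewrite Cmod_opp.
  assert (H1 := HN (S n) ltac:(lia)). assert (H2 := HN n ltac:(lia)). lra.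
Qed.

Lemma pseries_abs (a : nat -> C) (r rho : R) : (0 <= rho < r)%R ->
  (forall h, (Cmod h < r)%R -> ex_series (fun n => a n * h ^ n)) ->
  ex_series (fun n => Cmod (a n) * rho ^ n)%R.
Proof.
  intros Hr H.
  set (r' := ((rho + r) / 2)%R).
  assert (Hr' : (rho < r' < r)%R) by (unfold r'; lra).
  destruct (ex_series_terms_bounded _ (H (RtoC r') ltac:(rewrite Cmod_R, Rabs_pos_eq; lra))) as [M [HM HB]].
  apply ex_series_le_pos with (fun n => M * (rho / r') ^ n)%R.
  - intros n. assert (Hp := pow_le rho n ltac:(lra)). assert (Hc := Cmod_ge_0 (a n)). split; [nra|].
    specialize (HB n). rewrite Cmod_mult, Cmod_pow, Cmod_R, (Rabs_pos_eq r') in HB by lra.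
    unfold Rdiv. rewrite Rpow_mult_distr, pow_inv.
    assert (Hp' := pow_lt r' n ltac:(lra)).
    replace (Cmod (a n) * rho ^ n)%R with ((Cmod (a n) * r' ^ n) * (rho ^ n * / r' ^ n))%R by (field; lra).
    apply Rmult_le_compat_r; [|exact HB].
    apply Rmult_le_pos; [exact Hp|]. left. apply Rinv_0_lt_compat, Hp'.
  - apply ex_series_geom_scal. split.
    + apply Rmult_le_pos; [lra|]. left; apply Rinv_0_lt_compat; lra.
    + apply (Rmult_lt_reg_r r'); [lra|]. unfold Rdiv. rewrite Rmult_assoc, Rinv_l; lra.
Qed.

Lemma pseries_abs_at (a : nat -> C) (h : C) (rho : R) : (Cmod h <= rho)%R ->
  ex_series (fun n => Cmod (a n) * rho ^ n)%R -> abs_summable (fun n => a n * h ^ n).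
Proof.
  intros Hh H. apply abs_summable_le with (2:=H). intros n.
  rewrite Cmod_mult, Cmod_pow. apply Rmult_le_compat_l; [apply Cmod_ge_0|].
  apply pow_incr. split; [apply Cmod_ge_0|exact Hh].
Qed.

(** For small radius the absolute sum is close to the modulus of the constant
    term; this is what keeps a composite inside the outer disc of convergence. *)
Lemma Series_small (a : nat -> C) (rho0 : R) : (0 < rho0)%R ->
  ex_series (fun n => Cmod (a n) * rho0 ^ n)%R ->
  exists K, (0 <= K)%R /\ forall rho, (0 <= rho <= rho0)%R ->
    ex_series (fun n => Cmod (a n) * rho ^ n)%R /\
    (Series (fun n => Cmod (a n) * rho ^ n) <= Cmod (a 0%nat) + K * rho)%R.
Proof.
  intros H0 H.
  assert (HE : forall rho, (0 <= rho <= rho0)%R -> ex_series (fun n => Cmod (a n) * rho ^ n)%R).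
  { intros rho Hr. apply ex_series_le_pos with (2:=H). intros n.
    assert (Hc := Cmod_ge_0 (a n)). assert (Hp := pow_le rho n ltac:(lra)).
    split; [nra|]. apply Rmult_le_compat_l; [exact Hc|]. apply pow_incr; lra. }
  assert (H1 : ex_series (fun n => Cmod (a (S n)) * rho0 ^ n)%R).
  { apply (ex_series_ext (fun n => / rho0 * (Cmod (a (S n)) * rho0 ^ S n))%R).
    - intros n. simpl. field. lra.
    - apply (ex_series_scal (/ rho0)%R (fun n => Cmod (a (S n)) * rho0 ^ S n)%R).
      apply (proj1 (ex_series_incr_1 (fun n => Cmod (a n) * rho0 ^ n)%R) H). }
  exists (Series (fun n => Cmod (a (S n)) * rho0 ^ n)%R). split.
  - apply Series_nonneg; [exact H1|]. intros n. apply Rmult_le_pos; [apply Cmod_ge_0|apply pow_le; lra].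
  - intros rho Hr. split; [apply HE, Hr|].
    rewrite Series_incr_1; [|apply HE, Hr]. simpl pow at 1. rewrite Rmult_1_r.
    apply Rplus_le_compat_l. rewrite <- Series_scal_r.
    apply Series_le.
    + intros n. assert (Hc := Cmod_ge_0 (a (S n))). assert (Hp := pow_le rho n ltac:(lra)). simpl. split.
      * apply Rmult_le_pos; [exact Hc|]. nra.
      * rewrite (Rmult_comm rho), <- Rmult_assoc. apply Rmult_le_compat_r; [lra|].
        apply Rmult_le_compat_l; [exact Hc|]. apply pow_incr; lra.
    + apply ex_series_scal_r, H1.
Qed.

Lemma pseries_at_0 (a : nat -> C) : is_series (fun n => a n * 0 ^ n) (a 0%nat).
Proof.
  replace (a 0%nat) with (sum_n (fun n => a n * 0 ^ n) 0).
  - apply is_series_finite. intros n Hn. destruct n; [lia|]. rewrite Cpow_S. ring.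
  - rewrite csum_0. simpl. cring.
Qed.

Lemma is_series_single (k : C) : is_series (fun n => if (n =? 0)%nat then k else RtoC 0) k.
Proof.
  apply (is_series_C_ext (fun n => (fun n => if (n =? 0)%nat then k else RtoC 0) n * 0 ^ n)).
  - intros n; destruct n; simpl; cring.
  - exact (pseries_at_0 (fun n => if (n =? 0)%nat then k else RtoC 0)).
Qed.

Lemma pseries_near_0 (a : nat -> C) (r : R) (f : C -> C) : (0 < r)%R ->
  (forall h, (Cmod h < r)%R -> is_series (fun n => a n * h ^ n) (f h)) ->
  exists K rho, (0 < rho < r)%R /\ (0 <= K)%R /\ forall h, (Cmod h <= rho)%R -> (Cmod (f h - a 0%nat) <= K * Cmod h)%R.
Proof.
  intros Hr H.
  assert (H0 : ex_series (fun n => Cmod (a n) * (r/2) ^ n)%R).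
  { apply pseries_abs with r; [lra|]. intros h Hh. exists (f h). apply H, Hh. }
  destruct (Series_small (fun n => if (n =? 0)%nat then RtoC 0 else a n) (r/2)%R ltac:(lra)) as [K [HK HB]].
  { apply ex_series_le_pos with (2:=H0). intros n. 
    assert (Hp := pow_le (r/2) n ltac:(lra)). assert (Hc := Cmod_ge_0 (a n)).
    destruct n; simpl Nat.eqb; cbv iota; [rewrite Cmod_0; nra|nra]. }
  exists K, (r/2)%R. split; [lra|]. split; [exact HK|]. intros h Hh.
  destruct (HB (Cmod h)) as [B1 B2]; [split; [apply Cmod_ge_0|exact Hh]|].
  simpl Nat.eqb in B2; cbv iota in B2; rewrite Cmod_0, Rplus_0_l in B2.
  eapply Rle_trans; [|exact B2].
  apply (Cmod_series_le (fun n => (if (n =? 0)%nat then RtoC 0 else a n) * h ^ n)); [|intros n; rewrite Cmod_mult, Cmod_pow; lra|exact B1].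
  assert (HS : is_series (fun n => a n * h ^ n - (if (n =? 0)%nat then a 0%nat else RtoC 0)) (f h - a 0%nat)).
  { apply is_series_C_minus; [apply H; lra|].
    apply is_series_single. }
  eapply is_series_C_ext; [|exact HS]. intros n; destruct n; simpl; cring.
Qed.

Lemma cauchy_bound (a b : nat -> C) : abs_summable a -> abs_summable b ->
  abs_summable (cauchy_prod a b) /\
  (Series (fun n => Cmod (cauchy_prod a b n)) <=
   Series (fun n => Cmod (a n)) * Series (fun n => Cmod (b n)))%R.
Proof.
  intros Ha Hb.
  assert (H := is_series_mult (fun n => Cmod (a n)) (fun n => Cmod (b n)) _ _
    (Series_correct _ Ha) (Series_correct _ Hb)).
  assert (HH : is_series (fun n => sum_f_R0 (fun k => Cmod (a k) * Cmod (b (n - k)%nat))%R n)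
    (Series (fun n => Cmod (a n)) * Series (fun n => Cmod (b n)))%R).
  { apply H.
    - eapply ex_series_ext; [|exact Ha]. intros n; cbv beta; rewrite Rabs_pos_eq; [reflexivity|apply Cmod_ge_0].
    - eapply ex_series_ext; [|exact Hb]. intros n; cbv beta; rewrite Rabs_pos_eq; [reflexivity|apply Cmod_ge_0]. }
  assert (L : forall n, (0 <= Cmod (cauchy_prod a b n) <= sum_f_R0 (fun k => Cmod (a k) * Cmod (b (n - k)%nat))%R n)%R).
  { intros n. split; [apply Cmod_ge_0|]. unfold cauchy_prod.
    eapply Rle_trans; [apply Cmod_sum_le|]. rewrite <- sum_n_Reals.
    apply rsum_le. intros k _. rewrite Cmod_mult. lra. }
  split.
  - eapply ex_series_le_pos; [exact L|]. eexists; exact HH.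
  - rewrite <- (is_series_unique _ _ HH). apply Series_le; [exact L|]. eexists; exact HH.
Qed.

Lemma sum_n_scal_C (u : nat -> C) (k : C) N : sum_n (fun n => u n * k) N = sum_n u N * k.
Proof.
  induction N as [|N IH]; [rewrite !csum_0; reflexivity|].
  rewrite !csum_S, IH. cring.
Qed.

Lemma cauchy_prod_pow (a b : nat -> C) (h : C) n :
  cauchy_prod (fun m => a m * h ^ m) (fun m => b m * h ^ m) n = cauchy_prod a b n * h ^ n.
Proof.
  unfold cauchy_prod. rewrite <- sum_n_scal_C. apply sum_n_ext_loc. intros k Hk.
  replace (h ^ n) with (h ^ k * h ^ (n - k)); [cring|].
  rewrite <- Cpow_add_r. f_equal. lia.
Qed.

(** Coefficients of the n-th power of the series with coefficients [b]. *)
Fixpoint pser_pow (b : nat -> C) (n : nat) : nat -> C :=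
  match n with
  | O => fun m => if (m =? 0)%nat then RtoC 1 else RtoC 0
  | S n => cauchy_prod b (pser_pow b n)
  end.

Lemma pser_pow_spec (b : nat -> C) (rho : R) (g : C -> C) : (0 <= rho)%R ->
  ex_series (fun n => Cmod (b n) * rho ^ n)%R ->
  (forall h, (Cmod h <= rho)%R -> is_series (fun n => b n * h ^ n) (g h)) ->
  forall n,
  (ex_series (fun m => Cmod (pser_pow b n m) * rho ^ m)%R /\
   (Series (fun m => Cmod (pser_pow b n m) * rho ^ m) <= Series (fun m => Cmod (b m) * rho ^ m) ^ n)%R) /\
  (forall h, (Cmod h <= rho)%R -> is_series (fun m => pser_pow b n m * h ^ m) (g h ^ n)).
Proof.
  intros Hr Hb Hg.
  assert (E : forall c : nat -> C, forall m, Cmod (c m * RtoC rho ^ m) = (Cmod (c m) * rho ^ m)%R).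
  { intros c m. rewrite Cmod_mult, Cmod_pow, Cmod_R, Rabs_pos_eq by exact Hr. reflexivity. }
  induction n as [|n [[IH1 IH2] IH3]].
  - assert (Z : forall h, is_series (fun m => pser_pow b 0 m * h ^ m) (RtoC 1)).
    { intros h. eapply is_series_C_ext; [|apply (is_series_single (RtoC 1))].
      intros m; destruct m; simpl; cring. }
    assert (ZR : is_series (fun m => Cmod (pser_pow b 0 m) * rho ^ m)%R 1%R).
    { apply is_series_decr_1. change (plus 1%R (opp (Cmod (pser_pow b 0 0) * rho ^ 0)%R)) with (1 - (Cmod 1 * 1))%R.
      rewrite Cmod_1. replace (1 - 1 * 1)%R with 0%R by ring.
      apply (is_series_ext (fun n => 0 * (/ 2) ^ n)%R).
      - intros m. simpl. rewrite Cmod_0. rewrite !Rmult_0_l. reflexivity.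
      - assert (G := is_series_scal 0%R (fun n => (/ 2) ^ n)%R _
          (is_series_geom (/ 2)%R ltac:(rewrite Rabs_pos_eq; lra))).
        change (is_series (fun n => 0 * (/ 2) ^ n)%R (0 * / (1 - / 2))%R) in G.
        rewrite Rmult_0_l in G. exact G. }
    split; [split; [eexists; exact ZR|]|].
    + rewrite (is_series_unique _ _ ZR). simpl. lra.
    + intros h _. simpl. apply Z.
  - assert (A1 : abs_summable (fun m => b m * RtoC rho ^ m)).
    { eapply ex_series_ext; [|exact Hb]. intros m; symmetry; apply E. }
    assert (A2 : abs_summable (fun m => pser_pow b n m * RtoC rho ^ m)).
    { eapply ex_series_ext; [|exact IH1]. intros m; symmetry; apply E. }
    destruct (cauchy_bound _ _ A1 A2) as [B1 B2].
    assert (F : forall m, Cmod (cauchy_prod (fun m => b m * RtoC rho ^ m)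
             (fun m => pser_pow b n m * RtoC rho ^ m) m) = (Cmod (pser_pow b (S n) m) * rho ^ m)%R).
    { intros m. rewrite cauchy_prod_pow, E. reflexivity. }
    split; [split|].
    + eapply ex_series_ext; [|exact B1]. exact F.
    + rewrite <- (Series_ext _ _ F). eapply Rle_trans; [exact B2|]. simpl.
      rewrite (Series_ext _ _ (E b)), (Series_ext _ _ (E (pser_pow b n))).
      apply Rmult_le_compat_l; [|exact IH2].
      apply Series_nonneg; [exact Hb|]. intros m. apply Rmult_le_pos; [apply Cmod_ge_0|apply pow_le, Hr].
    + intros h Hh. rewrite Cpow_S.
      eapply is_series_C_ext; [|apply (is_series_cauchy (fun m => b m * h ^ m) (fun m => pser_pow b n m * h ^ m))].
      * intros m. rewrite cauchy_prod_pow. reflexivity.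
      * apply pseries_abs_at with rho; assumption.
      * apply pseries_abs_at with rho; assumption.
      * apply Hg, Hh.
      * apply IH3, Hh.
Qed.

(** Substitution gives a double series in n (outer index) and m (power of h),
    which is absolutely convergent because the absolute sum of the inner series
    stays below the outer radius. *)
Lemma pseries_comp (a b : nat -> C) (f g : C -> C) (R0 rho : R) :
  (forall w, (Cmod w < R0)%R -> is_series (fun n => a n * w ^ n) (f w)) ->
  (0 < rho)%R ->
  ex_series (fun n => Cmod (b n) * rho ^ n)%R ->
  (Series (fun n => Cmod (b n) * rho ^ n) < R0)%R ->
  (forall h, (Cmod h <= rho)%R -> is_series (fun n => b n * h ^ n) (g h)) ->
  exists c : nat -> C, forall h, (Cmod h <= rho)%R -> is_series (fun n => c n * h ^ n) (f (g h)).
Proof.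
  intros Ha Hrho Hb HB Hg.
  set (B := Series (fun n => Cmod (b n) * rho ^ n)%R) in *.
  assert (HB0 : (0 <= B)%R).
  { apply Series_nonneg; [exact Hb|]. intros m. apply Rmult_le_pos; [apply Cmod_ge_0|apply pow_le; lra]. }
  assert (HaB : ex_series (fun n => Cmod (a n) * B ^ n)%R).
  { apply pseries_abs with R0; [lra|]. intros w Hw; exists (f w); apply Ha, Hw. }
  assert (SP := pser_pow_spec b rho g ltac:(lra) Hb Hg).
  assert (key : forall h, (Cmod h <= rho)%R ->
     (forall n, abs_summable (fun m => a n * (pser_pow b n m * h ^ m))) /\
     ex_series (fun n => Series (fun m => Cmod (a n * (pser_pow b n m * h ^ m))))).
  { intros h Hh.
    assert (S1 : forall n, abs_summable (fun m => pser_pow b n m * h ^ m)).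
    { intros n. apply pseries_abs_at with rho; [exact Hh|]. apply SP. }
    assert (S2 : forall n, (Series (fun m => Cmod (pser_pow b n m * h ^ m)) <= B ^ n)%R).
    { intros n. destruct (SP n) as [[SP1 SP2] _]. eapply Rle_trans; [|exact SP2].
      apply Series_le; [|exact SP1]. intros m. split; [apply Cmod_ge_0|].
      rewrite Cmod_mult, Cmod_pow. apply Rmult_le_compat_l; [apply Cmod_ge_0|].
      apply pow_incr; split; [apply Cmod_ge_0|exact Hh]. }
    split; [intros n; apply abs_summable_scal, S1|].
    apply ex_series_le_pos with (2 := HaB). intros n.
    assert (E : Series (fun m => Cmod (a n * (pser_pow b n m * h ^ m))) =
                (Cmod (a n) * Series (fun m => Cmod (pser_pow b n m * h ^ m)))%R).
    { rewrite <- Series_scal_l. apply Series_ext. intros m; apply Cmod_mult. }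
    rewrite E. split.
    - apply Rmult_le_pos; [apply Cmod_ge_0|]. apply Series_nonneg; [apply S1|intros; apply Cmod_ge_0].
    - apply Rmult_le_compat_l; [apply Cmod_ge_0|apply S2]. }
  exists (fun m => Csum (fun n => a n * pser_pow b n m)). intros h Hh.
  assert (Hsum : forall m, abs_summable (fun n => a n * pser_pow b n m)).
  { intros m. destruct (key (RtoC rho)) as [K1 K2]; [rewrite Cmod_R, Rabs_pos_eq; lra|].
    destruct (fubini _ K1 K2) as [F1 _]. specialize (F1 m).
    apply (abs_summable_scal (/ RtoC rho ^ m)) in F1. eapply abs_summable_ext; [|exact F1].
    intros n. cbv beta. field. apply Cpow_nz. intro h0. apply RtoC_inj in h0. lra. }
  destruct (key h Hh) as [K1 K2].
  destruct (fubini _ K1 K2) as [F1 [_ [_ [S [F4 F5]]]]].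
  assert (E : S = f (g h)).
  { apply (is_series_C_unique (fun n => a n * g h ^ n)).
    - eapply is_series_C_ext; [|exact F4]. intros n. cbv beta. apply Csum_unique.
      apply is_series_C_scal. apply SP, Hh.
    - apply Ha. eapply Rle_lt_trans; [|exact HB].
      apply (Cmod_series_le _ _ _ (Hg h Hh)); [|exact Hb].
      intros n. rewrite Cmod_mult, Cmod_pow. apply Rmult_le_compat_l; [apply Cmod_ge_0|].
      apply pow_incr; split; [apply Cmod_ge_0|exact Hh]. }
  rewrite <- E. eapply is_series_C_ext; [|exact F5].
  intros m. cbv beta. apply Csum_unique.
  rewrite Cmult_comm. eapply is_series_C_ext; [|apply is_series_C_scal, abs_summable_is, Hsum].
  intros n. cbv beta. ring.
Qed.

(** Near a point where the inner value lies inside the disc of the outer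
    series, the absolute sum of the inner series is still inside that disc. *)
Lemma pseries_comp_local (a b : nat -> C) (f g : C -> C) (R0 r : R) : (0 < r)%R ->
  (forall w, (Cmod w < R0)%R -> is_series (fun n => a n * w ^ n) (f w)) ->
  (forall h, (Cmod h < r)%R -> is_series (fun n => b n * h ^ n) (g h)) ->
  (Cmod (g 0) < R0)%R ->
  exists (rho : R) (c : nat -> C), (0 < rho)%R /\
    forall h, (Cmod h < rho)%R -> is_series (fun n => c n * h ^ n) (f (g h)).
Proof.
  intros Hr Ha Hb H0.
  assert (b0 : b 0%nat = g 0).
  { apply (is_series_C_unique _ _ _ (pseries_at_0 b)), Hb. rewrite Cmod_0; exact Hr. }
  assert (E0 : ex_series (fun n => Cmod (b n) * (r/2) ^ n)%R).
  { apply pseries_abs with r; [lra|]. intros h Hh; eexists; apply Hb, Hh. }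
  destruct (Series_small b (r/2)%R ltac:(lra) E0) as [K [HK HB]]. rewrite b0 in HB.
  set (d := ((R0 - Cmod (g 0)) / (2 * (K + 1)))%R).
  assert (Hd : (0 < d)%R) by (apply Rdiv_lt_0_compat; lra).
  assert (Ed : ((K + 1) * d = (R0 - Cmod (g 0)) / 2)%R) by (unfold d; field; lra).
  assert (Hrho : (0 < Rmin (r/2) d)%R) by (apply Rmin_pos; lra).
  assert (h1 := Rmin_l (r/2) d). assert (h2 := Rmin_r (r/2) d). set (rho := Rmin (r/2) d) in *.
  destruct (HB rho ltac:(lra)) as [HB1 HB2].
  destruct (pseries_comp a b f g R0 rho Ha Hrho HB1) as [c Hc].
  - eapply Rle_lt_trans; [exact HB2|].
    assert (K * rho <= (K + 1) * d)%R by (apply Rmult_le_compat; lra). lra.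
  - intros h Hh. apply Hb. lra.
  - exists rho, c. split; [exact Hrho|]. intros h Hh. apply Hc. lra.
Qed.

Definition analytic_at (f : C -> C) (z0 : C) : Prop :=
  exists (r : R) (coef : nat -> C), (0 < r)%R /\
    forall z : C, (Cmod (z - z0) < r)%R -> is_pseries coef (z - z0) (f z).

Lemma analytic_at_iff (f : C -> C) (z0 : C) :
  analytic_at f z0 <->
  exists (r : R) (coef : nat -> C), (0 < r)%R /\
    forall h : C, (Cmod h < r)%R -> is_series (fun n => coef n * h ^ n) (f (z0 + h)).
Proof.
  split; intros [r [c [Hr H]]]; exists r, c; split; try exact Hr.
  - intros h Hh. apply is_pseries_C. specialize (H (z0 + h)).
    replace (z0 + h - z0) with h in H by ring. apply H, Hh.
  - intros z Hz. apply is_pseries_C. specialize (H _ Hz).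
    replace (z0 + (z - z0)) with z in H by ring. exact H.
Qed.

Lemma analytic_at_comp (f g : C -> C) (z0 : C) :
  analytic_at g z0 -> analytic_at f (g z0) -> analytic_at (fun z => f (g z)) z0.
Proof.
  rewrite !analytic_at_iff. intros [r [b [Hr Hb]]] [R0 [a [HR Ha]]].
  destruct (pseries_comp_local a (fun n => b n - (if (n =? 0)%nat then g z0 else RtoC 0))
     (fun w => f (g z0 + w)) (fun h => g (z0 + h) - g z0) R0 r Hr Ha) as [rho [c [Hrho Hc]]].
  - intros h Hh.
    eapply is_series_C_ext; [|apply (is_series_C_minus _ _ _ _ (Hb h Hh) (is_series_single (g z0)))].
    intros [|n]; simpl; cring.
  - rewrite Cplus_0_r. replace (g z0 - g z0) with (RtoC 0) by ring. rewrite Cmod_0. exact HR.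
  - exists rho, c. split; [exact Hrho|]. intros h Hh. specialize (Hc h Hh). cbv beta in Hc.
    replace (g z0 + (g (z0 + h) - g z0)) with (g (z0 + h)) in Hc by ring. exact Hc.
Qed.

Lemma analytic_at_ext (f g : C -> C) (z0 : C) (r : R) : (0 < r)%R ->
  (forall z, (Cmod (z - z0) < r)%R -> f z = g z) -> analytic_at f z0 -> analytic_at g z0.
Proof.
  intros Hr H [r' [c [Hr' Hc]]]. exists (Rmin r r'), c. split; [apply Rmin_pos; assumption|].
  intros z Hz. rewrite <- H.
  - apply Hc. eapply Rlt_le_trans; [exact Hz|apply Rmin_r].
  - eapply Rlt_le_trans; [exact Hz|apply Rmin_l].
Qed.

Lemma analytic_at_plus (f g : C -> C) (z0 : C) :
  analytic_at f z0 -> analytic_at g z0 -> analytic_at (fun z => f z + g z) z0.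
Proof.
  rewrite !analytic_at_iff. intros [r [a [Hr Ha]]] [r' [b [Hr' Hb]]].
  exists (Rmin r r'), (fun n => a n + b n). split; [apply Rmin_pos; assumption|].
  intros h Hh.
  assert (h1 : (Cmod h < r)%R) by (eapply Rlt_le_trans; [exact Hh|apply Rmin_l]).
  assert (h2 : (Cmod h < r')%R) by (eapply Rlt_le_trans; [exact Hh|apply Rmin_r]).
  eapply is_series_C_ext; [|apply is_series_C_plus; [apply Ha, h1|apply Hb, h2]].
  intros n; cbv beta; ring.
Qed.

Lemma analytic_at_mult (f g : C -> C) (z0 : C) :
  analytic_at f z0 -> analytic_at g z0 -> analytic_at (fun z => f z * g z) z0.
Proof.
  rewrite !analytic_at_iff. intros [r [a [Hr Ha]]] [r' [b [Hr' Hb]]].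
  exists (Rmin r r'), (cauchy_prod a b). split; [apply Rmin_pos; assumption|].
  intros h Hh.
  assert (h1 : (Cmod h < r)%R) by (eapply Rlt_le_trans; [exact Hh|apply Rmin_l]).
  assert (h2 : (Cmod h < r')%R) by (eapply Rlt_le_trans; [exact Hh|apply Rmin_r]).
  assert (P := Cmod_ge_0 h).
  eapply is_series_C_ext; [|apply (is_series_cauchy (fun m => a m * h ^ m) (fun m => b m * h ^ m))].
  - intros n. apply cauchy_prod_pow.
  - apply pseries_abs_at with (Cmod h); [lra|]. apply pseries_abs with r; [lra|].
    intros w Hw; eexists; apply Ha, Hw.
  - apply pseries_abs_at with (Cmod h); [lra|]. apply pseries_abs with r'; [lra|].
    intros w Hw; eexists; apply Hb, Hw.
  - apply Ha, h1.
  - apply Hb, h2.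
Qed.

Lemma analytic_at_const (k z0 : C) : analytic_at (fun _ => k) z0.
Proof.
  apply analytic_at_iff. exists 1%R, (fun n => if (n =? 0)%nat then k else RtoC 0). split; [lra|].
  intros h _. eapply is_series_C_ext; [|apply (is_series_single k)].
  intros n; destruct n; simpl; cring.
Qed.

Lemma analytic_at_id (z0 : C) : analytic_at (fun z => z) z0.
Proof.
  apply analytic_at_iff. exists 1%R, (fun n => match n with 0%nat => z0 | 1%nat => RtoC 1 | _ => RtoC 0 end).
  split; [lra|]. intros h _.
  replace (z0 + h) with (sum_n (fun n => (match n with 0%nat => z0 | 1%nat => RtoC 1 | _ => RtoC 0 end) * h ^ n) 1).
  - apply is_series_finite. intros n Hn; destruct n as [|[|n]]; [lia|lia|]. ring.
  - rewrite csum_S, csum_0; simpl; cring.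
Qed.

Lemma analytic_at_scal (k : C) (f : C -> C) (z0 : C) :
  analytic_at f z0 -> analytic_at (fun z => k * f z) z0.
Proof. intros H. apply analytic_at_mult; [apply analytic_at_const|exact H]. Qed.

Lemma analytic_at_minus (f g : C -> C) (z0 : C) :
  analytic_at f z0 -> analytic_at g z0 -> analytic_at (fun z => f z - g z) z0.
Proof.
  intros Hf Hg. apply (analytic_at_ext (fun z => f z + (-(1)) * g z) _ z0 1); [lra| |].
  - intros z _. ring.
  - apply analytic_at_plus; [exact Hf|apply analytic_at_scal, Hg].
Qed.

Lemma pow_Cmod_abs (q : C) : (Cmod q < 1)%R -> abs_summable (fun n => q ^ n).
Proof.
  intros H. unfold abs_summable. eapply ex_series_ext; [intros n; symmetry; apply Cmod_pow|].
  apply ex_series_geom. rewrite Rabs_pos_eq; [exact H|apply Cmod_ge_0].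
Qed.

Lemma is_series_geom_C (q : C) : (Cmod q < 1)%R -> is_series (fun n => q ^ n) (/ (1 - q)).
Proof.
  intros H.
  assert (Hq : 1 - q <> 0).
  { intros E. apply Ceq_minus in E. rewrite <- E, Cmod_1 in H. lra. }
  assert (L := abs_summable_is _ (pow_Cmod_abs q H)).
  assert (L2 : is_series (fun n => q ^ n - q * q ^ n) (Csum (fun n => q ^ n) - q * Csum (fun n => q ^ n))).
  { apply is_series_C_minus; [exact L|apply is_series_C_scal, L]. }
  assert (L3 : is_series (fun n => q ^ n - q * q ^ n) (RtoC 1)).
  { assert (L1 := proj1 (is_series_C_incr_1 _ _) L). simpl in L1.
    assert (L4 := is_series_C_minus _ _ _ _ L L1).
    replace (Csum (fun n => q ^ n) - (Csum (fun n => q ^ n) - 1)) with (RtoC 1) in L4 by ring.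
    eapply is_series_C_ext; [|exact L4]. intros n. reflexivity. }
  assert (E := is_series_C_unique _ _ _ L2 L3).
  replace (/ (1 - q)) with (Csum (fun n => q ^ n)); [exact L|].
  replace (Csum (fun n => q ^ n)) with ((Csum (fun n => q ^ n) - q * Csum (fun n => q ^ n)) / (1 - q)) by (field; exact Hq).
  rewrite E. field. exact Hq.
Qed.

Lemma analytic_at_inv (z0 : C) : z0 <> 0 -> analytic_at (fun z => / z) z0.
Proof.
  intros H. apply analytic_at_iff.
  assert (H0 := proj1 (Cmod_gt_0 z0) H).
  exists (Cmod z0), (fun n => / z0 * (- / z0) ^ n). split; [exact H0|].
  intros h Hh.
  assert (Hq : (Cmod (- (h / z0)) < 1)%R).
  { rewrite Cmod_opp, Cmod_div by exact H. apply (Rmult_lt_reg_r (Cmod z0)); [exact H0|].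
    unfold Rdiv. rewrite Rmult_assoc, Rinv_l; lra. }
  assert (N : z0 + h <> 0).
  { intros E. replace h with (- z0) in Hh; [rewrite Cmod_opp in Hh; lra|].
    replace h with ((z0 + h) - z0) by ring. rewrite E; ring. }
  replace (/ (z0 + h)) with (/ z0 * / (1 - (- (h / z0)))).
  - eapply is_series_C_ext; [|apply is_series_C_scal, is_series_geom_C, Hq].
    intros n. cbv beta. rewrite <- Cmult_assoc, <- Cpow_mult_l. f_equal. f_equal. unfold Cdiv; ring.
  - replace (1 - - (h / z0)) with ((z0 + h) / z0) by (field; exact H).
    field. split; assumption.
Qed.

(** Re-expansion about another point of the disc is substitution of z0 + h. *)
Lemma analytic_at_pseries (a : nat -> C) (f : C -> C) (R0 : R) (z0 : C) :
  (forall w, (Cmod w < R0)%R -> is_series (fun n => a n * w ^ n) (f w)) ->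
  (Cmod z0 < R0)%R -> analytic_at f z0.
Proof.
  intros Ha Hz. apply analytic_at_iff.
  destruct (proj1 (analytic_at_iff _ _) (analytic_at_id z0)) as [r [b [Hr Hb]]].
  apply (pseries_comp_local a b f (fun h => z0 + h) R0 r Hr Ha Hb).
  rewrite Cplus_0_r. exact Hz.
Qed.

(** * The identity theorem *)
Lemma pow_is_series_shift (a : nat -> C) (h l : C) (n : nat) :
  (forall j, (j < n)%nat -> a j = 0) -> is_series (fun k => a k * h ^ k) l ->
  h <> 0 -> is_series (fun k => a (n + k)%nat * h ^ k) (l / h ^ n).
Proof.
  intros Hz H Hh.
  apply is_series_C_ext with (fun k => / h ^ n * (a (n + k)%nat * h ^ (n + k))).
  - intros k. rewrite Cpow_add_r. field. apply Cpow_nz, Hh.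
  - unfold Cdiv. rewrite Cmult_comm. apply is_series_C_scal.
    clear Hh. revert l H. induction n as [|n IH]; intros l H.
    + exact H.
    + assert (H1 := IH (fun j Hj => Hz j ltac:(lia)) l H).
      apply is_series_C_incr_1 in H1. rewrite Nat.add_0_r in H1. rewrite (Hz n) in H1 by lia.
      replace (l - 0 * h ^ n) with l in H1 by ring.
      eapply is_series_C_ext; [|exact H1]. intros k. cbv beta.
      replace (n + S k)%nat with (S n + k)%nat by lia. reflexivity.
Qed.

(** The first nonzero coefficient would dominate near the centre. *)
Lemma pseries_coef_zero (a : nat -> C) (f : C -> C) (r : R) : (0 < r)%R ->
  (forall h, (Cmod h < r)%R -> is_series (fun n => a n * h ^ n) (f h)) ->
  (forall eps, (0 < eps)%R -> exists h : C, h <> 0 /\ (Cmod h < eps)%R /\ f h = 0) ->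
  forall n, a n = 0.
Proof.
  intros Hr Ha Hz n. induction n as [n IH] using (well_founded_induction lt_wf).
  assert (Hs : forall h, (Cmod h < r)%R -> is_series (fun k => a (n + k)%nat * h ^ k)
              (if Ceq_dec h 0 then a n else f h / h ^ n)).
  { intros h Hh. destruct (Ceq_dec h 0) as [->|Hne].
    - assert (H := pseries_at_0 (fun k => a (n + k)%nat)). cbv beta in H. rewrite Nat.add_0_r in H. exact H.
    - apply pow_is_series_shift; [exact IH|apply Ha, Hh|exact Hne]. }
  destruct (pseries_near_0 _ r _ Hr Hs) as [K [rho [Hrho [HK HB]]]].
  destruct (Ceq_dec (a n) 0) as [|Hne]; [assumption|exfalso].
  assert (Hp := proj1 (Cmod_gt_0 _) Hne).
  assert (He : (0 < Rmin rho (Cmod (a n) / (2 * (K + 1))))%R).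
  { apply Rmin_pos; [lra|]. apply Rdiv_lt_0_compat; lra. }
  destruct (Hz _ He) as [h [H1 [H2 H3]]].
  assert (h1 : (Cmod h < rho)%R) by (eapply Rlt_le_trans; [exact H2|apply Rmin_l]).
  assert (h2 : (Cmod h < Cmod (a n) / (2 * (K + 1)))%R) by (eapply Rlt_le_trans; [exact H2|apply Rmin_r]).
  specialize (HB h ltac:(lra)). cbv beta in HB. rewrite Nat.add_0_r in HB.
  destruct (Ceq_dec h 0) as [e|_]; [contradiction|]. rewrite H3 in HB.
  replace (0 / h ^ n - a n) with (- a n) in HB by (unfold Cdiv; ring). rewrite Cmod_opp in HB.
  assert (Hc := Cmod_ge_0 h).
  assert ((K + 1) * (Cmod (a n) / (2 * (K + 1))) = Cmod (a n) / 2)%R by (field; lra). nra.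
Qed.

Definition zero_near (f : C -> C) (z0 : C) : Prop :=
  exists r, (0 < r)%R /\ forall z, (Cmod (z - z0) < r)%R -> f z = 0.

Lemma analytic_zero_near (f : C -> C) (z0 : C) : analytic_at f z0 ->
  (forall eps, (0 < eps)%R -> exists z : C, z <> z0 /\ (Cmod (z - z0) < eps)%R /\ f z = 0) ->
  zero_near f z0.
Proof.
  intros Hf Hz. apply analytic_at_iff in Hf. destruct Hf as [r [a [Hr Ha]]].
  assert (A0 : forall n, a n = 0).
  { apply (pseries_coef_zero a (fun h => f (z0 + h)) r Hr Ha).
    intros eps He. destruct (Hz eps He) as [z [H1 [H2 H3]]].
    exists (z - z0). split; [|split; [exact H2|]].
    - intros E. apply H1. apply Ceq_minus, E.
    - replace (z0 + (z - z0)) with z by ring. exact H3. }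
  exists r. split; [exact Hr|]. intros z Hzr.
  specialize (Ha _ Hzr). replace (z0 + (z - z0)) with z in Ha by ring.
  apply (is_series_C_unique _ _ _ Ha).
  replace (RtoC 0) with (sum_n (fun n => a n * (z - z0) ^ n) 0).
  - apply is_series_finite. intros n _. rewrite A0. ring.
  - rewrite csum_0, A0. cring.
Qed.

Definition segment (z0 z1 : C) (t : R) : C := z0 + RtoC t * (z1 - z0).

Lemma segment_dist (z0 z1 : C) (s t : R) :
  Cmod (segment z0 z1 s - segment z0 z1 t) = (Rabs (s - t) * Cmod (z1 - z0))%R.
Proof.
  unfold segment. rewrite <- Cmod_R, <- Cmod_mult. f_equal. rewrite RtoC_minus. ring.
Qed.

(** The set of parameters up to which f vanishes locally is open because of the
    definition of [zero_near], and closed because an analytic function whose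
    zeros accumulate vanishes near the accumulation point. *)
Theorem identity_segment (f : C -> C) (z0 z1 : C) :
  (forall t, (0 <= t <= 1)%R -> analytic_at f (segment z0 z1 t)) ->
  zero_near f z0 -> zero_near f z1.
Proof.
  intros Ha H0.
  destruct (Ceq_dec z0 z1) as [<-|Hne]; [exact H0|].
  assert (Hd : (0 < Cmod (z1 - z0))%R).
  { apply Cmod_gt_0. intros E. apply Hne. symmetry. apply Ceq_minus, E. }
  set (d := Cmod (z1 - z0)) in *.
  set (E := fun t => (0 <= t <= 1)%R /\ forall s, (0 <= s <= t)%R -> zero_near f (segment z0 z1 s)).
  assert (s0 : segment z0 z1 0 = z0) by (unfold segment; ring).
  assert (s1 : segment z0 z1 1 = z1) by (unfold segment; ring).
  assert (E0 : E 0%R).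
  { split; [lra|]. intros s Hs. replace s with 0%R by lra. rewrite s0. exact H0. }
  destruct (completeness E) as [T [HT1 HT2]].
  { exists 1%R. intros t [Ht _]. lra. }
  { exists 0%R; exact E0. }
  assert (T0 : (0 <= T)%R) by (apply HT1, E0).
  assert (T1 : (T <= 1)%R) by (apply HT2; intros t [Ht _]; lra).
  assert (below : forall s, (0 <= s < T)%R -> zero_near f (segment z0 z1 s)).
  { intros s Hs. destruct (Rle_lt_dec T s) as [h|h]; [lra|].
    destruct (Classical_Prop.classic (exists t, E t /\ (s < t)%R)) as [[t [[_ Ht] Hst]]|Hn].
    - apply Ht; lra.
    - exfalso. assert (T <= s)%R; [|lra]. apply HT2. intros t Ht.
      apply Rnot_lt_le. intros Hlt. apply Hn. exists t; split; assumption. }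
  assert (atT : zero_near f (segment z0 z1 T)).
  { destruct (Req_dec T 0) as [->|HTn]; [rewrite s0; exact H0|].
    apply analytic_zero_near; [apply Ha; lra|]. intros eps He.
    set (del := Rmin T (eps / (2 * d))).
    assert (Hdel : (0 < del)%R) by (apply Rmin_pos; [lra|apply Rdiv_lt_0_compat; lra]).
    assert (Hdel1 : (del <= T)%R) by apply Rmin_l.
    assert (Hdel2 : (del <= eps / (2 * d))%R) by apply Rmin_r.
    assert (Hdd : (del * d <= eps / 2)%R).
    { replace (eps / 2)%R with (eps / (2 * d) * d)%R by (field; lra). apply Rmult_le_compat_r; lra. }
    exists (segment z0 z1 (T - del)). 
    assert (D : (Cmod (segment z0 z1 (T - del) - segment z0 z1 T) = del * d)%R).
    { rewrite segment_dist. replace (T - del - T)%R with (- del)%R by ring.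
      rewrite Rabs_Ropp, Rabs_pos_eq by lra. reflexivity. }
    split; [|split].
    - intros Eq. rewrite Eq in D. replace (segment z0 z1 T - segment z0 z1 T) with (RtoC 0) in D by ring.
      rewrite Cmod_0 in D. nra.
    - rewrite D. lra.
    - destruct (below (T - del)%R ltac:(lra)) as [r [Hr Hz]]. apply Hz.
      replace (segment z0 z1 (T - del) - segment z0 z1 (T - del)) with (RtoC 0) by ring.
      rewrite Cmod_0; exact Hr. }
  destruct (Req_dec T 1) as [->|HT3]; [rewrite s1 in atT; exact atT|exfalso].
  destruct atT as [r [Hr Hz]].
  set (del := Rmin (1 - T) (r / (2 * d))).
  assert (Hdel : (0 < del)%R) by (apply Rmin_pos; [lra|apply Rdiv_lt_0_compat; lra]).
  assert (Hdel1 : (del <= 1 - T)%R) by apply Rmin_l.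
  assert (Hdel2 : (del <= r / (2 * d))%R) by apply Rmin_r.
  assert (Hdd : (del * d <= r / 2)%R).
  { replace (r / 2)%R with (r / (2 * d) * d)%R by (field; lra). apply Rmult_le_compat_r; lra. }
  assert (HE : E (T + del)%R).
  { split; [lra|]. intros s Hs. destruct (Rlt_le_dec s T) as [h|h]; [apply below; lra|].
    exists (r / 2)%R. split; [lra|]. intros z Hzs. apply Hz.
    replace (z - segment z0 z1 T) with ((z - segment z0 z1 s) + (segment z0 z1 s - segment z0 z1 T)) by ring.
    eapply Rle_lt_trans; [apply Cmod_triangle|]. rewrite segment_dist. fold d.
    rewrite Rabs_pos_eq by lra.
    assert ((s - T) * d <= del * d)%R by (apply Rmult_le_compat_r; lra). lra. }
  specialize (HT1 _ HE). lra.
Qed.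

(** * Sequences of subexponential growth *)

(** Such coefficients give convergence in the unit disc, and unlike a condition on
    ratios the property is stable under products and convolution. *)
Definition subexp (u : nat -> C) : Prop :=
  forall Q : R, (1 < Q)%R -> exists M : R, (0 < M)%R /\ forall n, (Cmod (u n) <= M * Q ^ n)%R.

Lemma subexp_summable_R (u : nat -> C) (r : R) : subexp u -> (0 <= r < 1)%R ->
  ex_series (fun n => Cmod (u n) * r ^ n)%R.
Proof.
  intros Hu Hr. destruct (Hu (2 / (1 + r))%R) as [M [HM H]].
  { apply (Rmult_lt_reg_r (1 + r)); [lra|]. unfold Rdiv. rewrite Rmult_assoc, Rinv_l; lra. }
  apply ex_series_le_pos with (fun n => M * (2 / (1 + r) * r) ^ n)%R.
  - intros n. assert (Hp := pow_le r n ltac:(lra)). assert (Hc := Cmod_ge_0 (u n)).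
    split; [nra|]. rewrite Rpow_mult_distr, <- Rmult_assoc. apply Rmult_le_compat_r; [exact Hp|apply H].
  - apply ex_series_geom_scal. split.
    + apply Rmult_le_pos; [|lra]. apply Rmult_le_pos; [lra|]. left; apply Rinv_0_lt_compat; lra.
    + apply (Rmult_lt_reg_r (1 + r)); [lra|]. field_simplify; lra.
Qed.

Lemma subexp_summable (u : nat -> C) (z : C) : subexp u -> (Cmod z < 1)%R ->
  abs_summable (fun n => u n * z ^ n).
Proof.
  intros Hu Hz. apply pseries_abs_at with (Cmod z); [lra|].
  apply subexp_summable_R; [exact Hu|]. split; [apply Cmod_ge_0|exact Hz].
Qed.

Lemma subexp_le (u v : nat -> C) : (forall n, (Cmod (u n) <= Cmod (v n))%R) -> subexp v -> subexp u.
Proof.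
  intros H Hv Q HQ. destruct (Hv Q HQ) as [M [HM HB]]. exists M; split; [exact HM|].
  intros n; eapply Rle_trans; [apply H|apply HB].
Qed.

Lemma subexp_ext (u v : nat -> C) : (forall n, u n = v n) -> subexp u -> subexp v.
Proof. intros H. apply subexp_le. intros n. rewrite H. lra. Qed.

Lemma sqrt_gt_1 Q : (1 < Q)%R -> (1 < sqrt Q)%R /\ (sqrt Q * sqrt Q = Q)%R.
Proof.
  intros HQ. split; [|apply sqrt_sqrt; lra]. rewrite <- sqrt_1. apply sqrt_lt_1_alt. lra.
Qed.

Lemma subexp_mult (u v : nat -> C) : subexp u -> subexp v -> subexp (fun n => u n * v n).
Proof.
  intros Hu Hv Q HQ. destruct (sqrt_gt_1 Q HQ) as [Hs Hss].
  destruct (Hu _ Hs) as [M [HM HB]]. destruct (Hv _ Hs) as [M' [HM' HB']].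
  exists (M * M')%R. split; [nra|]. intros n. rewrite Cmod_mult.
  rewrite <- Hss at 1. rewrite Rpow_mult_distr.
  replace (M * M' * (sqrt Q ^ n * sqrt Q ^ n))%R with ((M * sqrt Q ^ n) * (M' * sqrt Q ^ n))%R by ring.
  apply Rmult_le_compat; try apply Cmod_ge_0; [apply HB|apply HB'].
Qed.

Lemma subexp_const (k : C) : subexp (fun _ => k).
Proof.
  intros Q HQ. exists (Cmod k + 1)%R. assert (H := Cmod_ge_0 k). split; [lra|].
  intros n. assert (H1 := pow_R1_Rle Q n ltac:(lra)). nra.
Qed.

Lemma subexp_scal (k : C) (u : nat -> C) : subexp u -> subexp (fun n => k * u n).
Proof. apply (subexp_mult (fun _ => k)), subexp_const. Qed.

Lemma subexp_plus (u v : nat -> C) : subexp u -> subexp v -> subexp (fun n => u n + v n).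
Proof.
  intros Hu Hv Q HQ.
  destruct (Hu _ HQ) as [M [HM HB]]. destruct (Hv _ HQ) as [M' [HM' HB']].
  exists (M + M')%R. split; [lra|]. intros n. eapply Rle_trans; [apply Cmod_triangle|].
  specialize (HB n). specialize (HB' n). lra.
Qed.

Lemma subexp_shift (u : nat -> C) : subexp u -> subexp (fun n => u (S n)).
Proof.
  intros Hu Q HQ. destruct (Hu _ HQ) as [M [HM HB]]. exists (M * Q)%R. split; [nra|].
  intros n. eapply Rle_trans; [apply HB|]. simpl. lra.
Qed.

(** An eventual bound on the ratios, made global by enlarging the constant. *)
Lemma growth_bound (u : nat -> R) (Q : R) (N : nat) : (1 < Q)%R ->
  (forall n, (N <= n)%nat -> (u (S n) <= Q * u n)%R) ->
  exists M, (0 < M)%R /\ forall n, (u n <= M * Q ^ n)%R.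
Proof.
  intros HQ H.
  assert (HN : exists M, (0 < M)%R /\ forall n, (n <= N)%nat -> (u n <= M * Q ^ n)%R).
  { clear H. induction N as [|N [M [HM IH]]].
    - exists (Rmax 1 (u 0%nat)). assert (h := Rmax_l 1 (u 0%nat)). split; [lra|].
      intros n Hn. replace n with 0%nat by lia. simpl. rewrite Rmult_1_r. apply Rmax_r.
    - exists (Rmax M (u (S N))). assert (h := Rmax_l M (u (S N))). split; [lra|].
      intros n Hn. assert (hq := pow_R1_Rle Q n ltac:(lra)).
      destruct (Nat.eq_dec n (S N)) as [->|hn].
      + assert (h' := Rmax_r M (u (S N))).
        apply Rle_trans with (Rmax M (u (S N)) * 1)%R; [lra|]. apply Rmult_le_compat_l; lra.
      + eapply Rle_trans; [apply IH; lia|]. apply Rmult_le_compat_r; [lra|exact h]. }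
  destruct HN as [M [HM HB]]. exists M. split; [exact HM|]. intros n.
  destruct (Nat.le_gt_cases n N) as [h|h]; [apply HB, h|].
  induction n as [|n IH]; [lia|].
  destruct (Nat.eq_dec n N) as [->|hn].
  - eapply Rle_trans; [apply H; lia|]. specialize (HB N (le_n _)). simpl. nra.
  - eapply Rle_trans; [apply H; lia|]. specialize (IH ltac:(lia)). simpl. nra.
Qed.

Lemma subexp_ratio (u : nat -> C) :
  (forall e, (0 < e)%R -> exists N, forall n, (N <= n)%nat -> (Cmod (u (S n)) <= (1 + e) * Cmod (u n))%R) ->
  subexp u.
Proof.
  intros H Q HQ. destruct (H (Q - 1)%R ltac:(lra)) as [N HN].
  apply (growth_bound (fun n => Cmod (u n)) Q N HQ).
  intros n Hn. replace Q with (1 + (Q - 1))%R by ring. apply HN, Hn.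
Qed.

Lemma INR_eventually_ge (x : R) : exists N, forall n, (N <= n)%nat -> (x <= INR n)%R.
Proof.
  destruct (nfloor_ex (Rmax x 0)) as [N HN]; [apply Rmax_r|].
  exists (S N). intros n Hn. apply le_INR in Hn. rewrite S_INR in Hn.
  assert (h := Rmax_l x 0). lra.
Qed.

Lemma RtoC_INR_S n : RtoC (INR (S n)) = RtoC (INR n) + 1.
Proof. rewrite S_INR, RtoC_plus. reflexivity. Qed.

Lemma Cmod_plus_INR_ge (b : C) n : (INR n - Cmod b <= Cmod (b + INR n))%R.
Proof.
  assert (H := Cmod_triangle (b + INR n) (- b)). rewrite Cmod_opp in H.
  replace (b + INR n + - b) with (RtoC (INR n)) in H by ring.
  rewrite Cmod_R, Rabs_pos_eq in H by apply pos_INR. lra.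
Qed.

Lemma ratio_eventually (a b : C) e : (0 < e)%R -> exists N, forall n, (N <= n)%nat ->
  (Cmod (a + INR n) <= (1 + e) * Cmod (b + INR n))%R.
Proof.
  intros He. destruct (INR_eventually_ge (Cmod b + Cmod (a - b) / e)) as [N HN].
  exists N. intros n Hn. specialize (HN n Hn).
  assert (H1 := Cmod_plus_INR_ge b n).
  replace (a + INR n) with ((b + INR n) + (a - b)) by ring.
  eapply Rle_trans; [apply Cmod_triangle|].
  assert (Cmod (a - b) / e <= Cmod (b + INR n))%R by lra.
  assert (Cmod (a - b) <= e * Cmod (b + INR n))%R; [|lra].
  replace (Cmod (a - b)) with (e * (Cmod (a - b) / e))%R by (field; lra).
  apply Rmult_le_compat_l; lra.
Qed.

Lemma subexp_INR : subexp (fun n => RtoC (INR (S n))).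
Proof.
  apply subexp_ratio. intros e He.
  destruct (ratio_eventually 2 1 e He) as [N HN]. exists N. intros n Hn.
  specialize (HN n Hn). rewrite !RtoC_INR_S.
  replace (RtoC (INR n) + 1 + 1) with (2 + INR n) by ring.
  replace (RtoC (INR n) + 1) with (1 + INR n) by ring. exact HN.
Qed.

Lemma subexp_cauchy (a b : nat -> C) : subexp a -> subexp b -> subexp (cauchy_prod a b).
Proof.
  intros Ha Hb Q HQ. destruct (sqrt_gt_1 Q HQ) as [Hs Hss].
  destruct (Ha _ Hs) as [M [HM HB]]. destruct (Hb _ Hs) as [M' [HM' HB']].
  destruct (subexp_INR _ Hs) as [M2 [HM2 HB2]].
  exists (M * M' * M2)%R. split; [apply Rmult_lt_0_compat; nra|]. intros n.
  unfold cauchy_prod. eapply Rle_trans; [apply Cmod_sum_le|].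
  apply Rle_trans with (sum_n (fun _ => M * M' * sqrt Q ^ n)%R n).
  - apply rsum_le. intros k Hk. rewrite Cmod_mult.
    replace (M * M' * sqrt Q ^ n)%R with ((M * sqrt Q ^ k) * (M' * sqrt Q ^ (n - k)))%R.
    + apply Rmult_le_compat; try apply Cmod_ge_0; [apply HB|apply HB'].
    + replace (sqrt Q ^ n)%R with (sqrt Q ^ k * sqrt Q ^ (n - k))%R; [ring|].
      rewrite <- pow_add. f_equal; lia.
  - rewrite sum_n_const. specialize (HB2 n).
    rewrite Cmod_R, Rabs_pos_eq in HB2 by apply pos_INR.
    rewrite <- Hss at 2. rewrite Rpow_mult_distr.
    replace (M * M' * M2 * (sqrt Q ^ n * sqrt Q ^ n))%R with ((M2 * sqrt Q ^ n) * (M * M' * sqrt Q ^ n))%R by ring.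
    apply Rmult_le_compat_r; [|exact HB2].
    assert (h := pow_le (sqrt Q) n ltac:(lra)). apply Rmult_le_pos; [nra|exact h].
Qed.

(** * Pochhammer symbols *)

Lemma poch_S (a : C) n : poch a (S n) = poch a n * (a + INR n).
Proof. reflexivity. Qed.

Lemma nonpos_int_plus (b : C) n : ~ is_nonpos_int b -> b + INR n <> 0.
Proof.
  intros H E. apply H. exists n. replace b with ((b + INR n) - INR n) by ring. rewrite E. ring.
Qed.

Lemma poch_neq_0 (b : C) n : ~ is_nonpos_int b -> poch b n <> 0.
Proof.
  intros H. induction n as [|n IH].
  - simpl. apply C1_nz.
  - rewrite poch_S. apply Cmult_neq_0; [exact IH|]. apply nonpos_int_plus, H.
Qed.

Lemma one_not_nonpos : ~ is_nonpos_int 1.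
Proof.
  intros [n Hn]. rewrite <- RtoC_opp in Hn. apply RtoC_inj in Hn.
  assert (h := pos_INR n). lra.
Qed.

Lemma fact_neq_0C n : RtoC (INR (fact n)) <> 0.
Proof. intros E. apply RtoC_inj in E. apply (INR_fact_neq_0 n E). Qed.

Lemma INR_S_neq_0 n : RtoC (INR (S n)) <> 0.
Proof. intros E. apply RtoC_inj in E. apply (not_0_INR (S n)); [lia|exact E]. Qed.

Lemma fact_S_C n : RtoC (INR (fact (S n))) = RtoC (INR (S n)) * RtoC (INR (fact n)).
Proof. rewrite <- RtoC_mult, <- mult_INR. reflexivity. Qed.

Lemma poch_1 n : poch 1 n = INR (fact n).
Proof.
  induction n as [|n IH]; [reflexivity|].
  rewrite poch_S, IH, fact_S_C, RtoC_INR_S. ring.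
Qed.

Lemma poch_add (a : C) m j : poch a (m + j) = poch a m * poch (a + INR m) j.
Proof.
  induction j as [|j IH].
  - rewrite Nat.add_0_r. simpl. ring.
  - rewrite Nat.add_succ_r, !poch_S, IH, plus_INR, RtoC_plus. ring.
Qed.

Lemma poch_S_l (a : C) n : poch a (S n) = a * poch (a + 1) n.
Proof.
  change (S n) with (1 + n)%nat. rewrite poch_add. simpl. rewrite Cplus_0_r. ring.
Qed.

Lemma subexp_poch_ratio (a b : C) : ~ is_nonpos_int b -> subexp (fun n => poch a n / poch b n).
Proof.
  intros Hb. apply subexp_ratio. intros e He.
  destruct (ratio_eventually a b e He) as [N HN]. exists N. intros n Hn. specialize (HN n Hn).
  assert (H0 := nonpos_int_plus b n Hb).
  assert (Hp := proj1 (Cmod_gt_0 _) H0).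
  replace (poch a (S n) / poch b (S n)) with ((poch a n / poch b n) * ((a + INR n) / (b + INR n))).
  2:{ rewrite !poch_S. field. split; [exact H0|apply poch_neq_0, Hb]. }
  rewrite Cmod_mult, Rmult_comm. apply Rmult_le_compat_r; [apply Cmod_ge_0|].
  rewrite Cmod_div by exact H0. apply (Rmult_le_reg_r (Cmod (b + INR n))); [exact Hp|].
  unfold Rdiv. rewrite Rmult_assoc, Rinv_l by lra. lra.
Qed.

Ltac nz := repeat split; try assumption; try apply fact_neq_0C; try apply INR_S_neq_0;
  try (apply poch_neq_0; assumption); try (apply nonpos_int_plus; assumption).

Lemma nonpos_int_neq_0 c : ~ is_nonpos_int c -> c <> 0.
Proof. intros H. assert (N := nonpos_int_plus c 0 H). simpl in N. rewrite Cplus_0_r in N. exact N. Qed.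

Lemma nonpos_int_S c : ~ is_nonpos_int c -> ~ is_nonpos_int (c + 1).
Proof.
  intros Hc [n Hn]. apply Hc. exists (S n). rewrite RtoC_INR_S.
  replace c with ((c + 1) - 1) by ring. rewrite Hn. ring.
Qed.

Lemma nonpos_int_plus_nat c n : ~ is_nonpos_int c -> ~ is_nonpos_int (c + INR n).
Proof.
  intros Hc. induction n as [|n IH]; [rewrite Cplus_0_r; exact Hc|].
  rewrite RtoC_INR_S, Cplus_assoc. apply nonpos_int_S, IH.
Qed.

Definition bcoef (a : C) (n : nat) : C := poch a n / INR (fact n).

Lemma subexp_bcoef (a : C) : subexp (bcoef a).
Proof.
  eapply subexp_ext; [|apply (subexp_poch_ratio a 1 one_not_nonpos)].
  intros n. cbv beta. rewrite poch_1. reflexivity.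
Qed.

Definition hcoef (a b c : C) (n : nat) : C := poch a n * poch b n / poch c n / INR (fact n).

Lemma hyp2F1_term_hcoef (a b c z : C) n : hyp2F1_term a b c z n = hcoef a b c n * z ^ n.
Proof. unfold hyp2F1_term, hcoef, Cdiv. ring. Qed.

Lemma subexp_hcoef (a b c : C) : ~ is_nonpos_int c -> subexp (hcoef a b c).
Proof.
  intros Hc. eapply subexp_ext; [|apply subexp_mult; [apply (subexp_poch_ratio a c Hc)|apply (subexp_bcoef b)]].
  intros n. unfold hcoef, bcoef, Cdiv. ring.
Qed.

Definition psum (a : nat -> C) (z : C) : C := Csum (fun n => a n * z ^ n).

Lemma psum_is (a : nat -> C) (z : C) : subexp a -> (Cmod z < 1)%R ->
  is_series (fun n => a n * z ^ n) (psum a z).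
Proof. intros Ha Hz. apply abs_summable_is, subexp_summable; assumption. Qed.

Lemma psum_analytic (a : nat -> C) (z : C) : subexp a -> (Cmod z < 1)%R -> analytic_at (psum a) z.
Proof.
  intros Ha Hz. apply (analytic_at_pseries a (psum a) 1 z); [|exact Hz].
  intros w Hw. apply psum_is; assumption.
Qed.

Lemma psum_mult (a b : nat -> C) (z : C) : subexp a -> subexp b -> (Cmod z < 1)%R ->
  psum a z * psum b z = psum (cauchy_prod a b) z.
Proof.
  intros Ha Hb Hz. symmetry. apply Csum_unique.
  eapply is_series_C_ext; [|apply (is_series_cauchy (fun m => a m * z ^ m) (fun m => b m * z ^ m))];
    try (apply subexp_summable; assumption); try (apply psum_is; assumption).
  intros n. apply cauchy_prod_pow.
Qed.

Lemma psum_ext (a b : nat -> C) (z : C) : subexp a -> (Cmod z < 1)%R -> (forall n, a n = b n) ->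
  psum a z = psum b z.
Proof.
  intros Ha Hz H. apply Csum_ext; [intros n; rewrite H; reflexivity|].
  apply subexp_summable; assumption.
Qed.

Lemma bcoef_rec (a : C) n : RtoC (INR (S n)) * bcoef a (S n) = (a + INR n) * bcoef a n.
Proof.
  unfold bcoef. rewrite poch_S, fact_S_C. field. split; [apply fact_neq_0C|apply INR_S_neq_0].
Qed.

Lemma bcoef_0 (a : C) : bcoef a 0 = 1.
Proof. unfold bcoef. simpl. field. Qed.

Lemma sum_n_C_plus (u v : nat -> C) n : sum_n (fun k => u k + v k) n = sum_n u n + sum_n v n.
Proof. exact (sum_n_plus u v n). Qed.

Lemma sum_n_scal_l_C (u : nat -> C) (k : C) N : sum_n (fun n => k * u n) N = k * sum_n u N.
Proof. exact (sum_n_mult_l k u N). Qed.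

Lemma sum_n_ext_loc_C (u v : nat -> C) N : (forall n, (n <= N)%nat -> u n = v n) ->
  sum_n u N = sum_n v N.
Proof. exact (sum_n_ext_loc u v N). Qed.

Lemma sum_n_C_S_l (u : nat -> C) n : sum_n u (S n) = u 0%nat + sum_n (fun k => u (S k)) n.
Proof.
  induction n as [|n IH].
  - rewrite csum_S, !csum_0. reflexivity.
  - rewrite csum_S, IH, (csum_S (fun k => u (S k))). cring.
Qed.

(** Multiplying the convolution by n + 1 = k + (n + 1 - k) and using the
    recursion of the factors gives the recursion of [bcoef (a + b)]. *)
Lemma vandermonde (a b : C) n : cauchy_prod (bcoef a) (bcoef b) n = bcoef (a + b) n.
Proof.
  induction n as [|n IH].
  - unfold cauchy_prod. rewrite csum_0. simpl. rewrite !bcoef_0. cring.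
  - assert (E : RtoC (INR (S n)) * cauchy_prod (bcoef a) (bcoef b) (S n) =
      (a + b + INR n) * cauchy_prod (bcoef a) (bcoef b) n).
    { unfold cauchy_prod.
      transitivity (sum_n (fun k => RtoC (INR k) * bcoef a k * bcoef b (S n - k)) (S n)
         + sum_n (fun k => bcoef a k * (RtoC (INR (S n - k)) * bcoef b (S n - k)%nat)) (S n)).
      - rewrite <- sum_n_C_plus, <- sum_n_scal_l_C. apply sum_n_ext_loc_C. intros k Hk.
        replace (RtoC (INR (S n))) with (RtoC (INR k) + RtoC (INR (S n - k))).
        + ring.
        + rewrite <- RtoC_plus, <- plus_INR. do 2 f_equal. lia.
      - rewrite sum_n_C_S_l. rewrite (csum_S (fun k => bcoef a k * _)).
        replace (S n - S n)%nat with 0%nat by lia.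
        transitivity (sum_n (fun k => (a + INR k) * bcoef a k * bcoef b (n - k)) n
          + sum_n (fun k => bcoef a k * ((b + INR (n - k)) * bcoef b (n - k)%nat)) n).
        + rewrite (sum_n_ext_loc_C (fun k => RtoC (INR (S k)) * bcoef a (S k) * bcoef b (S n - S k))
            (fun k => (a + INR k) * bcoef a k * bcoef b (n - k))).
          2:{ intros k Hk. rewrite bcoef_rec. reflexivity. }
          rewrite (sum_n_ext_loc_C (fun k => bcoef a k * (INR (S n - k) * bcoef b (S n - k)))
            (fun k => bcoef a k * ((b + INR (n - k)) * bcoef b (n - k)%nat))).
          2:{ intros k Hk. rewrite Nat.sub_succ_l by exact Hk. rewrite bcoef_rec. reflexivity. }
          simpl INR. ring.
        + rewrite <- sum_n_C_plus, <- sum_n_scal_l_C. apply sum_n_ext_loc_C. intros k Hk.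
          replace (RtoC (INR n)) with (RtoC (INR k) + RtoC (INR (n - k))).
          * ring.
          * rewrite <- RtoC_plus, <- plus_INR. do 2 f_equal. lia. }
    rewrite IH in E. rewrite <- bcoef_rec in E.
    assert (N := INR_S_neq_0 n).
    replace (cauchy_prod (bcoef a) (bcoef b) (S n)) with
      (/ RtoC (INR (S n)) * (RtoC (INR (S n)) * cauchy_prod (bcoef a) (bcoef b) (S n))) by (field; exact N).
    rewrite E. field. exact N.
Qed.

(** * The binomial series *)

Definition binom_fun (a z : C) : C := psum (bcoef a) z.

Lemma binom_fun_mult (a b z : C) : (Cmod z < 1)%R ->
  binom_fun a z * binom_fun b z = binom_fun (a + b) z.
Proof.
  intros Hz. unfold binom_fun. rewrite psum_mult by (try apply subexp_bcoef; exact Hz).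
  apply psum_ext; [|exact Hz|intros n; apply vandermonde].
  apply subexp_cauchy; apply subexp_bcoef.
Qed.

Lemma binom_fun_0 (z : C) : (Cmod z < 1)%R -> binom_fun 0 z = 1.
Proof.
  intros Hz. apply Csum_unique. eapply is_series_C_ext; [|apply (is_series_single (RtoC 1))].
  intros n; destruct n as [|n]; cbn [Nat.eqb].
  - rewrite bcoef_0. simpl. cring.
  - unfold bcoef. rewrite poch_S_l. unfold Cdiv. cring.
Qed.

Lemma one_minus_neq_0 (z : C) : (Cmod z < 1)%R -> 1 - z <> 0.
Proof. intros H E. apply Ceq_minus in E. rewrite <- E, Cmod_1 in H. lra. Qed.

Lemma binom_fun_1 (z : C) : (Cmod z < 1)%R -> binom_fun 1 z = / (1 - z).
Proof.
  intros Hz. apply Csum_unique. eapply is_series_C_ext; [|apply is_series_geom_C, Hz].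
  intros n. unfold bcoef. rewrite poch_1. cbv beta.
  change (z ^ n = RtoC (INR (fact n)) / RtoC (INR (fact n)) * z ^ n). field. apply fact_neq_0C.
Qed.

Lemma binom_fun_nat (m : nat) (z : C) : (Cmod z < 1)%R -> binom_fun (INR m) z = / (1 - z) ^ m.
Proof.
  intros Hz. assert (H := one_minus_neq_0 z Hz). induction m as [|m IH].
  - simpl INR. rewrite binom_fun_0 by exact Hz. simpl. field.
  - rewrite RtoC_INR_S, <- binom_fun_mult, IH, binom_fun_1 by exact Hz. rewrite Cpow_S.
    field. split; [apply Cpow_nz, H|exact H].
Qed.

Lemma is_series_shift_1 (u : nat -> C) (l : C) : is_series u l ->
  is_series (fun k => match k with O => RtoC 0 | S k => u k end) l.
Proof.
  intros H. apply is_series_C_incr_1. cbv beta iota.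
  replace (l - 0) with l by ring. exact H.
Qed.

(** * The Gauss series in half-plane coordinates *)

Definition pochq (b c : C) (i : nat) : C := poch b i / poch c i.

(** The n-th differences of [pochq b c] with parameter X.  The entry at i = 0 is
    the terminating 2F1[-n, b; c; X] ([diff_tab_series]); the other columns make
    its recursion in n provable by induction. *)
Fixpoint diff_tab (b c X : C) (n i : nat) : C :=
  match n with
  | O => pochq b c i
  | S n => diff_tab b c X n i - X * diff_tab b c X n (S i)
  end.

Lemma pochq_rec (b c : C) i : ~ is_nonpos_int c ->
  (c + INR i) * pochq b c (S i) = (b + INR i) * pochq b c i.
Proof.
  intros Hc. unfold pochq. rewrite !poch_S. field.
  split; [apply poch_neq_0, Hc|apply nonpos_int_plus, Hc].
Qed.

Lemma diff_tab_rec (b c X : C) n i : ~ is_nonpos_int c ->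
  (c + INR (S n) + INR i) * diff_tab b c X (S n) (S i) =
  (b + INR i) * diff_tab b c X (S n) i + INR (S n) * (1 - X) * diff_tab b c X n (S i).
Proof.
  intros Hc. revert i. induction n as [|n IH]; intros i.
  - simpl diff_tab.
    assert (H1 := pochq_rec b c i Hc). assert (H2 := pochq_rec b c (S i) Hc).
    rewrite RtoC_INR_S in H2.
    replace (c + INR 1 + INR i) with (c + (INR i + 1)) by (simpl; ring).
    replace (RtoC (INR 1)) with (RtoC 1) by reflexivity.
    transitivity ((c + INR i) * pochq b c (S i) + pochq b c (S i) - X * ((c + (INR i + 1)) * pochq b c (S (S i)))); [ring|].
    rewrite H1, H2. ring.
  - assert (H1 := IH i). assert (H2 := IH (S i)).
    set (D := diff_tab b c X) in *.
    assert (R : forall k j, D (S k) j = D k j - X * D k (S j)) by reflexivity.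
    rewrite (R (S n) (S i)), (R (S n) i).
    rewrite !RtoC_INR_S in *.
    transitivity ((c + (INR n + 1) + INR i) * D (S n) (S i) + D (S n) (S i)
      - X * ((c + (INR n + 1) + (INR i + 1)) * D (S n) (S (S i)))); [ring|].
    rewrite H1, H2, (R n (S i)). ring.
Qed.

(** Let Q n and E n be the entries in the first two columns.  Then
    Q (n+1) = Q n - X E n, and [diff_tab_rec] with |1 - X| <= 1 bounds |E (n+1)|
    by (1 + o(1)) |E n| + o(1) |Q (n+1)|.  With a small weight d the quantity
    d |Q (n+1)| + |E n| therefore grows by factors that are eventually as close to
    1 as desired. *)
Lemma subexp_diff_tab (b c X : C) : ~ is_nonpos_int c -> (Cmod (1 - X) <= 1)%R ->
  subexp (fun n => diff_tab b c X n 0).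
Proof.
  intros Hc HX Q HQ.
  set (q := fun n => Cmod (diff_tab b c X n 0)).
  set (e := fun n => Cmod (diff_tab b c X n 1)).
  set (x := Cmod X).
  assert (Hx : (0 <= x)%R) by apply Cmod_ge_0.
  (* The weight d makes d (1 + 2 |X|), the relative growth per step, at most Q - 1. *)
  set (d := Rmin 1 ((Q - 1) / (1 + 2 * x))).
  assert (Hd : (0 < d)%R) by (apply Rmin_pos; [lra|apply Rdiv_lt_0_compat; lra]).
  assert (Hd1 : (d <= 1)%R) by apply Rmin_l.
  assert (Hd2 : (d * (1 + 2 * x) <= Q - 1)%R).
  { apply Rle_trans with ((Q - 1) / (1 + 2 * x) * (1 + 2 * x))%R.
    - apply Rmult_le_compat_r; [lra|apply Rmin_r].
    - right. field. lra. }
  assert (Hdd : (0 < d * d)%R) by nra.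
  destruct (ratio_eventually 0 c (d * d)%R Hdd) as [N1 HN1].
  destruct (INR_eventually_ge (Cmod c + Cmod b / (d * d) + 1)) as [N2 HN2].
  assert (Hstep : forall n, (max N1 N2 <= n)%nat -> (e (S n) <= (1 + d * d) * e n + d * d * q (S n))%R).
  { intros n Hn. 
    assert (h1 := HN1 (S n) ltac:(lia)). assert (h2 := HN2 (S n) ltac:(lia)).
    rewrite Cplus_0_l, Cmod_R, Rabs_pos_eq in h1 by apply pos_INR.
    assert (h3 := Cmod_plus_INR_ge c (S n)).
    assert (Hb : (Cmod b <= d * d * Cmod (c + INR (S n)))%R).
    { replace (Cmod b) with (d * d * (Cmod b / (d * d)))%R by (field; lra).
      apply Rmult_le_compat_l; lra. }
    assert (Hpos : (0 < Cmod (c + INR (S n)))%R).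
    { assert (0 <= Cmod b / (d * d))%R; [|lra]. apply Rmult_le_pos; [apply Cmod_ge_0|].
      left; apply Rinv_0_lt_compat; lra. }
    assert (E := diff_tab_rec b c X n 0 Hc). change (INR 0) with 0%R in E.
    rewrite !Cplus_0_r in E.
    apply (Rmult_le_reg_l (Cmod (c + INR (S n)))); [exact Hpos|].
    unfold e at 1. rewrite <- Cmod_mult, E.
    eapply Rle_trans; [apply Cmod_triangle|]. rewrite !Cmod_mult, Cmod_R, Rabs_pos_eq by apply pos_INR.
    fold (q (S n)) (e n).
    assert (He : (0 <= e n)%R) by apply Cmod_ge_0. assert (Hq : (0 <= q (S n))%R) by apply Cmod_ge_0.
    assert (T1 : (Cmod b * q (S n) <= d * d * Cmod (c + INR (S n)) * q (S n))%R) by (apply Rmult_le_compat_r; assumption).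
    assert (T2 : (INR (S n) * Cmod (1 - X) * e n <= (1 + d * d) * Cmod (c + INR (S n)) * e n)%R).
    { apply Rmult_le_compat_r; [exact He|]. rewrite <- (Rmult_1_r ((1 + d * d) * Cmod (c + INR (S n)))).
      apply Rmult_le_compat; [apply pos_INR|apply Cmod_ge_0|exact h1|exact HX]. }
    lra. }
  assert (Hq : forall n, (q (S n) <= q n + x * e n)%R).
  { intros n. unfold q, e, x. simpl diff_tab. unfold Cminus. eapply Rle_trans; [apply Cmod_triangle|].
    rewrite Cmod_opp, Cmod_mult. lra. }
  destruct (growth_bound (fun n => d * q (S n) + e n)%R Q (max N1 N2) HQ) as [M [HM HB]].
  { intros n Hn. specialize (Hstep n Hn). assert (h := Hq (S n)).
    assert (He : (0 <= e n)%R) by apply Cmod_ge_0. assert (Hq0 : (0 <= q (S n))%R) by apply Cmod_ge_0.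
    set (U := (d * q (S n) + e n)%R).
    assert (HU : (0 <= U)%R) by (unfold U; nra).
    assert (e0 : (d * d * e n <= d * e n)%R) by (apply Rmult_le_compat_r; [exact He|nra]).
    assert (e1 : (e (S n) <= e n + d * U)%R) by (unfold U; lra).
    assert (e2 : (e (S n) <= 2 * U)%R).
    { assert (d * U <= 1 * U)%R by (apply Rmult_le_compat_r; assumption).
      assert (0 <= d * q (S n))%R by (apply Rmult_le_pos; lra). unfold U in *; lra. }
    assert (e3 : (d * q (S (S n)) <= d * q (S n) + d * (x * (2 * U)))%R).
    { rewrite <- Rmult_plus_distr_l. apply Rmult_le_compat_l; [lra|].
      eapply Rle_trans; [exact h|]. apply Rplus_le_compat_l. apply Rmult_le_compat_l; lra. }
    apply Rle_trans with (U + d * (1 + 2 * x) * U)%R; [unfold U in *; lra|].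
    assert (d * (1 + 2 * x) * U <= (Q - 1) * U)%R by (apply Rmult_le_compat_r; assumption). lra. }
  exists (M / d + q 0%nat + 1)%R. 
  assert (Hq00 : (0 <= q 0%nat)%R) by apply Cmod_ge_0.
  assert (HMd : (0 < M / d)%R) by (apply Rdiv_lt_0_compat; lra).
  split; [lra|]. intros n. fold (q n).
  destruct n as [|n]; [simpl; lra|].
  assert (hq := pow_R1_Rle Q n ltac:(lra)).
  assert (He : (0 <= e n)%R) by apply Cmod_ge_0.
  assert (h := HB n).
  assert (q (S n) <= M / d * Q ^ n)%R.
  { apply (Rmult_le_reg_l d); [exact Hd|].
    replace (d * (M / d * Q ^ n))%R with (M * Q ^ n)%R by (field; lra). lra. }
  simpl. 
  assert (Q ^ n <= Q * Q ^ n)%R by nra. nra.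
Qed.

(** At X = 1 the terminating 2F1 is summed by the Chu-Vandermonde formula. *)
Lemma diff_tab_1 (b c : C) n : ~ is_nonpos_int c ->
  forall i, diff_tab b c 1 n i * (poch c (n + i)) = poch (c - b) n * poch b i.
Proof.
  intros Hc. induction n as [|n IH]; intros i.
  - simpl. unfold pochq. field. apply poch_neq_0, Hc.
  - simpl diff_tab. assert (H1 := IH i). assert (H2 := IH (S i)).
    replace (n + S i)%nat with (S n + i)%nat in H2 by lia.
    replace ((diff_tab b c 1 n i - 1 * diff_tab b c 1 n (S i)) * poch c (S n + i)) with
      (diff_tab b c 1 n i * poch c (S n + i) - diff_tab b c 1 n (S i) * poch c (S n + i)) by ring.
    rewrite H2. change (S n + i)%nat with (S (n + i)). rewrite !poch_S.
    rewrite Cmult_assoc, H1, plus_INR, RtoC_plus. ring.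
Qed.

Lemma poch_neg_nat (n m : nat) : (m <= n)%nat ->
  poch (- INR n) m * INR (fact (n - m)) = (-(1)) ^ m * INR (fact n).
Proof.
  induction m as [|m IH]; intros Hm.
  - rewrite Nat.sub_0_r. simpl. ring.
  - assert (H := IH ltac:(lia)).
    replace (n - m)%nat with (S (n - S m)) in H by lia. rewrite fact_S_C in H.
    replace (INR (S (n - S m))) with (INR n - INR m)%R in H.
    2:{ rewrite <- minus_INR by lia. f_equal. lia. }
    rewrite RtoC_minus in H. rewrite poch_S, Cpow_S.
    transitivity (- (poch (- INR n) m * ((INR n - INR m) * INR (fact (n - S m))))); [ring|].
    rewrite H. ring.
Qed.

Lemma poch_neg_nat_0 (n m : nat) : (n < m)%nat -> poch (- INR n) m = 0.
Proof.
  intros H. induction H as [|m H IH].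
  - rewrite poch_S. ring.
  - rewrite poch_S, IH. ring.
Qed.

Lemma diff_tab_series (b c X : C) n i :
  is_series (fun m => poch (- INR n) m / INR (fact m) * X ^ m * pochq b c (m + i)) (diff_tab b c X n i).
Proof.
  revert i. induction n as [|n IH]; intros i.
  - simpl diff_tab. eapply is_series_C_ext; [|apply (is_series_single (pochq b c i))].
    intros m; destruct m as [|m]; cbn [Nat.eqb].
    + simpl. field.
    + rewrite (poch_neg_nat_0 0 (S m)) by lia. unfold Cdiv. cring.
  - simpl diff_tab.
    assert (H1 := IH i). assert (H2 := is_series_shift_1 _ _ (is_series_C_scal X _ _ (IH (S i)))).
    eapply is_series_C_ext; [|apply (is_series_C_minus _ _ _ _ H1 H2)].
    intros m. destruct m as [|m]; cbv beta iota.
    + simpl. field.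
    + replace (m + S i)%nat with (S m + i)%nat by lia.
      rewrite (poch_S_l (- INR (S n))).
      replace (- INR (S n) + 1) with (- INR n) by (rewrite RtoC_INR_S; ring).
      rewrite poch_S, fact_S_C, !RtoC_INR_S, Cpow_S.
      assert (N1 := fact_neq_0C m). assert (N2 := INR_S_neq_0 m). rewrite RtoC_INR_S in N2.
      field. split; assumption.
Qed.

Lemma diff_tab_sum (b c X : C) n :
  sum_n (fun m => bcoef (- INR n) m * X ^ m * pochq b c m) n = diff_tab b c X n 0.
Proof.
  apply (is_series_C_unique (fun m => bcoef (- INR n) m * X ^ m * pochq b c m)).
  - apply is_series_finite. intros m Hm. unfold bcoef. rewrite poch_neg_nat_0 by exact Hm. unfold Cdiv; ring.
  - eapply is_series_C_ext; [|apply diff_tab_series]. intros m. cbv beta. rewrite Nat.add_0_r. reflexivity.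
Qed.

(** A binomial coefficient is at most a power of 2, by Pascal's rule. *)
Lemma fact_binom_le (m j : nat) :
  (INR (fact (m + j)) <= 2 ^ (m + j) * (INR (fact m) * INR (fact j)))%R.
Proof.
  assert (H : forall n m j, (m + j = n)%nat -> (INR (fact (m + j)) <= 2 ^ (m + j) * (INR (fact m) * INR (fact j)))%R).
  2:{ exact (H _ m j eq_refl). }
  clear. induction n as [|n IH]; intros m j Hn.
  - replace m with 0%nat by lia. replace j with 0%nat by lia. simpl. lra.
  - assert (f1 := INR_fact_lt_0 m). assert (f2 := INR_fact_lt_0 j).
    destruct m as [|m].
    { rewrite Nat.add_0_l. assert (h := pow_R1_Rle 2 j ltac:(lra)). simpl (fact 0). simpl (INR 1). nra. }
    destruct j as [|j].
    { rewrite Nat.add_0_r. assert (h := pow_R1_Rle 2 (S m) ltac:(lra)).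
      replace (INR (fact 0)) with 1%R by reflexivity. nra. }
    assert (h1 := IH m (S j) ltac:(lia)). assert (h2 := IH (S m) j ltac:(lia)).
    replace (m + S j)%nat with n in h1 by lia. replace (S m + j)%nat with n in h2 by lia.
    replace (S m + S j)%nat with (S n) by lia.
    assert (Fs : forall k, INR (fact (S k)) = (INR (S k) * INR (fact k))%R) by (intros k; rewrite <- mult_INR; reflexivity).
    assert (g1 := INR_fact_lt_0 m). assert (g2 := INR_fact_lt_0 j).
    rewrite (Fs n). 
    replace (INR (S n)) with (INR (S m) + INR (S j))%R by (rewrite <- plus_INR; f_equal; lia).
    apply Rle_trans with (INR (S m) * (2 ^ n * (INR (fact m) * INR (fact (S j)))) +
       INR (S j) * (2 ^ n * (INR (fact (S m)) * INR (fact j))))%R.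
    + rewrite Rmult_plus_distr_r. apply Rplus_le_compat; apply Rmult_le_compat_l; try apply pos_INR; assumption.
    + rewrite (Fs m), (Fs j). simpl (2 ^ S n)%R. right. ring.
Qed.

(** The Gauss function in the variable zeta with z = - X zeta / (1 - zeta), that
    is zeta = p z / (p z - 1) for X = 1 / p; the first factor is (1 - zeta)^a. *)
Definition pfaff_fun (a b c X z : C) : C :=
  binom_fun (- a) z * psum (fun n => bcoef a n * diff_tab b c X n 0) z.

(** Expand every power of z in powers of zeta and exchange the sums.  The
    binomial factor cancels the surplus a in (1 - zeta)^(-a-m) and leaves
    (1 - zeta)^(-m). *)
Lemma pfaff_fun_gauss (a b c X z : C) : ~ is_nonpos_int c -> (8 * (1 + Cmod X) * Cmod z < 1)%R ->
  is_series (hyp2F1_term a b c (- X * z / (1 - z))) (pfaff_fun a b c X z).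
Proof.
  intros Hc Hz.
  assert (HX := Cmod_ge_0 X). assert (Hz0 := Cmod_ge_0 z).
  assert (Hz1 : (Cmod z < 1)%R) by nra.
  assert (H1z := one_minus_neq_0 z Hz1).
  set (v := fun m j => pochq b c m * (- X * z) ^ m * (poch a (m + j) / (INR (fact m) * INR (fact j))) * z ^ j).
  destruct (subexp_bcoef a 2%R ltac:(lra)) as [M1 [HM1 HB1]].
  destruct (subexp_poch_ratio b c Hc 2%R ltac:(lra)) as [M2 [HM2 HB2]].
  (* Each of the two coefficient sequences is bounded by a multiple of 2^n, and
     the binomial coefficient contributes another 2^(m+j). *)
  assert (Hv : forall m j, (Cmod (v m j) <= (M1 * M2 * (8 * (Cmod X * Cmod z)) ^ m) * (4 * Cmod z) ^ j)%R).
  { intros m j. unfold v.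
    replace (poch a (m + j) / (INR (fact m) * INR (fact j))) with
      (bcoef a (m + j) * RtoC (INR (fact (m + j)) / (INR (fact m) * INR (fact j)))).
    2:{ unfold bcoef. rewrite RtoC_div, RtoC_mult.
        - field. repeat split; apply fact_neq_0C.
        - apply Rmult_integral_contrapositive_currified; apply INR_fact_neq_0. }
    rewrite !Cmod_mult, !Cmod_pow, Cmod_mult, Cmod_opp, Cmod_R.
    assert (f1 := INR_fact_lt_0 m). assert (f2 := INR_fact_lt_0 j). assert (f3 := INR_fact_lt_0 (m + j)).
    rewrite Rabs_pos_eq by (apply Rmult_le_pos; [lra|left; apply Rinv_0_lt_compat; nra]).
    assert (B : (INR (fact (m + j)) / (INR (fact m) * INR (fact j)) <= 2 ^ (m + j))%R).
    { apply (Rmult_le_reg_r (INR (fact m) * INR (fact j))); [nra|].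
      unfold Rdiv. rewrite Rmult_assoc, Rinv_l by nra. assert (h := fact_binom_le m j). lra. }
    assert (B0 : (0 <= INR (fact (m + j)) / (INR (fact m) * INR (fact j)))%R).
    { apply Rmult_le_pos; [lra|left; apply Rinv_0_lt_compat; nra]. }
    assert (P1 := pow_le _ m (Rmult_le_pos _ _ HX Hz0)). assert (P2 := pow_le _ j Hz0).
    assert (b1 := HB1 (m + j)%nat). assert (b2 := HB2 m). fold (pochq b c m) in b2.
    apply Rle_trans with (M2 * 2 ^ m * (Cmod X * Cmod z) ^ m * (M1 * 2 ^ (m + j) * 2 ^ (m + j)) * Cmod z ^ j)%R.
    - apply Rmult_le_compat_r; [exact P2|]. apply Rmult_le_compat.
      + apply Rmult_le_pos; [apply Cmod_ge_0|exact P1].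
      + apply Rmult_le_pos; [apply Cmod_ge_0|exact B0].
      + apply Rmult_le_compat_r; assumption.
      + apply Rmult_le_compat; try assumption. apply Cmod_ge_0.
    - right. rewrite !pow_add. rewrite (Rpow_mult_distr 8), (Rpow_mult_distr 4).
      replace (8 ^ m)%R with (2 ^ m * 2 ^ m * 2 ^ m)%R by (rewrite <- !Rpow_mult_distr; f_equal; ring).
      replace (4 ^ j)%R with (2 ^ j * 2 ^ j)%R by (rewrite <- !Rpow_mult_distr; f_equal; ring).
      ring. }
  destruct (product_bound_summable v (fun m => M1 * M2 * (8 * (Cmod X * Cmod z)) ^ m)%R (fun j => (4 * Cmod z) ^ j)%R Hv) as [K1 K2].
  { intros m. apply Rmult_le_pos; [nra|]. apply pow_le. nra. }
  { intros j. apply pow_le. lra. }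
  { apply ex_series_geom_scal. split; nra. }
  { apply ex_series_geom. rewrite Rabs_pos_eq; nra. }
  destruct (fubini_diag v K1 K2) as [S [S1 [S2 _]]].
  assert (E1 : S = psum (fun n => bcoef a n * diff_tab b c X n 0) z).
  { symmetry. apply Csum_unique. eapply is_series_C_ext; [|exact S2].
    intros k. cbv beta. rewrite <- diff_tab_sum.
    replace (bcoef a k * sum_n (fun m => bcoef (- INR k) m * X ^ m * pochq b c m) k * z ^ k) with
      ((bcoef a k * z ^ k) * sum_n (fun m => bcoef (- INR k) m * X ^ m * pochq b c m) k) by ring.
    rewrite <- sum_n_scal_l_C. apply sum_n_ext_loc_C. intros m Hm. unfold v, bcoef.
    replace (m + (k - m))%nat with k by lia.
    replace (z ^ k) with (z ^ m * z ^ (k - m)) by (rewrite <- Cpow_add_r; f_equal; lia).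
    rewrite Cpow_mult_l. replace (- X) with (-(1) * X) by ring. rewrite Cpow_mult_l.
    assert (Hp := poch_neg_nat k m Hm).
    assert (N1 := fact_neq_0C m). assert (N2 := fact_neq_0C k). assert (N3 := fact_neq_0C (k - m)).
    replace (poch (- INR k) m) with ((-(1)) ^ m * INR (fact k) / INR (fact (k - m))).
    2:{ rewrite <- Hp. field. exact N3. }
    field. repeat split; assumption. }
  unfold pfaff_fun. rewrite <- E1.
  eapply is_series_C_ext; [|apply is_series_C_scal, S1].
  intros m. cbv beta.
  assert (E2 : Csum (v m) = pochq b c m * (- X * z) ^ m * (poch a m / INR (fact m)) * binom_fun (a + INR m) z).
  { apply Csum_unique. eapply is_series_C_ext; [|apply is_series_C_scal, psum_is; [apply (subexp_bcoef (a + INR m))|exact Hz1]].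
    intros j. cbv beta. unfold v, bcoef. rewrite poch_add.
    field. split; apply fact_neq_0C. }
  rewrite E2.
  transitivity (pochq b c m * (- X * z) ^ m * (poch a m / INR (fact m)) * (binom_fun (- a) z * binom_fun (a + INR m) z)); [ring|].
  rewrite binom_fun_mult by exact Hz1.
  replace (- a + (a + INR m)) with (RtoC (INR m)) by ring.
  rewrite binom_fun_nat by exact Hz1.
  unfold hyp2F1_term, pochq.
  replace ((- X * z / (1 - z)) ^ m) with ((- X * z) ^ m * / (1 - z) ^ m)
    by (unfold Cdiv; rewrite (Cpow_mult_l (- X * z) (/ (1 - z))), Cpow_inv by exact H1z; reflexivity).
  assert (N1 := fact_neq_0C m). assert (N2 := Cpow_nz (1 - z) m H1z). assert (N3 := poch_neq_0 c m Hc).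
  field. repeat split; assumption.
Qed.

(** * Analytic continuation of the Gauss series *)

Lemma Cmod_mult_self (z : C) : (Cmod z * Cmod z = Re z * Re z + Im z * Im z)%R.
Proof. assert (H := Cmod2_alt z). simpl in H. lra. Qed.

Lemma Cmod_lt_sqr (z w : C) : (Cmod z * Cmod z < Cmod w * Cmod w)%R -> (Cmod z < Cmod w)%R.
Proof. intros H. assert (h := Cmod_ge_0 z). assert (h' := Cmod_ge_0 w). nra. Qed.

Lemma half_plane_Cmod (w : C) : (Re w < 1 / 2)%R -> (Cmod w < Cmod (w - 1))%R.
Proof.
  intros H. apply Cmod_lt_sqr. rewrite !Cmod_mult_self. destruct w as [u v]. simpl in *. nra.
Qed.

Lemma half_plane_neq (w : C) : (Re w < 1 / 2)%R -> w - 1 <> 0.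
Proof. intros H E. apply Ceq_minus in E. rewrite E in H. simpl in H. lra. Qed.

Lemma half_plane_map_lt (w : C) : (Re w < 1 / 2)%R -> (Cmod (w / (w - 1)) < 1)%R.
Proof.
  intros H. assert (N := half_plane_neq w H). rewrite Cmod_div by exact N.
  assert (Hp := proj1 (Cmod_gt_0 _) N). assert (h := half_plane_Cmod w H).
  apply (Rmult_lt_reg_r (Cmod (w - 1))); [exact Hp|]. unfold Rdiv. rewrite Rmult_assoc, Rinv_l; lra.
Qed.

Definition half_branch (a b c p z : C) : C := pfaff_fun a b c (/ p) (p * z / (p * z - 1)).

Lemma inv_dist_one (p : C) : (1 / 2 <= Re p)%R -> p <> 0 /\ (Cmod (1 - / p) <= 1)%R.
Proof.
  intros H. assert (N : p <> 0) by (intros E; rewrite E in H; simpl in H; lra).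
  split; [exact N|].
  replace (1 - / p) with ((p - 1) / p) by (field; exact N).
  rewrite Cmod_div by exact N. assert (Hp := proj1 (Cmod_gt_0 _) N).
  assert (h : (Cmod (p - 1) <= Cmod p)%R).
  { assert (h1 := Cmod_ge_0 p). assert (h2 := Cmod_ge_0 (p - 1)).
    assert (Cmod (p - 1) * Cmod (p - 1) <= Cmod p * Cmod p)%R; [|nra].
    rewrite !Cmod_mult_self. destruct p as [u v]. simpl in *. nra. }
  apply (Rmult_le_reg_r (Cmod p)); [exact Hp|]. unfold Rdiv. rewrite Rmult_assoc, Rinv_l; lra.
Qed.

Lemma pfaff_fun_analytic (a b c X z : C) : ~ is_nonpos_int c -> (Cmod (1 - X) <= 1)%R -> (Cmod z < 1)%R ->
  analytic_at (pfaff_fun a b c X) z.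
Proof.
  intros Hc HX Hz. apply analytic_at_mult.
  - apply psum_analytic; [apply subexp_bcoef|exact Hz].
  - apply psum_analytic; [|exact Hz]. apply subexp_mult; [apply subexp_bcoef|apply subexp_diff_tab; assumption].
Qed.

Lemma half_branch_analytic (a b c p z : C) : ~ is_nonpos_int c -> (1 / 2 <= Re p)%R ->
  (Re (p * z) < 1 / 2)%R -> analytic_at (half_branch a b c p) z.
Proof.
  intros Hc Hp Hz. destruct (inv_dist_one p Hp) as [N HX].
  apply (analytic_at_comp (pfaff_fun a b c (/ p)) (fun z => p * z / (p * z - 1))).
  - apply analytic_at_mult; [apply analytic_at_scal, analytic_at_id|].
    apply (analytic_at_comp (fun w => / w) (fun z => p * z - 1)).
    + apply analytic_at_minus; [apply analytic_at_scal, analytic_at_id|apply analytic_at_const].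
    + apply analytic_at_inv, half_plane_neq, Hz.
  - apply pfaff_fun_analytic; [exact Hc|exact HX|]. apply half_plane_map_lt, Hz.
Qed.

(** The double series of [pfaff_fun_gauss] converges absolutely only for z close
    to 0; this is enough for the identity theorem. *)
Lemma half_branch_gauss (a b c p : C) : ~ is_nonpos_int c -> (1 / 2 <= Re p)%R ->
  exists r, (0 < r)%R /\ forall z, (Cmod z < r)%R ->
    is_series (hyp2F1_term a b c z) (half_branch a b c p z).
Proof.
  intros Hc Hp. destruct (inv_dist_one p Hp) as [N HX].
  assert (Hm := proj1 (Cmod_gt_0 _) N).
  set (K := (8 * (1 + Cmod (/ p)))%R).
  assert (HK : (8 <= K)%R) by (unfold K; assert (h := Cmod_ge_0 (/ p)); lra).
  exists (/ (2 * K * Cmod p))%R. split; [apply Rinv_0_lt_compat; nra|].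
  intros z Hz.
  assert (Hpz : (Cmod (p * z) < / (2 * K))%R).
  { rewrite Cmod_mult. replace (/ (2 * K))%R with (Cmod p * / (2 * K * Cmod p))%R by (field; lra).
    apply Rmult_lt_compat_l; assumption. }
  assert (HK2 : (/ (2 * K) <= 1 / 16)%R).
  { replace (1 / 16)%R with (/ 16)%R by field. apply Rinv_le_contravar; lra. }
  assert (Hre : (Re (p * z) < 1 / 2)%R).
  { assert (h := re_le_Cmod (p * z)). revert h; unfold Rabs; destruct Rcase_abs; lra. }
  assert (N1 := half_plane_neq _ Hre).
  set (w := p * z) in *.
  assert (Hw1 : (1 - 1 / 16 <= Cmod (w - 1))%R).
  { assert (h := Cmod_triangle (w - 1) (- w)). rewrite Cmod_opp in h.
    replace (w - 1 + - w) with (- (1)) in h by ring. rewrite Cmod_m1 in h. lra. }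
  assert (Hzeta : (K * Cmod (w / (w - 1)) < 1)%R).
  { rewrite Cmod_div by exact N1. assert (Hw0 := Cmod_ge_0 w).
    apply (Rmult_lt_reg_r (Cmod (w - 1))); [lra|]. unfold Rdiv. rewrite <- Rmult_assoc, (Rmult_assoc (K * Cmod w)), Rinv_l by lra.
    assert (K * Cmod w < 1 / 2)%R; [|lra].
    replace (1 / 2)%R with (K * / (2 * K))%R by (field; lra). apply Rmult_lt_compat_l; lra. }
  assert (E := pfaff_fun_gauss a b c (/ p) (w / (w - 1)) Hc Hzeta).
  assert (Ez : - / p * (w / (w - 1)) / (1 - w / (w - 1)) = z).
  { replace (1 - w / (w - 1)) with (- / (w - 1)) by (field; exact N1).
    unfold w. field. split; [|exact N]. exact N1. }
  rewrite Ez in E. exact E.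
Qed.

Lemma gauss_analytic (a b c z : C) : ~ is_nonpos_int c -> (Cmod z < 1)%R ->
  analytic_at (psum (hcoef a b c)) z.
Proof. intros Hc Hz. apply psum_analytic; [apply subexp_hcoef, Hc|exact Hz]. Qed.

Lemma gauss_is (a b c z : C) : ~ is_nonpos_int c -> (Cmod z < 1)%R ->
  is_series (hyp2F1_term a b c z) (psum (hcoef a b c) z).
Proof.
  intros Hc Hz. eapply is_series_C_ext; [|apply psum_is; [apply (subexp_hcoef a b c Hc)|exact Hz]].
  intros n. symmetry. apply hyp2F1_term_hcoef.
Qed.

Lemma segment_0 z t : segment 0 z t = RtoC t * z.
Proof. unfold segment. ring. Qed.

Lemma zero_near_at (f : C -> C) z : zero_near f z -> f z = 0.
Proof.
  intros [r [Hr H]]. apply H. replace (z - z) with (RtoC 0) by ring. rewrite Cmod_0; exact Hr.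
Qed.

(** All domains below are star-shaped about 0. *)
Lemma eq_on_segment (f g : C -> C) (z : C) :
  (forall t, (0 <= t <= 1)%R -> analytic_at f (RtoC t * z)) ->
  (forall t, (0 <= t <= 1)%R -> analytic_at g (RtoC t * z)) ->
  (exists r, (0 < r)%R /\ forall w, (Cmod w < r)%R -> f w = g w) -> f z = g z.
Proof.
  intros Hf Hg [r [Hr H]]. apply Ceq_minus. apply (zero_near_at (fun z => f z - g z)).
  apply (identity_segment (fun z => f z - g z) 0 z).
  - intros t Ht. rewrite segment_0. apply analytic_at_minus; [apply Hf, Ht|apply Hg, Ht].
  - exists r. split; [exact Hr|]. intros w Hw. replace (w - 0) with w in Hw by ring.
    rewrite H by exact Hw. ring.
Qed.

Lemma Re_scal t w : Re (RtoC t * w) = (t * Re w)%R.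
Proof. apply re_scal_l. Qed.

Lemma half_seg (p z : C) t : (Re (p * z) < 1 / 2)%R -> (0 <= t <= 1)%R -> (Re (p * (RtoC t * z)) < 1 / 2)%R.
Proof.
  intros H Ht. replace (p * (RtoC t * z)) with (RtoC t * (p * z)) by ring. rewrite Re_scal.
  destruct (Rle_lt_dec (Re (p * z)) 0); nra.
Qed.

Lemma half_branch_indep (a b c p p' z : C) : ~ is_nonpos_int c ->
  (1 / 2 <= Re p)%R -> (1 / 2 <= Re p')%R -> (Re (p * z) < 1 / 2)%R -> (Re (p' * z) < 1 / 2)%R ->
  half_branch a b c p z = half_branch a b c p' z.
Proof.
  intros Hc Hp Hp' Hz Hz'. apply eq_on_segment.
  - intros t Ht. apply half_branch_analytic; try assumption. apply half_seg; assumption.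
  - intros t Ht. apply half_branch_analytic; try assumption. apply half_seg; assumption.
  - destruct (half_branch_gauss a b c p Hc Hp) as [r [Hr H]].
    destruct (half_branch_gauss a b c p' Hc Hp') as [r' [Hr' H']].
    exists (Rmin r r'). split; [apply Rmin_pos; assumption|]. intros w Hw.
    apply (is_series_C_unique (hyp2F1_term a b c w)).
    + apply H. eapply Rlt_le_trans; [exact Hw|apply Rmin_l].
    + apply H'. eapply Rlt_le_trans; [exact Hw|apply Rmin_r].
Qed.

(** A p with real part 1/2 whose half plane contains z: the line Re (p z) = 1/2
    passes through 1, and p is chosen to leave z on the same side as 0. *)
Definition half_plane_dir (z : C) : C :=
  ((1 / 2)%R, if Req_EM_T (Im z) 0 then 0%R else (Re z / (2 * Im z))%R).

Lemma half_plane_dir_spec z : cut_plane z -> (1 / 2 <= Re (half_plane_dir z))%R /\ (Re (half_plane_dir z * z) < 1 / 2)%R.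
Proof.
  intros Hz. split; [simpl; lra|].
  unfold half_plane_dir. destruct (Req_EM_T (Im z) 0) as [E|E].
  - rewrite re_mult. simpl. unfold cut_plane in Hz.
    destruct (Rle_lt_dec 1 (Re z)) as [h|h]; [exfalso; apply Hz; split; assumption|].
    change (fst z) with (Re z). lra.
  - rewrite re_mult. simpl. change (fst z) with (Re z). change (snd z) with (Im z).
    replace (1 / 2 * Re z - Re z / (2 * Im z) * Im z)%R with 0%R; [lra|]. field. exact E.
Qed.

(** Locally this is a single [half_branch], by [branch_half]. *)
Definition branch2F1 (a b c z : C) : C := half_branch a b c (half_plane_dir z) z.

Lemma half_plane_in_cut (p z : C) : (1 / 2 <= Re p)%R -> (Re (p * z) < 1 / 2)%R -> cut_plane z.
Proof.
  intros Hp Hz [E h]. rewrite re_mult, E in Hz. nra.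
Qed.

Lemma branch_half (a b c p z : C) : ~ is_nonpos_int c -> (1 / 2 <= Re p)%R ->
  (Re (p * z) < 1 / 2)%R -> branch2F1 a b c z = half_branch a b c p z.
Proof.
  intros Hc Hp Hz. destruct (half_plane_dir_spec z (half_plane_in_cut p z Hp Hz)) as [H1 H2].
  unfold branch2F1. exact (half_branch_indep a b c (half_plane_dir z) p z Hc H1 Hp H2 Hz).
Qed.

Lemma branch_analytic (a b c z : C) : ~ is_nonpos_int c -> cut_plane z -> analytic_at (branch2F1 a b c) z.
Proof.
  intros Hc Hz. destruct (half_plane_dir_spec z Hz) as [H1 H2]. set (p := half_plane_dir z) in *.
  destruct (inv_dist_one p H1) as [N _]. assert (Hm := proj1 (Cmod_gt_0 _) N).
  apply (analytic_at_ext (half_branch a b c p) _ z ((1 / 2 - Re (p * z)) / Cmod p)%R).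
  - apply Rdiv_lt_0_compat; lra.
  - intros w Hw. symmetry. apply branch_half; [exact Hc|exact H1|].
    replace (p * w) with (p * z + p * (w - z)) by ring. rewrite re_plus.
    assert (h := re_le_Cmod (p * (w - z))). rewrite Cmod_mult in h.
    assert (Cmod p * Cmod (w - z) < 1 / 2 - Re (p * z))%R.
    { apply (Rmult_lt_compat_l (Cmod p)) in Hw; [|exact Hm].
      replace (Cmod p * ((1 / 2 - Re (p * z)) / Cmod p))%R with (1 / 2 - Re (p * z))%R in Hw by (field; lra).
      exact Hw. }
    revert h. unfold Rabs. destruct Rcase_abs; lra.
  - apply half_branch_analytic; assumption.
Qed.

Lemma cut_seg z t : cut_plane z -> (0 <= t <= 1)%R -> cut_plane (RtoC t * z).
Proof.
  intros Hz Ht [E h]. rewrite im_scal_l in E. rewrite Re_scal in h.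
  destruct (Req_dec t 0) as [->|Ht0]; [lra|].
  apply Hz. split.
  - apply Rmult_integral in E. destruct E; [contradiction|assumption].
  - nra.
Qed.

Lemma disc_in_cut z : (Cmod z < 1)%R -> cut_plane z.
Proof.
  intros H [_ h]. assert (h' := re_le_Cmod z). revert h'; unfold Rabs; destruct Rcase_abs; lra.
Qed.

Lemma disc_seg z t : (Cmod z < 1)%R -> (0 <= t <= 1)%R -> (Cmod (RtoC t * z) < 1)%R.
Proof.
  intros H Ht. rewrite Cmod_mult, Cmod_R, Rabs_pos_eq by lra. assert (h := Cmod_ge_0 z). nra.
Qed.

Lemma branch_gauss (a b c z : C) : ~ is_nonpos_int c -> (Cmod z < 1)%R ->
  branch2F1 a b c z = psum (hcoef a b c) z.
Proof.
  intros Hc Hz. apply eq_on_segment.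
  - intros t Ht. apply branch_analytic; [exact Hc|]. apply disc_in_cut, disc_seg; assumption.
  - intros t Ht. apply gauss_analytic; [exact Hc|]. apply disc_seg; assumption.
  - destruct (half_branch_gauss a b c 1 Hc ltac:(simpl; lra)) as [r [Hr H]].
    exists (Rmin r (1/2)). split; [apply Rmin_pos; lra|]. intros w Hw.
    assert (h1 : (Cmod w < r)%R) by (eapply Rlt_le_trans; [exact Hw|apply Rmin_l]).
    assert (h2 : (Cmod w < 1/2)%R) by (eapply Rlt_le_trans; [exact Hw|apply Rmin_r]).
    rewrite (branch_half a b c 1 w Hc); [|simpl; lra|].
    + apply (is_series_C_unique (hyp2F1_term a b c w)); [apply H, h1|apply gauss_is; [exact Hc|lra]].
    + rewrite Cmult_1_l. assert (h' := re_le_Cmod w). revert h'; unfold Rabs; destruct Rcase_abs; lra.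
Qed.

(** The cut plane is star-shaped about 0, so the continuation is unique. *)
Lemma hyp2F1_branch (a b c z : C) : ~ is_nonpos_int c -> cut_plane z ->
  hyp2F1 a b c z = branch2F1 a b c z.
Proof.
  intros Hc Hz. unfold hyp2F1, Ciota.
  assert (B : is_hyp2F1_branch a b c (branch2F1 a b c)).
  { split.
    - intros w Hw. apply branch_analytic; assumption.
    - intros w Hw. rewrite branch_gauss by assumption. apply gauss_is; assumption. }
  apply (@iota_unique C_AbsRing C_CompleteNormedModule).
  - intros v [F [[HF1 HF2] <-]]. apply eq_on_segment.
    + intros t Ht. apply HF1, cut_seg; assumption.
    + intros t Ht. apply branch_analytic; [exact Hc|apply cut_seg; assumption].
    + exists 1%R. split; [lra|]. intros w Hw.
      apply (is_series_C_unique (hyp2F1_term a b c w)); [apply HF2, Hw|apply B, Hw].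
  - exists (branch2F1 a b c). split; [exact B|reflexivity].
Qed.

(** The half plane with p = 1, where the coefficients are given by
    [diff_tab_1]. *)
Lemma branch_pfaff (a b c z : C) : ~ is_nonpos_int c -> (Re z < 1 / 2)%R ->
  branch2F1 a b c z = binom_fun (- a) (z / (z - 1)) * psum (hcoef a (c - b) c) (z / (z - 1)).
Proof.
  intros Hc Hz. rewrite (branch_half a b c 1 z Hc); [|simpl; lra|rewrite Cmult_1_l; exact Hz].
  unfold half_branch, pfaff_fun. rewrite Cmult_1_l.
  replace (/ 1) with (RtoC 1) by field. f_equal. symmetry.
  apply psum_ext; [apply subexp_hcoef, Hc|apply half_plane_map_lt, Hz|].
  intros n. assert (H := diff_tab_1 b c n Hc 0). rewrite Nat.add_0_r in H. simpl (poch b 0) in H.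
  rewrite Cmult_1_r in H. unfold hcoef, bcoef. rewrite <- H. field.
  split; [apply fact_neq_0C|apply poch_neq_0, Hc].
Qed.

Lemma hcoef_sym (a b c : C) n : hcoef a b c n = hcoef b a c n.
Proof. unfold hcoef. rewrite (Cmult_comm (poch a n)). reflexivity. Qed.

Lemma branch_sym (a b c z : C) : ~ is_nonpos_int c -> cut_plane z -> branch2F1 a b c z = branch2F1 b a c z.
Proof.
  intros Hc Hz. apply eq_on_segment.
  - intros t Ht. apply branch_analytic; [exact Hc|apply cut_seg; assumption].
  - intros t Ht. apply branch_analytic; [exact Hc|apply cut_seg; assumption].
  - exists 1%R. split; [lra|]. intros w Hw. rewrite !branch_gauss by assumption.
    apply psum_ext; [apply subexp_hcoef, Hc|exact Hw|apply hcoef_sym].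
Qed.

(** * Calculus on the interval (0, 1) *)

(** Derivative of a complex function of a real variable, by components, so that
    the real calculus of power series and the mean value theorem apply. *)
Definition cder (f : R -> C) (t : R) (l : C) : Prop :=
  is_derive (fun s => Re (f s)) t (Re l) /\ is_derive (fun s => Im (f s)) t (Im l).

Lemma rder_eq (f : R -> R) (t l l' : R) : is_derive f t l -> l = l' -> is_derive f t l'.
Proof. intros H <-; exact H. Qed.

Lemma cder_eq (f : R -> C) (t : R) (l l' : C) : cder f t l -> l = l' -> cder f t l'.
Proof. intros H <-; exact H. Qed.

Lemma cder_ext_loc (f g : R -> C) (t : R) (l : C) :
  locally t (fun s => f s = g s) -> cder f t l -> cder g t l.
Proof.
  intros H [H1 H2]. split.
  - apply (is_derive_ext_loc (fun s => Re (f s))); [|exact H1].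
    revert H; apply filter_imp; intros s ->; reflexivity.
  - apply (is_derive_ext_loc (fun s => Im (f s))); [|exact H2].
    revert H; apply filter_imp; intros s ->; reflexivity.
Qed.

Lemma locally_open01 (t : R) (P : R -> Prop) : (0 < t < 1)%R ->
  (forall s, (0 < s < 1)%R -> P s) -> locally t P.
Proof.
  intros Ht H.
  assert (Hd : (0 < Rmin t (1 - t))%R) by (apply Rmin_pos; lra).
  exists (mkposreal _ Hd). intros s Hs. apply H.
  change (Rabs (s - t) < Rmin t (1 - t))%R in Hs.
  assert (h1 := Rmin_l t (1 - t)). assert (h2 := Rmin_r t (1 - t)).
  revert Hs; unfold Rabs; destruct Rcase_abs; lra.
Qed.

Lemma cder_ext01 (f g : R -> C) (t : R) (l : C) : (0 < t < 1)%R ->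
  (forall s, (0 < s < 1)%R -> f s = g s) -> cder f t l -> cder g t l.
Proof. intros Ht H. apply cder_ext_loc. apply locally_open01; assumption. Qed.

Lemma cder_const (k : C) t : cder (fun _ => k) t 0.
Proof. split; apply (is_derive_const (K := R_AbsRing) (V := R_NormedModule)). Qed.

Lemma cder_id t : cder RtoC t 1.
Proof.
  split; simpl.
  - exact (is_derive_id (K := R_AbsRing) t).
  - apply (is_derive_const (K := R_AbsRing) (V := R_NormedModule)).
Qed.

Lemma cder_plus (f g : R -> C) t l m : cder f t l -> cder g t m -> cder (fun s => f s + g s) t (l + m).
Proof.
  intros [f1 f2] [g1 g2]. split.
  - exact (is_derive_plus _ _ _ _ _ f1 g1).
  - exact (is_derive_plus _ _ _ _ _ f2 g2).
Qed.

Lemma rder_mult (f g : R -> R) t l m : is_derive f t l -> is_derive g t m ->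
  is_derive (fun s => f s * g s)%R t (l * g t + f t * m)%R.
Proof. intros Hf Hg. exact (is_derive_mult f g t l m Hf Hg Rmult_comm). Qed.

Lemma cder_mult (f g : R -> C) t l m : cder f t l -> cder g t m ->
  cder (fun s => f s * g s) t (l * g t + f t * m).
Proof.
  intros [f1 f2] [g1 g2]. split.
  - eapply rder_eq.
    + exact (is_derive_minus _ _ _ _ _ (rder_mult _ _ _ _ _ f1 g1) (rder_mult _ _ _ _ _ f2 g2)).
    + rewrite re_plus, !re_mult. unfold minus, plus, opp; simpl. ring.
  - eapply rder_eq.
    + exact (is_derive_plus _ _ _ _ _ (rder_mult _ _ _ _ _ f1 g2) (rder_mult _ _ _ _ _ f2 g1)).
    + rewrite im_plus, !im_mult. unfold minus, plus, opp; simpl. ring.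
Qed.

Lemma cder_scal (k : C) (f : R -> C) t l : cder f t l -> cder (fun s => k * f s) t (k * l).
Proof.
  intros H. eapply cder_eq; [apply cder_mult; [apply cder_const|exact H]|]. cbv beta; ring.
Qed.

Lemma cder_minus (f g : R -> C) t l m : cder f t l -> cder g t m -> cder (fun s => f s - g s) t (l - m).
Proof.
  intros [f1 f2] [g1 g2]. split.
  - exact (is_derive_minus _ _ _ _ _ f1 g1).
  - exact (is_derive_minus _ _ _ _ _ f2 g2).
Qed.

Lemma cder_flip (f : R -> C) t l : cder f (1 - t) l -> cder (fun s => f (1 - s)%R) t (- l).
Proof.
  assert (D : is_derive (fun s : R => (1 - s)%R) t (-1)%R).
  { auto_derive; [exact I|ring]. }
  intros [f1 f2]. split.
  - eapply rder_eq; [exact (is_derive_comp (fun s => Re (f s)) (fun s : R => (1 - s)%R) t _ _ f1 D)|].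
    rewrite re_opp. change (-1 * Re l = - Re l)%R. ring.
  - eapply rder_eq; [exact (is_derive_comp (fun s => Im (f s)) (fun s : R => (1 - s)%R) t _ _ f2 D)|].
    rewrite im_opp. change (-1 * Im l = - Im l)%R. ring.
Qed.

Lemma C_eq_parts (z w : C) : Re z = Re w -> Im z = Im w -> z = w.
Proof. destruct z, w; simpl; intros -> ->; reflexivity. Qed.

Lemma cder_unique (f : R -> C) t l m : cder f t l -> cder f t m -> l = m.
Proof.
  intros [f1 f2] [g1 g2]. apply C_eq_parts.
  - rewrite <- (is_derive_unique _ _ _ f1). exact (is_derive_unique _ _ _ g1).
  - rewrite <- (is_derive_unique _ _ _ f2). exact (is_derive_unique _ _ _ g2).
Qed.

Lemma rder_zero_const (f : R -> R) : (forall t, (0 < t < 1)%R -> is_derive f t 0%R) ->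
  forall s t, (0 < s < 1)%R -> (0 < t < 1)%R -> f s = f t.
Proof.
  intros H s t Hs Ht.
  assert (Hm := Rmin_case s t (fun x => (0 < x < 1)%R) Hs Ht).
  assert (HM := Rmax_case s t (fun x => (0 < x < 1)%R) Hs Ht).
  destruct (MVT_gen f s t (fun _ => 0%R)) as [x [_ Hx]].
  - intros x Hx. apply H. lra.
  - intros x Hx. apply derivable_continuous_pt. exists 0%R. apply is_derive_Reals, H. lra.
  - lra.
Qed.

Lemma cder_zero_const (f : R -> C) : (forall t, (0 < t < 1)%R -> cder f t 0) ->
  forall s t, (0 < s < 1)%R -> (0 < t < 1)%R -> f s = f t.
Proof.
  intros H s t Hs Ht. apply C_eq_parts.
  - apply (rder_zero_const (fun x => Re (f x))); try assumption. intros x Hx. apply (H x Hx).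
  - apply (rder_zero_const (fun x => Im (f x))); try assumption. intros x Hx. apply (H x Hx).
Qed.

Lemma im_le_Cmod (z : C) : (Rabs (Im z) <= Cmod z)%R.
Proof. eapply Rle_trans; [|apply Rmax_Cmod]. apply Rmax_r. Qed.

Lemma Re_sum (u : nat -> C) N : Re (sum_n u N) = sum_n (fun n => Re (u n)) N.
Proof.
  induction N as [|N IH]; [rewrite csum_0, rsum_0; reflexivity|].
  rewrite csum_S, rsum_S, re_plus, IH. reflexivity.
Qed.

Lemma Im_sum (u : nat -> C) N : Im (sum_n u N) = sum_n (fun n => Im (u n)) N.
Proof.
  induction N as [|N IH]; [rewrite csum_0, rsum_0; reflexivity|].
  rewrite csum_S, rsum_S, im_plus, IH. reflexivity.
Qed.

Lemma is_series_Re (u : nat -> C) l : is_series u l -> is_series (fun n => Re (u n)) (Re l).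
Proof.
  intros H. apply (filterlim_R_iff eventually). intros eps He.
  destruct (proj1 (filterlim_C_iff eventually (sum_n u) l) H eps He) as [N HN].
  exists N. intros n Hn. specialize (HN n Hn). change (Rabs (sum_n (fun n => Re (u n)) n - Re l) < eps)%R.
  rewrite <- Re_sum. assert (h := re_le_Cmod (sum_n u n - l)).
  unfold Cminus in h. rewrite re_plus, re_opp in h. unfold Rminus. 
  eapply Rle_lt_trans; [exact h|exact HN].
Qed.

Lemma is_series_Im (u : nat -> C) l : is_series u l -> is_series (fun n => Im (u n)) (Im l).
Proof.
  intros H. apply (filterlim_R_iff eventually). intros eps He.
  destruct (proj1 (filterlim_C_iff eventually (sum_n u) l) H eps He) as [N HN].
  exists N. intros n Hn. specialize (HN n Hn). change (Rabs (sum_n (fun n => Im (u n)) n - Im l) < eps)%R.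
  rewrite <- Im_sum. assert (h := im_le_Cmod (sum_n u n - l)).
  unfold Cminus in h. rewrite im_plus, im_opp in h. unfold Rminus. 
  eapply Rle_lt_trans; [exact h|exact HN].
Qed.

(** Coefficients of the derivative. *)
Definition dcoef (a : nat -> C) (n : nat) : C := INR (S n) * a (S n).

Lemma subexp_dcoef a : subexp a -> subexp (dcoef a).
Proof. intros H. apply subexp_mult; [apply subexp_INR|apply subexp_shift, H]. Qed.

Lemma subexp_CV_radius (a : nat -> R) (b : nat -> C) (x : R) : subexp b ->
  (forall n, (Rabs (a n) <= Cmod (b n))%R) -> (Rabs x < 1)%R -> Rbar_lt (Rabs x) (CV_radius a).
Proof.
  intros Hb Hab Hx. apply Rbar_lt_le_trans with (Finite ((Rabs x + 1) / 2)); [simpl; lra|].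
  apply (CV_radius_bounded a).
  assert (h := Rabs_pos x).
  assert (S := subexp_summable b (RtoC ((Rabs x + 1) / 2)) Hb).
  rewrite Cmod_R, Rabs_pos_eq in S by lra. specialize (S ltac:(lra)).
  destruct (ex_series_terms_bounded _ (abs_summable_ex _ S)) as [M [HM HB]].
  exists M. intros n. eapply Rle_trans; [|apply (HB n)].
  rewrite Rabs_mult, <- RPow_abs, Cmod_mult, Cmod_pow, Cmod_R.
  apply Rmult_le_compat_r; [apply pow_le, Rabs_pos|apply Hab].
Qed.

Lemma psum_Re (a : nat -> C) (s : R) : subexp a -> (Rabs s < 1)%R ->
  Re (psum a s) = PSeries (fun n => Re (a n)) s.
Proof.
  intros Ha Hs. symmetry. apply is_series_unique.
  eapply is_series_ext; [|apply is_series_Re, psum_is; [exact Ha|rewrite Cmod_R; exact Hs]].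
  intros n. cbv beta. rewrite <- RtoC_pow, re_scal_r. reflexivity.
Qed.

Lemma psum_Im (a : nat -> C) (s : R) : subexp a -> (Rabs s < 1)%R ->
  Im (psum a s) = PSeries (fun n => Im (a n)) s.
Proof.
  intros Ha Hs. symmetry. apply is_series_unique.
  eapply is_series_ext; [|apply is_series_Im, psum_is; [exact Ha|rewrite Cmod_R; exact Hs]].
  intros n. cbv beta. rewrite <- RtoC_pow, im_scal_r. reflexivity.
Qed.

Lemma locally_disc (t : R) (P : R -> Prop) : (Rabs t < 1)%R ->
  (forall s, (Rabs s < 1)%R -> P s) -> locally t P.
Proof.
  intros Ht H. assert (Hd : (0 < 1 - Rabs t)%R) by lra.
  exists (mkposreal _ Hd). intros s Hs. apply H. change (Rabs (s - t) < 1 - Rabs t)%R in Hs.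
  replace s with ((s - t) + t)%R by ring. eapply Rle_lt_trans; [apply Rabs_triang|lra].
Qed.

(** Componentwise, this is termwise differentiation of two real power series. *)
Lemma cder_psum (a : nat -> C) (t : R) : subexp a -> (Rabs t < 1)%R ->
  cder (fun s => psum a (RtoC s)) t (psum (dcoef a) t).
Proof.
  intros Ha Ht. split.
  - apply (is_derive_ext_loc (PSeries (fun n => Re (a n)))).
    + apply locally_disc; [exact Ht|]. intros s Hs. symmetry. apply psum_Re; assumption.
    + rewrite psum_Re by (try apply subexp_dcoef; assumption).
      eapply rder_eq; [apply is_derive_PSeries|].
      * apply (subexp_CV_radius _ a); [exact Ha|intros n; apply re_le_Cmod|exact Ht].
      * apply PSeries_ext. intros n. unfold PS_derive, dcoef. rewrite re_scal_l. reflexivity.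
  - apply (is_derive_ext_loc (PSeries (fun n => Im (a n)))).
    + apply locally_disc; [exact Ht|]. intros s Hs. symmetry. apply psum_Im; assumption.
    + rewrite psum_Im by (try apply subexp_dcoef; assumption).
      eapply rder_eq; [apply is_derive_PSeries|].
      * apply (subexp_CV_radius _ a); [exact Ha|intros n; apply im_le_Cmod|exact Ht].
      * apply PSeries_ext. intros n. unfold PS_derive, dcoef. rewrite im_scal_l. reflexivity.
Qed.

(** * Complex powers of positive reals *)
Lemma Cexp_plus (z w : C) : Cexp (z + w) = Cexp z * Cexp w.
Proof.
  destruct z as [x y], w as [u v]. unfold Cexp, Cplus, Cmult; simpl.
  rewrite exp_plus, cos_plus, sin_plus. f_equal; ring.
Qed.

Lemma Cexp_0 : Cexp 0 = 1.
Proof. unfold Cexp, RtoC; simpl. rewrite exp_0, cos_0, sin_0. f_equal; ring. Qed.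

Lemma Cexp_neq_0 z : Cexp z <> 0.
Proof.
  intros E. apply C1_nz. rewrite <- Cexp_0. replace (RtoC 0) with (z + - z) by ring.
  rewrite Cexp_plus, E. ring.
Qed.

Lemma Cmod_Cexp z : Cmod (Cexp z) = exp (Re z).
Proof.
  assert (h := exp_pos (Re z)).
  assert (H : (Cmod (Cexp z) * Cmod (Cexp z) = exp (Re z) * exp (Re z))%R).
  { assert (H := Cmod2_alt (Cexp z)). unfold Cexp in H at 2 3. simpl in H.
    assert (S := sin2_cos2 (Im z)). unfold Rsqr in S. 
    change (fst z) with (Re z) in *. change (snd z) with (Im z) in *.
    transitivity (Cmod (Cexp z) * (Cmod (Cexp z) * 1))%R; [ring|]. rewrite H.
    transitivity (exp (Re z) * exp (Re z) * (sin (Im z) * sin (Im z) + cos (Im z) * cos (Im z)))%R; [ring|].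
    rewrite S; ring. }
  assert (h' := Cmod_ge_0 (Cexp z)). nra.
Qed.

(** The power t^al for t > 0. *)
Definition rcpow (al : C) (t : R) : C := Cexp (al * ln t).

Lemma rcpow_add al be t : rcpow (al + be) t = rcpow al t * rcpow be t.
Proof. unfold rcpow. rewrite <- Cexp_plus. f_equal. ring. Qed.

Lemma rcpow_0 t : rcpow 0 t = 1.
Proof. unfold rcpow. rewrite Cmult_0_l. apply Cexp_0. Qed.

Lemma rcpow_1 t : (0 < t)%R -> rcpow 1 t = t.
Proof.
  intros Ht. unfold rcpow. rewrite Cmult_1_l. apply C_eq_parts; unfold Cexp; simpl.
  - rewrite cos_0, exp_ln by exact Ht. ring.
  - rewrite sin_0. ring.
Qed.

Lemma rcpow_neq_0 al t : rcpow al t <> 0.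
Proof. apply Cexp_neq_0. Qed.

Lemma rcpow_S al t : (0 < t)%R -> rcpow (al + 1) t = rcpow al t * t.
Proof. intros Ht. rewrite rcpow_add, rcpow_1 by exact Ht. reflexivity. Qed.

Lemma cder_rcpow al t : (0 < t)%R -> cder (rcpow al) t (al * rcpow (al - 1) t).
Proof.
  intros Ht.
  assert (E : al * rcpow (al - 1) t = al / t * rcpow al t).
  { replace al with ((al - 1) + 1) at 4 by ring. rewrite rcpow_S by exact Ht. field.
    intros e; apply RtoC_inj in e; lra. }
  rewrite E. unfold rcpow, Cexp. split.
  - apply (is_derive_ext (fun s => exp (Re al * ln s) * cos (Im al * ln s))%R).
    + intros s. rewrite re_scal_r, im_scal_r. reflexivity.
    + auto_derive; [lra|]. unfold Cdiv. rewrite <- RtoC_inv by lra.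
      rewrite re_mult, re_scal_r, im_scal_r, re_scal_r, im_scal_r. simpl. field. lra.
  - apply (is_derive_ext (fun s => exp (Re al * ln s) * sin (Im al * ln s))%R).
    + intros s. rewrite re_scal_r, im_scal_r. reflexivity.
    + auto_derive; [lra|]. unfold Cdiv. rewrite <- RtoC_inv by lra.
      rewrite im_mult, re_scal_r, im_scal_r, re_scal_r, im_scal_r. simpl. field. lra.
Qed.

(** * Differential and contiguity relations of the Gauss series *)

Lemma psum_plus (a b : nat -> C) z : subexp a -> subexp b -> (Cmod z < 1)%R ->
  psum a z + psum b z = psum (fun n => a n + b n) z.
Proof.
  intros Ha Hb Hz. symmetry. apply Csum_unique.
  eapply is_series_C_ext; [|apply is_series_C_plus; apply psum_is; [exact Ha|exact Hz|exact Hb|exact Hz]].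
  intros n; cbv beta; cring.
Qed.

Lemma psum_scal (k : C) (a : nat -> C) z : subexp a -> (Cmod z < 1)%R ->
  k * psum a z = psum (fun n => k * a n) z.
Proof.
  intros Ha Hz. symmetry. apply Csum_unique.
  eapply is_series_C_ext; [|apply is_series_C_scal, psum_is; [exact Ha|exact Hz]].
  intros n; cbv beta; cring.
Qed.

Definition xcoef (a : nat -> C) (n : nat) : C := match n with O => 0 | S n => a n end.

Lemma subexp_xcoef a : subexp a -> subexp (xcoef a).
Proof.
  intros Ha Q HQ. destruct (Ha Q HQ) as [M [HM HB]]. exists M; split; [exact HM|].
  intros [|n]; simpl.
  - rewrite Cmod_0. lra.
  - eapply Rle_trans; [apply HB|]. apply Rmult_le_compat_l; [lra|].
    assert (h := pow_R1_Rle Q n ltac:(lra)). nra.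
Qed.

Lemma xcoef_dcoef a n : xcoef (dcoef a) n = INR n * a n.
Proof. destruct n as [|n]; [simpl; ring|reflexivity]. Qed.

Lemma psum_x (a : nat -> C) z : subexp a -> (Cmod z < 1)%R -> z * psum a z = psum (xcoef a) z.
Proof.
  intros Ha Hz. symmetry. apply Csum_unique.
  assert (H := is_series_shift_1 _ _ (is_series_C_scal z _ _ (psum_is a z Ha Hz))).
  eapply is_series_C_ext; [|exact H].
  intros [|n]; cbv beta iota; unfold xcoef; [simpl; cring|]. rewrite Cpow_S. cring.
Qed.

Lemma hcoef_rec (a b c : C) n : ~ is_nonpos_int c ->
  INR (S n) * (c + INR n) * hcoef a b c (S n) = (a + INR n) * (b + INR n) * hcoef a b c n.
Proof.
  intros Hc. unfold hcoef. rewrite !poch_S, fact_S_C. field.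
  nz.
Qed.

(** Equivalent to the two-term recursion [hcoef_rec] of the coefficients. *)
Lemma hyp_ode (a b c z : C) (Hc : ~ is_nonpos_int c) (Hz : (Cmod z < 1)%R) :
  let h := hcoef a b c in
  z * (1 - z) * psum (dcoef (dcoef h)) z + (c - (a + b + 1) * z) * psum (dcoef h) z - a * b * psum h z = 0.
Proof.
  intros h. assert (sh : subexp h) by apply subexp_hcoef, Hc.
  assert (s1 := subexp_dcoef _ sh). assert (s2 := subexp_dcoef _ s1).
  assert (s3 := subexp_xcoef _ s2). assert (s4 := subexp_xcoef _ s1).
  assert (s5 := subexp_xcoef _ s3).
  replace (z * (1 - z) * psum (dcoef (dcoef h)) z + (c - (a + b + 1) * z) * psum (dcoef h) z - a * b * psum h z)
   with (psum (xcoef (dcoef (dcoef h))) z + (-(1)) * psum (xcoef (xcoef (dcoef (dcoef h)))) z + c * psum (dcoef h) z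
     + (- (a + b + 1)) * psum (xcoef (dcoef h)) z + (- (a * b)) * psum h z).
  2:{ rewrite <- !psum_x by assumption. ring. }
  rewrite !psum_scal by assumption.
  rewrite !psum_plus by (repeat first [assumption | apply subexp_scal | apply subexp_plus]).
  apply Csum_unique.
  assert (Z : forall n, xcoef (dcoef (dcoef h)) n + - (1) * xcoef (xcoef (dcoef (dcoef h))) n + c * dcoef h n +
       - (a + b + 1) * xcoef (dcoef h) n + - (a * b) * h n = 0).
  { intros n. assert (R := hcoef_rec a b c n Hc). fold h in R.
    destruct n as [|[|n]]; unfold xcoef, dcoef.
    - rewrite !RtoC_INR_S in *. change (RtoC (INR 0)) with (RtoC 0) in *.
      transitivity ((0 + 1) * (c + 0) * h 1%nat - a * b * h 0%nat); [ring|]. rewrite R. ring.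
    - rewrite !RtoC_INR_S in *. change (RtoC (INR 0)) with (RtoC 0) in *.
      transitivity ((0 + 1 + 1) * (c + (0 + 1)) * h 2%nat - (a + (0 + 1)) * (b + (0 + 1)) * h 1%nat); [ring|]. rewrite R. ring.
    - rewrite !RtoC_INR_S in *.
      match type of R with ?l = ?r => transitivity (l - r) end; [ring|]. rewrite R. ring. }
  eapply is_series_C_ext; [|apply (is_series_single (RtoC 0))].
  intros n. cbv beta. rewrite Z. destruct n; cbn [Nat.eqb]; cring.
Qed.

(** The first-order operator that raises c by 1. *)
Lemma hyp_raise_c (a b c z : C) (Hc : ~ is_nonpos_int c) (Hz : (Cmod z < 1)%R) :
  let h := hcoef a b c in
  (1 - z) * psum (dcoef h) z + (c - a - b) * psum h z =
  (c - a) * (c - b) / c * psum (hcoef a b (c + 1)) z.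
Proof.
  intros h. assert (sh : subexp h) by apply subexp_hcoef, Hc.
  assert (Hc1 := nonpos_int_S c Hc). assert (s1 := subexp_dcoef _ sh). assert (s2 := subexp_xcoef _ s1).
  replace ((1 - z) * psum (dcoef h) z) with (psum (dcoef h) z + (-(1)) * psum (xcoef (dcoef h)) z).
  2:{ rewrite <- psum_x by assumption. ring. }
  rewrite !psum_scal by (try apply subexp_hcoef; assumption).
  rewrite !psum_plus by (repeat first [assumption | apply subexp_scal | apply subexp_plus]).
  apply psum_ext; [repeat first [assumption | apply subexp_scal | apply subexp_plus]|exact Hz|].
  intros n. assert (R := hcoef_rec a b c n Hc). fold h in R.
  assert (c0 := nonpos_int_neq_0 c Hc).
  assert (cn := nonpos_int_plus c n Hc).
  assert (E : hcoef a b (c + 1) n = c / (c + INR n) * h n).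
  { unfold h, hcoef. assert (P := poch_S_l c n). rewrite poch_S in P.
    assert (p1 := poch_neq_0 (c + 1) n Hc1). assert (p2 := poch_neq_0 c n Hc).
    replace (poch (c + 1) n) with (poch c n * (c + INR n) / c) by (rewrite P; field; exact c0).
    field. nz. }
  rewrite E.
  rewrite xcoef_dcoef. unfold dcoef.
  replace (INR (S n) * h (S n)) with ((a + INR n) * (b + INR n) * h n / (c + INR n)).
  2:{ rewrite <- R. field. exact cn. }
  field. split; assumption.
Qed.

Lemma hyp_deriv (a b c z : C) (Hc : ~ is_nonpos_int c) (Hz : (Cmod z < 1)%R) :
  psum (dcoef (hcoef a b c)) z = a * b / c * psum (hcoef (a + 1) (b + 1) (c + 1)) z.
Proof.
  assert (Hc1 := nonpos_int_S c Hc). assert (sh := subexp_hcoef a b c Hc).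
  rewrite psum_scal by (try apply subexp_hcoef; assumption).
  apply psum_ext; [apply subexp_dcoef, sh|exact Hz|]. intros n. unfold dcoef, hcoef.
  rewrite !poch_S_l, fact_S_C.
  assert (c0 := nonpos_int_neq_0 c Hc).
  field. nz.
Qed.

(** * Solutions of the hypergeometric equation on (0, 1) *)

Lemma RtoC_neq_0 (t : R) : t <> 0%R -> RtoC t <> 0.
Proof. intros H E. apply H, RtoC_inj, E. Qed.

Lemma not_int_not_nonpos (s : C) : ~ is_int s -> ~ is_nonpos_int s.
Proof.
  intros H [n Hn]. apply H. exists (- Z.of_nat n)%Z. rewrite Hn, opp_IZR, <- INR_IZR_INZ, RtoC_opp. reflexivity.
Qed.

Lemma not_int_opp (s : C) : ~ is_int s -> ~ is_int (- s).
Proof.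
  intros H [n Hn]. apply H. exists (- n)%Z. rewrite opp_IZR, RtoC_opp, <- Hn. ring.
Qed.

Lemma not_int_plus_Z (s : C) (k : Z) : ~ is_int s -> ~ is_int (s + IZR k).
Proof.
  intros H [n Hn]. apply H. exists (n - k)%Z. rewrite minus_IZR, RtoC_minus, <- Hn. ring.
Qed.

Lemma not_int_plus_nat (s : C) (k : nat) : ~ is_int s -> ~ is_int (s + INR k).
Proof. intros H. rewrite INR_IZR_INZ. apply not_int_plus_Z, H. Qed.

Lemma not_int_S (s : C) : ~ is_int s -> ~ is_int (s + 1).
Proof. exact (not_int_plus_Z s 1). Qed.

Lemma not_int_0 (s : C) : ~ is_int s -> s <> 0.
Proof. intros H E. apply H. exists 0%Z. exact E. Qed.

Lemma not_int_minus_nat (s : C) (k : nat) : ~ is_int s -> ~ is_int (s - INR k).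
Proof.
  intros H. replace (s - INR k) with (s + IZR (- Z.of_nat k)); [apply not_int_plus_Z, H|].
  rewrite opp_IZR, <- INR_IZR_INZ, RtoC_opp. reflexivity.
Qed.

Lemma not_int_swap (a b : C) : ~ is_int (a - b) -> ~ is_int (b - a).
Proof. intros H. replace (b - a) with (- (a - b)) by ring. apply not_int_opp, H. Qed.

Lemma not_nonpos_S (s : C) : ~ is_int s -> ~ is_nonpos_int (s + 1).
Proof. intros H. apply not_int_not_nonpos, not_int_S, H. Qed.

Lemma not_nonpos_1_minus (s : C) : ~ is_int s -> ~ is_nonpos_int (1 - s).
Proof.
  intros H. replace (1 - s) with (- s + 1) by ring. apply not_nonpos_S, not_int_opp, H.
Qed.

(** The hypergeometric equation with c = s + a + b, in the variable t = 1 - zeta;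
    y1 is the derivative of y. *)
Definition hyp_sol (a b s : C) (y y1 : R -> C) : Prop :=
  exists y2 : R -> C, forall t, (0 < t < 1)%R ->
   cder y t (y1 t) /\ cder y1 t (y2 t) /\
   RtoC t * (1 - RtoC t) * y2 t + (1 - s - (a + b + 1) * RtoC t) * y1 t - a * b * y t = 0.

(** The Wronskian times the integrating factor of the equation. *)
Definition wronsk (a b s : C) (y y1 z z1 : R -> C) (t : R) : C :=
  rcpow (s + a + b) (1 - t) * rcpow (1 - s) t * (y t * z1 t - y1 t * z t).

Lemma wronsk_const (a b s : C) (y y1 z z1 : R -> C) :
  hyp_sol a b s y y1 -> hyp_sol a b s z z1 ->
  forall t t', (0 < t < 1)%R -> (0 < t' < 1)%R -> wronsk a b s y y1 z z1 t = wronsk a b s y y1 z z1 t'.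
Proof.
  intros [y2 Hy] [z2 Hz]. apply cder_zero_const. intros t Ht.
  destruct (Hy t Ht) as [Y1 [Y2 Y3]]. destruct (Hz t Ht) as [Z1 [Z2 Z3]].
  assert (t0 : RtoC t <> 0) by (apply RtoC_neq_0; lra).
  assert (t1 : 1 - RtoC t <> 0) by (rewrite <- RtoC_minus; apply RtoC_neq_0; lra).
  eapply cder_eq.
  - apply cder_mult; [apply cder_mult|apply cder_minus; apply cder_mult].
    + apply (cder_flip (rcpow (s + a + b))). apply cder_rcpow. lra.
    + apply cder_rcpow. lra.
    + exact Y1.
    + exact Z2.
    + exact Y2.
    + exact Z1.
  - cbv beta.
    assert (E1 : rcpow (s + a + b) (1 - t) = rcpow (s + a + b - 1) (1 - t) * (1 - RtoC t)).
    { rewrite <- RtoC_minus. rewrite <- rcpow_S by lra. f_equal. ring. }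
    assert (E2 : rcpow (1 - s) t = rcpow (1 - s - 1) t * RtoC t).
    { rewrite <- rcpow_S by lra. f_equal. ring. }
    rewrite E1, E2.
    set (p := rcpow (s + a + b - 1) (1 - t)). set (q := rcpow (1 - s - 1) t).
    assert (EY : RtoC t * (1 - RtoC t) * y2 t = a * b * y t - (1 - s - (a + b + 1) * RtoC t) * y1 t).
    { match type of Y3 with ?l = _ => transitivity (l + (a * b * y t - (1 - s - (a + b + 1) * RtoC t) * y1 t)) end; [ring|]. rewrite Y3; ring. }
    assert (EZ : RtoC t * (1 - RtoC t) * z2 t = a * b * z t - (1 - s - (a + b + 1) * RtoC t) * z1 t).
    { match type of Z3 with ?l = _ => transitivity (l + (a * b * z t - (1 - s - (a + b + 1) * RtoC t) * z1 t)) end; [ring|]. rewrite Z3; ring. }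
    transitivity (p * q * ((- (s + a + b) * RtoC t + (1 - s) * (1 - RtoC t)) * (y t * z1 t - y1 t * z t)
       + (y t * (RtoC t * (1 - RtoC t) * z2 t) - (RtoC t * (1 - RtoC t) * y2 t) * z t))); [ring|].
    rewrite EY, EZ. ring.
Qed.

Section Solutions.
Variables (a b c : C).
Let s := c - a - b.

(** The solution regular at t = 1; primed names denote derivatives. *)
Definition y_reg1 (t : R) : C := psum (hcoef a b c) (RtoC (1 - t)).
Definition y_reg1' (t : R) : C := - psum (dcoef (hcoef a b c)) (RtoC (1 - t)).
Definition G_reg0 (z : C) : C := psum (hcoef a b (1 - s)) z.
Definition G_reg0' (z : C) : C := psum (dcoef (hcoef a b (1 - s))) z.
Definition G_exp0 (z : C) : C := psum (hcoef (c - a) (c - b) (s + 1)) z.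
Definition G_exp0' (z : C) : C := psum (dcoef (hcoef (c - a) (c - b) (s + 1))) z.
(** The solution regular at t = 0. *)
Definition y_reg0 (t : R) : C := G_reg0 (RtoC t).
Definition y_reg0' (t : R) : C := G_reg0' (RtoC t).
(** The solution with exponent s at t = 0. *)
Definition y_exp0 (t : R) : C := rcpow s t * G_exp0 (RtoC t).
Definition y_exp0' (t : R) : C := rcpow (s - 1) t * (s * G_exp0 (RtoC t) + RtoC t * G_exp0' (RtoC t)).
End Solutions.

Lemma Cmod_R_lt1 (t : R) : (0 < t < 1)%R -> (Cmod (RtoC t) < 1)%R.
Proof. intros H. rewrite Cmod_R, Rabs_pos_eq; lra. Qed.

Section Equations.
Variables (a b c : C).
Hypothesis Hc : ~ is_nonpos_int c.
Let s := c - a - b.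
Hypothesis Hs : ~ is_int s.

Lemma y_reg1_sol : hyp_sol a b s (y_reg1 a b c) (y_reg1' a b c).
Proof.
  exists (fun t => psum (dcoef (dcoef (hcoef a b c))) (RtoC (1 - t))). intros t Ht.
  assert (sh := subexp_hcoef a b c Hc).
  assert (s1 := subexp_dcoef _ sh).
  assert (H1 : (Rabs (1 - t) < 1)%R) by (rewrite Rabs_pos_eq; lra).
  split; [|split].
  - apply (cder_flip (fun x => psum (hcoef a b c) (RtoC x))). apply cder_psum; assumption.
  - unfold y_reg1'. eapply cder_eq.
    + apply (cder_ext_loc (fun t => -(1) * psum (dcoef (hcoef a b c)) (RtoC (1 - t)))).
      * apply filter_forall. intros x. ring.
      * apply cder_scal. apply (cder_flip (fun x => psum (dcoef (hcoef a b c)) (RtoC x))). apply cder_psum; assumption.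
    + ring.
  - unfold y_reg1, y_reg1'.
    assert (H := hyp_ode a b c (RtoC (1 - t)) Hc ltac:(rewrite Cmod_R; exact H1)). cbv zeta in H.
    rewrite <- H. unfold s. rewrite RtoC_minus. ring.
Qed.

Lemma y_reg0_sol : hyp_sol a b s (y_reg0 a b c) (y_reg0' a b c).
Proof.
  exists (fun t => psum (dcoef (dcoef (hcoef a b (1 - s)))) (RtoC t)). intros t Ht.
  assert (H1s := not_nonpos_1_minus s Hs). assert (sh := subexp_hcoef a b (1 - s) H1s).
  assert (sd := subexp_dcoef _ sh).
  assert (H1 : (Rabs t < 1)%R) by (rewrite Rabs_pos_eq; lra).
  split; [|split].
  - apply cder_psum; assumption.
  - apply cder_psum; assumption.
  - exact (hyp_ode a b (1 - s) (RtoC t) H1s (Cmod_R_lt1 t Ht)).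
Qed.

Lemma y_exp0_sol : hyp_sol a b s (y_exp0 a b c) (y_exp0' a b c).
Proof.
  exists (fun t => rcpow (s - 2) t * (s * (s - 1) * G_exp0 a b c (RtoC t) + 2 * s * RtoC t * G_exp0' a b c (RtoC t) +
     RtoC t * RtoC t * psum (dcoef (dcoef (hcoef (c - a) (c - b) (s + 1)))) (RtoC t))). intros t Ht.
  assert (Hs2 := not_nonpos_S s Hs). assert (sh := subexp_hcoef (c - a) (c - b) (s + 1) Hs2).
  assert (sd := subexp_dcoef _ sh).
  assert (H1 : (Rabs t < 1)%R) by (rewrite Rabs_pos_eq; lra).
  assert (D0 := cder_psum _ t sh H1). assert (D1 := cder_psum _ t sd H1).
  change (cder (fun x => G_exp0 a b c (RtoC x)) t (G_exp0' a b c (RtoC t))) in D0.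
  change (cder (fun x => G_exp0' a b c (RtoC x)) t (psum (dcoef (dcoef (hcoef (c - a) (c - b) (s + 1)))) (RtoC t))) in D1.
  assert (P1 : rcpow (s - 1) t = rcpow (s - 2) t * RtoC t).
  { rewrite <- rcpow_S by lra. f_equal. ring. }
  assert (P2 : rcpow s t = rcpow (s - 2) t * RtoC t * RtoC t).
  { rewrite <- P1, <- rcpow_S by lra. f_equal. ring. }
  split; [|split].
  - unfold y_exp0, y_exp0'. eapply cder_eq; [apply cder_mult; [apply cder_rcpow; lra|exact D0]|].
    fold s. rewrite P2, P1. cbv beta. ring.
  - unfold y_exp0'. eapply cder_eq.
    + apply cder_mult; [apply cder_rcpow; lra|]. apply cder_plus; [apply cder_scal, D0|].
      apply cder_mult; [apply cder_id|exact D1].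
    + fold s. replace (s - 1 - 1) with (s - 2) by ring. rewrite P1. cbv beta. ring.
  - unfold y_exp0, y_exp0'. fold s. rewrite P2, P1.
    assert (H := hyp_ode (c - a) (c - b) (s + 1) (RtoC t) Hs2 (Cmod_R_lt1 t Ht)). cbv zeta in H.
    fold (G_exp0 a b c (RtoC t)) in H. fold (G_exp0' a b c (RtoC t)) in H.
    unfold G_exp0, G_exp0' in *. fold s in H. fold s.
    match type of H with ?l = _ => transitivity (rcpow (s - 2) t * RtoC t * RtoC t * l) end.
    + unfold s. ring.
    + rewrite H. ring.
Qed.
End Equations.

(** * The connection between the two ends of (0, 1) *)

Lemma filterlim_C_mult {T} (F : (T -> Prop) -> Prop) {FF : Filter F} (f g : T -> C) (a b : C) :
  filterlim f F (locally a) -> filterlim g F (locally b) ->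
  filterlim (fun x => f x * g x) F (locally (a * b)).
Proof.
  intros Hf Hg. apply (filterlim_C_iff F). intros eps He.
  assert (ha := Cmod_ge_0 a). assert (hb := Cmod_ge_0 b).
  set (d := Rmin 1 (eps / (2 * (1 + Cmod a + Cmod b)))).
  assert (Hd : (0 < d)%R) by (apply Rmin_pos; [lra|apply Rdiv_lt_0_compat; lra]).
  assert (Hd1 : (d <= 1)%R) by apply Rmin_l.
  assert (Hd2 : (d * (1 + Cmod a + Cmod b) <= eps / 2)%R).
  { apply Rle_trans with (eps / (2 * (1 + Cmod a + Cmod b)) * (1 + Cmod a + Cmod b))%R.
    - apply Rmult_le_compat_r; [lra|apply Rmin_r].
    - right. field. lra. }
  apply (proj1 (filterlim_C_iff F _ _)) with (eps := d) in Hf; [|lra].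
  apply (proj1 (filterlim_C_iff F _ _)) with (eps := d) in Hg; [|lra].
  refine (filter_imp _ _ _ (filter_and _ _ Hf Hg)). intros x [h1 h2].
  replace (f x * g x - a * b) with ((f x - a) * (g x - b) + (a * (g x - b) + (f x - a) * b)) by ring.
  eapply Rle_lt_trans; [apply Cmod_triangle|].
  eapply Rle_lt_trans; [apply Rplus_le_compat_l, Cmod_triangle|]. rewrite !Cmod_mult.
  assert (h3 := Cmod_ge_0 (f x - a)). assert (h4 := Cmod_ge_0 (g x - b)).
  assert (Cmod (f x - a) * Cmod (g x - b) <= d * 1)%R by (apply Rmult_le_compat; lra).
  assert (Cmod a * Cmod (g x - b) <= Cmod a * d)%R by (apply Rmult_le_compat_l; lra).
  assert (Cmod (f x - a) * Cmod b <= d * Cmod b)%R by (apply Rmult_le_compat_r; lra). lra.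
Qed.

Lemma filterlim_C_eq {T} (F : (T -> Prop) -> Prop) (f : T -> C) (a b : C) :
  filterlim f F (locally a) -> a = b -> filterlim f F (locally b).
Proof. intros H <-; exact H. Qed.

Lemma filterlim_C_const {T} (F : (T -> Prop) -> Prop) {FF : Filter F} (a : C) :
  filterlim (fun _ : T => a) F (locally a).
Proof. apply filterlim_const. Qed.

Lemma filterlim_C_ext {T} (F : (T -> Prop) -> Prop) {FF : Filter F} (f g : T -> C) (a : C) :
  F (fun x => f x = g x) -> filterlim f F (locally a) -> filterlim g F (locally a).
Proof. intros H. apply filterlim_ext_loc. exact H. Qed.

Lemma filterlim_C_unique {T} (F : (T -> Prop) -> Prop) {FF : ProperFilter F} (f : T -> C) (a b : C) :
  filterlim f F (locally a) -> filterlim f F (locally b) -> a = b.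
Proof. exact (@filterlim_locally_unique T C_AbsRing C_NormedModule F _ f a b). Qed.

Lemma at_right_01 : at_right 0 (fun t => (0 < t < 1)%R).
Proof.
  exists (mkposreal 1 Rlt_0_1). intros t Ht H0. change (Rabs (t - 0) < 1)%R in Ht.
  revert Ht; unfold Rabs; destruct Rcase_abs; lra.
Qed.

Lemma at_right_lt (d : R) : (0 < d)%R -> at_right 0 (fun t => (0 < t < d)%R).
Proof.
  intros Hd. exists (mkposreal d Hd). intros t Ht H0. change (Rabs (t - 0) < d)%R in Ht.
  revert Ht; unfold Rabs; destruct Rcase_abs; lra.
Qed.

Lemma psum_at_right_0 (a : nat -> C) : subexp a ->
  filterlim (fun t : R => psum a (RtoC t)) (at_right 0) (locally (a 0%nat)).
Proof.
  intros Ha. apply (filterlim_C_iff (at_right 0)). intros eps He.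
  destruct (pseries_near_0 a 1 (psum a) ltac:(lra) (fun h Hh => psum_is a h Ha Hh)) as [K [rho [Hr [HK HB]]]].
  assert (Hd : (0 < Rmin rho (eps / (K + 1)))%R) by (apply Rmin_pos; [lra|apply Rdiv_lt_0_compat; lra]).
  refine (filter_imp _ _ _ (at_right_lt _ Hd)). intros t Ht.
  assert (h1 := Rmin_l rho (eps / (K + 1))). assert (h2 := Rmin_r rho (eps / (K + 1))).
  specialize (HB (RtoC t)). rewrite Cmod_R, Rabs_pos_eq in HB by lra. specialize (HB ltac:(lra)).
  eapply Rle_lt_trans; [exact HB|].
  apply Rle_lt_trans with ((K + 1) * t)%R; [nra|].
  replace eps with ((K + 1) * (eps / (K + 1)))%R by (field; lra).
  apply Rmult_lt_compat_l; lra.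
Qed.

Lemma cder_continuous (f : R -> C) t l : cder f t l -> filterlim f (locally t) (locally (f t)).
Proof.
  intros [H1 H2].
  assert (c1 := ex_derive_continuous _ _ (ex_intro _ _ H1)).
  assert (c2 := ex_derive_continuous _ _ (ex_intro _ _ H2)).
  apply (filterlim_C_iff (locally t)). intros eps He.
  assert (d1 := proj1 (filterlim_R_iff (locally t) _ _) c1 (eps / 2)%R ltac:(lra)).
  assert (d2 := proj1 (filterlim_R_iff (locally t) _ _) c2 (eps / 2)%R ltac:(lra)).
  refine (filter_imp _ _ _ (filter_and _ _ d1 d2)). intros x [h1 h2].
  apply Rlt_le_trans with (eps / 2 + eps / 2)%R; [|lra].
  eapply Rle_lt_trans; [|apply Rplus_lt_compat; [exact h1|exact h2]].
  set (w := f x - f t).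
  replace (Re (f x) - Re (f t))%R with (Re w) by (unfold w, Cminus; rewrite re_plus, re_opp; ring).
  replace (Im (f x) - Im (f t))%R with (Im w) by (unfold w, Cminus; rewrite im_plus, im_opp; ring).
  clearbody w. assert (S := Cmod2_alt w). assert (p := Cmod_ge_0 w).
  assert (p1 := Rabs_pos (Re w)). assert (p2 := Rabs_pos (Im w)).
  rewrite <- (pow2_abs (Re w)), <- (pow2_abs (Im w)) in S.
  apply Rnot_lt_le. intros hlt.
  assert (q := Rmult_le_0_lt_compat _ _ _ _ (Rplus_le_le_0_compat _ _ p1 p2) (Rplus_le_le_0_compat _ _ p1 p2) hlt hlt).
  assert (q2 := Rmult_le_pos _ _ p1 p2). lra.
Qed.

Lemma filterlim_at_right (f : R -> C) (t : R) (l : C) :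
  filterlim f (locally t) (locally l) -> filterlim f (at_right t) (locally l).
Proof.
  intros H. refine (filterlim_filter_le_1 _ _ H).
  intros P HP. unfold at_right, within. refine (filter_imp _ _ _ HP). intros x h _; exact h.
Qed.

Lemma rcpow_one_minus_lim (c : C) : filterlim (fun t : R => rcpow c (1 - t)) (at_right 0) (locally (RtoC 1)).
Proof.
  assert (D : cder (fun t => rcpow c (1 - t)) 0 (- (c * rcpow (c - 1) (1 - 0)))).
  { apply (cder_flip (rcpow c)). apply cder_rcpow. lra. }
  apply cder_continuous in D.
  assert (E : rcpow c (1 - 0) = 1).
  { unfold rcpow. rewrite Rminus_0_r, ln_1, Cmult_0_r. apply Cexp_0. }
  cbv beta in D. rewrite E in D. apply filterlim_at_right, D.
Qed.

Lemma RtoC_at_right_0 : filterlim (fun t : R => RtoC t) (at_right 0) (locally (RtoC 0)).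
Proof.
  apply (filterlim_C_iff (at_right 0)). intros eps He.
  refine (filter_imp _ _ _ (at_right_lt _ He)). intros t Ht.
  replace (RtoC t - 0) with (RtoC t) by ring. rewrite Cmod_R, Rabs_pos_eq; lra.
Qed.

Lemma hcoef_0 a b c : hcoef a b c 0 = 1.
Proof. unfold hcoef. simpl. field. Qed.

Lemma rcpow_at_right_0 (s : C) : (0 < Re s)%R -> filterlim (rcpow s) (at_right 0) (locally (RtoC 0)).
Proof.
  intros Hs. apply (filterlim_C_iff (at_right 0)). intros eps He.
  refine (filter_imp _ _ _ (at_right_lt (exp (ln eps / Re s)) (exp_pos _))). intros t Ht.
  replace (rcpow s t - 0) with (rcpow s t) by ring. unfold rcpow. rewrite Cmod_Cexp, re_scal_r.
  rewrite <- (exp_ln eps) by exact He. apply exp_increasing.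
  assert (h : (ln t < ln eps / Re s)%R).
  { rewrite <- (ln_exp (ln eps / Re s)). apply ln_increasing; apply Ht. }
  replace (ln eps) with (Re s * (ln eps / Re s))%R by (field; lra).
  apply Rmult_lt_compat_l; assumption.
Qed.

Section Wronskian.
Variables (a b c : C).
Hypothesis Hc : ~ is_nonpos_int c.
Hypothesis Hs : ~ is_int (c - a - b).
Let s := c - a - b.

Lemma y_reg0_lim : filterlim (y_reg0 a b c) (at_right 0) (locally (RtoC 1)).
Proof.
  rewrite <- (hcoef_0 a b (1 - s)). apply psum_at_right_0. apply subexp_hcoef, not_nonpos_1_minus, Hs.
Qed.

(** The value of the constant is read off from the limit at t = 0. *)
Lemma wronsk_at_0 t : (0 < t < 1)%R ->
  wronsk a b s (y_reg0 a b c) (y_reg0' a b c) (y_exp0 a b c) (y_exp0' a b c) t = s.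
Proof.
  intros Ht.
  assert (S1 := subexp_hcoef a b (1 - s) (not_nonpos_1_minus _ Hs)).
  assert (S2 := subexp_hcoef (c - a) (c - b) (s + 1) (not_nonpos_S _ Hs)).
  set (W := wronsk a b s (y_reg0 a b c) (y_reg0' a b c) (y_exp0 a b c) (y_exp0' a b c)).
  apply (filterlim_C_unique (at_right 0) (fun _ => W t)); [apply filterlim_C_const, _|].
  apply (filterlim_C_ext (at_right 0) (fun x => rcpow (s + a + b) (1 - x) *
     (G_reg0 a b c (RtoC x) * (s * G_exp0 a b c (RtoC x) + RtoC x * G_exp0' a b c (RtoC x))
      + (-(1)) * (G_reg0' a b c (RtoC x) * (RtoC x * G_exp0 a b c (RtoC x)))))).
  - refine (filter_imp _ _ _ at_right_01). intros x Hx.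
    unfold W. rewrite <- (wronsk_const a b s _ _ _ _ (y_reg0_sol a b c Hs) (y_exp0_sol a b c Hs) x t Hx Ht).
    unfold wronsk, y_reg0, y_reg0', y_exp0, y_exp0'. fold s.
    assert (E1 : rcpow s x = rcpow (s - 1) x * RtoC x) by (rewrite <- rcpow_S by lra; f_equal; ring).
    assert (E2 : rcpow (1 - s) x * rcpow (s - 1) x = 1) by (rewrite <- rcpow_add, <- (rcpow_0 x); f_equal; ring).
    rewrite E1.
    transitivity (rcpow (s + a + b) (1 - x) * (rcpow (1 - s) x * rcpow (s - 1) x) *
     (G_reg0 a b c (RtoC x) * (s * G_exp0 a b c (RtoC x) + RtoC x * G_exp0' a b c (RtoC x))
      + (-(1)) * (G_reg0' a b c (RtoC x) * (RtoC x * G_exp0 a b c (RtoC x))))); [rewrite E2; ring|ring].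
  - assert (L1 : filterlim (fun t : R => G_reg0 a b c (RtoC t)) (at_right 0) (locally (RtoC 1))) by exact y_reg0_lim.
    assert (L2 : filterlim (fun t : R => G_exp0 a b c (RtoC t)) (at_right 0) (locally (RtoC 1))).
    { rewrite <- (hcoef_0 (c - a) (c - b) (s + 1)). apply psum_at_right_0, S2. }
    assert (L3 := psum_at_right_0 _ (subexp_dcoef _ S1)).
    assert (L4 := psum_at_right_0 _ (subexp_dcoef _ S2)).
    set (k1 := dcoef (hcoef a b (1 - s)) 0) in *.
    set (k2 := dcoef (hcoef (c - a) (c - b) (s + 1)) 0) in *.
    apply (filterlim_C_eq _ _ (1 * (1 * (s * 1 + 0 * k2) + (-(1)) * (k1 * (0 * 1))))); [|ring].
    apply filterlim_C_mult; [apply _|apply rcpow_one_minus_lim|].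
    apply filterlim_C_plus; [apply _| |].
    + apply filterlim_C_mult; [apply _|exact L1|].
      apply filterlim_C_plus; [apply _| |].
      * apply filterlim_C_mult; [apply _| apply filterlim_C_const, _|exact L2].
      * apply filterlim_C_mult; [apply _|exact RtoC_at_right_0|exact L4].
    + apply filterlim_C_mult; [apply _|apply filterlim_C_const, _|].
      apply filterlim_C_mult; [apply _|exact L3|].
      apply filterlim_C_mult; [apply _|exact RtoC_at_right_0|exact L2].
Qed.
End Wronskian.

Definition connected (a b c C1 C2 : C) : Prop :=
  forall t, (0 < t < 1)%R -> y_reg1 a b c t = C1 * y_reg0 a b c t + C2 * y_exp0 a b c t.

(** Cramer's rule, the Wronskian of the two local solutions being c - a - b. *)
Definition connection_coef (a b c : C) : C :=
  wronsk a b (c - a - b) (y_reg1 a b c) (y_reg1' a b c) (y_exp0 a b c) (y_exp0' a b c) (1 / 2) / (c - a - b).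

Definition connection_coef2 (a b c : C) : C :=
  - (wronsk a b (c - a - b) (y_reg1 a b c) (y_reg1' a b c) (y_reg0 a b c) (y_reg0' a b c) (1 / 2) / (c - a - b)).

Lemma connected_ex (a b c : C) : ~ is_nonpos_int c -> ~ is_int (c - a - b) ->
  connected a b c (connection_coef a b c) (connection_coef2 a b c).
Proof.
  intros Hc Hs t Ht. unfold connection_coef, connection_coef2. set (s := c - a - b).
  assert (s0 : s <> 0) by (apply not_int_0, Hs).
  assert (Hh : (0 < 1 / 2 < 1)%R) by lra.
  rewrite <- (wronsk_const a b s _ _ _ _ (y_reg1_sol a b c Hc) (y_exp0_sol a b c Hs) t _ Ht Hh).
  rewrite <- (wronsk_const a b s _ _ _ _ (y_reg1_sol a b c Hc) (y_reg0_sol a b c Hs) t _ Ht Hh).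
  assert (E12 := wronsk_at_0 a b c Hs t Ht). fold s in E12.
  assert (E : y_reg1 a b c t * s = y_reg0 a b c t * wronsk a b s (y_reg1 a b c) (y_reg1' a b c) (y_exp0 a b c) (y_exp0' a b c) t
     - y_exp0 a b c t * wronsk a b s (y_reg1 a b c) (y_reg1' a b c) (y_reg0 a b c) (y_reg0' a b c) t).
  { rewrite <- E12 at 1. unfold wronsk. ring. }
  replace (y_reg1 a b c t) with (y_reg1 a b c t * s / s) at 1 by (field; exact s0).
  rewrite E. field. exact s0.
Qed.

Lemma connected_indep (a b c : C) (al be : C) : ~ is_int (c - a - b) ->
  (forall t, (0 < t < 1)%R -> al * y_reg0 a b c t + be * y_exp0 a b c t = 0) -> al = 0 /\ be = 0.
Proof.
  intros Hs H.
  assert (s0 := not_int_0 _ Hs). set (s := c - a - b) in *.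
  destruct (y_reg0_sol a b c Hs) as [y2 Hy]. destruct (y_exp0_sol a b c Hs) as [z2 Hz].
  assert (Ht : (0 < 1/2 < 1)%R) by lra. set (t := (1/2)%R) in *.
  assert (H1 : al * y_reg0' a b c t + be * y_exp0' a b c t = 0).
  { apply (cder_unique (fun t => al * y_reg0 a b c t + be * y_exp0 a b c t) t).
    - apply cder_plus; apply cder_scal; [apply (Hy t Ht)|apply (Hz t Ht)].
    - apply (cder_ext01 (fun _ => RtoC 0)); [exact Ht|intros x Hx; symmetry; apply H, Hx|apply cder_const]. }
  specialize (H t Ht).
  assert (W := wronsk_at_0 a b c Hs t Ht). fold s in W. unfold wronsk in W.
  set (p := rcpow (s + a + b) (1 - t) * rcpow (1 - s) t) in *.
  assert (Ea : al * s = 0).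
  { rewrite <- W. transitivity (p * ((al * y_reg0 a b c t + be * y_exp0 a b c t) * y_exp0' a b c t
       - (al * y_reg0' a b c t + be * y_exp0' a b c t) * y_exp0 a b c t)); [ring|]. rewrite H, H1. ring. }
  assert (Eb : be * s = 0).
  { rewrite <- W. transitivity (p * ((al * y_reg0' a b c t + be * y_exp0' a b c t) * y_reg0 a b c t
       - (al * y_reg0 a b c t + be * y_exp0 a b c t) * y_reg0' a b c t)); [ring|]. rewrite H, H1. ring. }
  split.
  - replace al with (al * s / s) by (field; exact s0). rewrite Ea. field. exact s0.
  - replace be with (be * s / s) by (field; exact s0). rewrite Eb. field. exact s0.
Qed.

(** The operator of [hyp_raise_c] maps each of the three solutions for c to a
    multiple of the corresponding solution for c + 1; comparing coefficients of
    the regular solution gives the recursion. *)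
Lemma connected_raise (a b c C1 C2 D1 D2 : C) : ~ is_nonpos_int c -> ~ is_int (c - a - b) ->
  connected a b c C1 C2 -> connected a b (c + 1) D1 D2 ->
  (c - a) * (c - b) / c * D1 = (c - a - b) * C1.
Proof.
  intros Hc Hs H HD. set (s := c - a - b) in *.
  assert (Hc1 := nonpos_int_S c Hc).
  assert (Hs' : ~ is_int (c + 1 - a - b)).
  { replace (c + 1 - a - b) with (s + 1) by (unfold s; ring). apply not_int_S, Hs. }
  assert (E : D1 * ((c - a) * (c - b) / c) - s * C1 = 0 /\
     D2 * ((c - a) * (c - b) / c) + C2 * ((c - a) * (c - b) / (s + 1)) = 0).
  2:{ destruct E as [E _]. apply Ceq_minus. rewrite <- E. ring. }
  apply (connected_indep a b (c + 1)); [exact Hs'|]. intros t Ht.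
  destruct (y_reg1_sol a b c Hc) as [x2 Hx]. destruct (y_reg0_sol a b c Hs) as [y2 Hy]. destruct (y_exp0_sol a b c Hs) as [z2 Hz].
  assert (H' : y_reg1' a b c t = C1 * y_reg0' a b c t + C2 * y_exp0' a b c t).
  { apply (cder_unique (y_reg1 a b c) t); [apply (Hx t Ht)|].
    apply (cder_ext01 (fun t => C1 * y_reg0 a b c t + C2 * y_exp0 a b c t)); [exact Ht|intros x Hxx; symmetry; apply H, Hxx|].
    apply cder_plus; apply cder_scal; [apply (Hy t Ht)|apply (Hz t Ht)]. }
  specialize (H t Ht). specialize (HD t Ht).
  assert (Ht1 : (Cmod (RtoC (1 - t)) < 1)%R) by (rewrite Cmod_R, Rabs_pos_eq; lra).
  assert (Ht0 := Cmod_R_lt1 t Ht).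
  assert (R0 : - RtoC t * y_reg1' a b c t + s * y_reg1 a b c t = (c - a) * (c - b) / c * y_reg1 a b (c + 1) t).
  { unfold y_reg1, y_reg1'. assert (R := hyp_raise_c a b c (RtoC (1 - t)) Hc Ht1). cbv zeta in R.
    rewrite <- R. fold s. rewrite RtoC_minus. ring. }
  assert (R1 : - RtoC t * y_reg0' a b c t + s * y_reg0 a b c t = s * y_reg0 a b (c + 1) t).
  { unfold y_reg0, y_reg0', G_reg0, G_reg0'. fold s.
    replace (1 - (c + 1 - a - b)) with (- s) by (unfold s; ring).
    assert (Hns : ~ is_nonpos_int (- s)) by apply not_int_not_nonpos, not_int_opp, Hs.
    assert (Hns1 : ~ is_nonpos_int (1 - s)) by apply (not_nonpos_1_minus _ Hs).
    assert (S1 := subexp_hcoef a b (- s) Hns). assert (S2 := subexp_hcoef a b (1 - s) Hns1).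
    assert (S3 := subexp_dcoef _ S2). assert (S4 := subexp_xcoef _ S3).
    replace (- RtoC t * psum (dcoef (hcoef a b (1 - s))) (RtoC t)) with
      ((-(1)) * psum (xcoef (dcoef (hcoef a b (1 - s)))) (RtoC t)) by (rewrite <- psum_x by assumption; ring).
    rewrite !psum_scal by assumption. rewrite psum_plus by (try apply subexp_scal; assumption).
    apply psum_ext; [apply subexp_plus; apply subexp_scal; assumption|exact Ht0|]. intros n.
    rewrite xcoef_dcoef. unfold hcoef.
    assert (P := poch_S_l (- s) n). rewrite poch_S in P.
    replace (- s + 1) with (1 - s) in P by ring.
    assert (p1 := poch_neq_0 (1 - s) n Hns1). assert (p2 := poch_neq_0 (- s) n Hns).
    assert (s0' : s <> 0) by (apply not_int_0, Hs). assert (sn := nonpos_int_plus (- s) n Hns).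
    replace (poch (1 - s) n) with (poch (- s) n * (- s + INR n) / (- s)) by (rewrite P; field; exact s0').
    field. repeat split; try assumption. apply fact_neq_0C. }
  assert (R2 : - RtoC t * y_exp0' a b c t + s * y_exp0 a b c t = - ((c - a) * (c - b) / (s + 1)) * y_exp0 a b (c + 1) t).
  { unfold y_exp0, y_exp0', G_exp0, G_exp0'. fold s.
    replace (c + 1 - a - b) with (s + 1) by (unfold s; ring).
    replace (c + 1 - a) with (c - a + 1) by ring. replace (c + 1 - b) with (c - b + 1) by ring.
    assert (E1 : rcpow s t = rcpow (s - 1) t * RtoC t) by (rewrite <- rcpow_S by lra; f_equal; ring).
    rewrite (rcpow_S s) by lra. rewrite E1.
    rewrite (hyp_deriv (c - a) (c - b) (s + 1) (RtoC t) (not_nonpos_S _ Hs) Ht0).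
    assert (s1 := nonpos_int_neq_0 _ (not_nonpos_S _ Hs)). fold s in s1. field. exact s1. }
  replace (D1 * ((c - a) * (c - b) / c) - s * C1) with (D1 * ((c - a) * (c - b) / c) - C1 * s) by ring.
  transitivity ((c - a) * (c - b) / c * (D1 * y_reg0 a b (c + 1) t + D2 * y_exp0 a b (c + 1) t)
    - (C1 * (s * y_reg0 a b (c + 1) t) + C2 * (- ((c - a) * (c - b) / (s + 1)) * y_exp0 a b (c + 1) t))); [ring|].
  rewrite <- HD, <- R0, <- R1, <- R2, H, H'. ring.
Qed.

(** When c is far to the right compared with a and b, consecutive terms have
    ratio at most k / (k + 2), so that they are dominated by a multiple of
    1 / (k (k + 1)) with a factor of order 1 / N. *)
Lemma hcoef_tail_bound (a b c : C) (N : R) :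
  (0 < N)%R -> (forall j : nat, (N + INR j <= Cmod (c + INR j))%R) ->
  (Cmod a + Cmod b + 3 * Cmod a * Cmod b + 2 * Cmod a + 2 * Cmod b + 1 <= N)%R ->
  forall k, (Cmod (hcoef a b c (S k)) <= Cmod a * Cmod b / N * (2 / (INR (S k) * INR (S (S k)))))%R.
Proof.
  intros HN Hcj HNb.
  assert (Hc : ~ is_nonpos_int c).
  { intros [n Hn]. specialize (Hcj n). rewrite Hn in Hcj. replace (- INR n + INR n) with (RtoC 0) in Hcj by ring.
    rewrite Cmod_0 in Hcj. assert (h := pos_INR n). lra. }
  assert (hA := Cmod_ge_0 a). assert (hB := Cmod_ge_0 b).
  set (A := Cmod a) in *. set (B := Cmod b) in *.
  assert (hAB : (0 <= A * B)%R) by nra.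
  assert (pn : forall x n, (Cmod (x + INR n) <= Cmod x + INR n)%R).
  { intros x n. eapply Rle_trans; [apply Cmod_triangle|]. rewrite Cmod_R, Rabs_pos_eq by apply pos_INR. lra. }
  assert (rec : forall n, (Cmod (hcoef a b c (S n)) * (INR (S n) * (N + INR n)) <= (A + INR n) * (B + INR n) * Cmod (hcoef a b c n))%R).
  { intros n. assert (R := f_equal Cmod (hcoef_rec a b c n Hc)).
    rewrite !Cmod_mult, Cmod_R, Rabs_pos_eq in R by apply pos_INR.
    assert (h0 := Cmod_ge_0 (hcoef a b c (S n))). assert (h1 := pos_INR (S n)).
    apply Rle_trans with (INR (S n) * Cmod (c + INR n) * Cmod (hcoef a b c (S n)))%R.
    - rewrite (Rmult_comm (Cmod _)). apply Rmult_le_compat_r; [exact h0|].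
      apply Rmult_le_compat_l; [exact h1|apply Hcj].
    - rewrite R. apply Rmult_le_compat_r; [apply Cmod_ge_0|].
      apply Rmult_le_compat; try apply Cmod_ge_0; apply pn. }
  induction k as [|k IH].
  - assert (r := rec 0%nat). rewrite hcoef_0, Cmod_1 in r. simpl INR in r. simpl INR.
    rewrite !Rplus_0_r, !Rmult_1_r, Rmult_1_l in r.
    replace (A * B / N * (2 / (1 * (1 + 1))))%R with (A * B / N)%R by (field; lra).
    apply (Rmult_le_reg_r N); [exact HN|]. replace (A * B / N * N)%R with (A * B)%R by (field; lra). exact r.
  - assert (r := rec (S k)). set (x := INR (S k)) in *.
    assert (hx : (1 <= x)%R). { unfold x. rewrite S_INR. assert (h := pos_INR k). lra. }
    assert (x1 : INR (S (S k)) = (x + 1)%R) by (unfold x; rewrite (S_INR (S k)); reflexivity).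
    assert (x2 : INR (S (S (S k))) = (x + 2)%R).
    { rewrite (S_INR (S (S k))), x1. ring. }
    rewrite x1 in IH, r. rewrite x1, x2.
    (* The ratio of consecutive terms is at most x / (x + 2), cleared of denominators. *)
    assert (Key : ((A + x) * (B + x) * (x + 2) <= x * (N + x) * (x + 1))%R).
    { assert (0 <= (x - 1) * x)%R by nra.
      assert (e1 : ((A + B + 2) * (x * x) <= (N + 1) * (x * x))%R) by (apply Rmult_le_compat_r; nra).
      assert (e2 : ((3 * A * B + 2 * A + 2 * B) * x <= N * x)%R) by (apply Rmult_le_compat_r; nra).
      assert (e3 : (2 * A * B * 1 <= 2 * A * B * x)%R) by (apply Rmult_le_compat_l; nra). lra. }
    set (h1 := Cmod (hcoef a b c (S k))) in *. set (h2 := Cmod (hcoef a b c (S (S k)))) in *.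
    assert (P1 : (0 < (x + 1) * (N + x))%R) by (apply Rmult_lt_0_compat; lra).
    apply (Rmult_le_reg_r ((x + 1) * (N + x))); [exact P1|].
    eapply Rle_trans; [exact r|].
    apply Rle_trans with ((A + x) * (B + x) * (A * B / N * (2 / (x * (x + 1)))))%R.
    { apply Rmult_le_compat_l; [nra|exact IH]. }
    assert (P2 : (0 <= A * B / N)%R) by (apply Rmult_le_pos; [lra|left; apply Rinv_0_lt_compat; lra]).
    replace ((A + x) * (B + x) * (A * B / N * (2 / (x * (x + 1)))))%R with
      (A * B / N * 2 * / (x * (x + 1) * (x + 2)) * ((A + x) * (B + x) * (x + 2)))%R by (field; lra).
    replace (A * B / N * (2 / ((x + 1) * (x + 2))) * ((x + 1) * (N + x)))%R with
      (A * B / N * 2 * / (x * (x + 1) * (x + 2)) * (x * (N + x) * (x + 1)))%R by (field; lra).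
    apply Rmult_le_compat_l; [|exact Key].
    apply Rmult_le_pos; [lra|]. left. apply Rinv_0_lt_compat.
    apply Rmult_lt_0_compat; [apply Rmult_lt_0_compat|]; lra.
Qed.

Lemma telescoping_sum n : sum_n (fun k => 2 / (INR (S k) * INR (S (S k))))%R n = (2 - 2 / INR (S (S n)))%R.
Proof.
  induction n as [|n IH].
  - rewrite rsum_0. simpl. match goal with |- @eq _ ?x ?y => change (@eq R x y) end. field.
  - rewrite rsum_S, IH. rewrite !S_INR. assert (h := pos_INR n).
    match goal with |- @eq _ ?x ?y => change (@eq R x y) end. field. lra.
Qed.

Lemma telescoping_series :
  ex_series (fun k => 2 / (INR (S k) * INR (S (S k))))%R /\
  (Series (fun k => 2 / (INR (S k) * INR (S (S k))))%R <= 2)%R.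
Proof.
  assert (Hp : forall k, (0 <= 2 / (INR (S k) * INR (S (S k))))%R).
  { intros k. apply Rdiv_le_0_compat; [lra|]. apply Rmult_lt_0_compat; apply lt_0_INR; lia. }
  assert (Hsum : forall n, (sum_n (fun k => 2 / (INR (S k) * INR (S (S k))))%R n <= 2)%R).
  { intros n. rewrite telescoping_sum. assert (0 <= 2 / INR (S (S n)))%R; [|lra].
    apply Rdiv_le_0_compat; [lra|]. apply lt_0_INR. lia. }
  assert (Ex := ex_series_bounded _ 2 Hp Hsum). split; [exact Ex|]. apply Series_bound; assumption.
Qed.

(** Uniformly in t, the Gauss series tends to 1 as c moves to the right. *)
Lemma y_reg1_bound (a b c : C) (N : R) :
  (0 < N)%R -> (forall j : nat, (N + INR j <= Cmod (c + INR j))%R) ->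
  (Cmod a + Cmod b + 3 * Cmod a * Cmod b + 2 * Cmod a + 2 * Cmod b + 1 <= N)%R ->
  ~ is_nonpos_int c ->
  forall t, (0 < t < 1)%R -> (Cmod (y_reg1 a b c t - 1) <= Cmod a * Cmod b / N * 2)%R.
Proof.
  intros HN Hcj HNb Hc t Ht.
  assert (Hb := hcoef_tail_bound a b c N HN Hcj HNb).
  set (M := (Cmod a * Cmod b / N)%R) in *.
  assert (HM : (0 <= M)%R).
  { apply Rmult_le_pos; [apply Rmult_le_pos; apply Cmod_ge_0|left; apply Rinv_0_lt_compat, HN]. }
  destruct telescoping_series as [Ex Hsum].
  assert (Ht1 : (Cmod (RtoC (1 - t)) < 1)%R) by (rewrite Cmod_R, Rabs_pos_eq; lra).
  assert (S0 := psum_is (hcoef a b c) (RtoC (1 - t)) (subexp_hcoef a b c Hc) Ht1).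
  apply is_series_C_incr_1 in S0. rewrite hcoef_0 in S0.
  replace (1 * RtoC (1 - t) ^ 0) with (RtoC 1) in S0 by (simpl; ring).
  eapply Rle_trans.
  - apply (Cmod_series_le _ (fun k => M * (2 / (INR (S k) * INR (S (S k)))))%R _ S0).
    + intros n. rewrite Cmod_mult, Cmod_pow.
      assert (hp : (Cmod (RtoC (1 - t)) ^ S n <= 1)%R).
      { apply Rle_trans with (1 ^ S n)%R; [apply pow_incr; split; [apply Cmod_ge_0|left; exact Ht1]|rewrite pow1; lra]. }
      specialize (Hb n). assert (h0 := Cmod_ge_0 (hcoef a b c (S n))).
      assert (h1 := pow_le (Cmod (RtoC (1 - t))) (S n) (Cmod_ge_0 _)). 
      eapply Rle_trans; [|exact Hb]. rewrite <- (Rmult_1_r (Cmod (hcoef a b c (S n)))) at 2.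
      apply Rmult_le_compat_l; assumption.
    + apply (ex_series_scal M _ Ex).
  - rewrite Series_scal_l. apply Rmult_le_compat_l; [exact HM|exact Hsum].
Qed.

(** As t tends to 0 the solution with exponent c - a - b vanishes and the
    regular one tends to 1, so the coefficient is the limit of [y_reg1]. *)
Lemma connection_coef_bound (a b c C1 C2 : C) (N : R) :
  (0 < N)%R -> (forall j : nat, (N + INR j <= Cmod (c + INR j))%R) ->
  (Cmod a + Cmod b + 3 * Cmod a * Cmod b + 2 * Cmod a + 2 * Cmod b + 1 <= N)%R ->
  ~ is_nonpos_int c -> ~ is_int (c - a - b) -> (0 < Re (c - a - b))%R ->
  connected a b c C1 C2 -> (Cmod (C1 - 1) <= Cmod a * Cmod b / N * 2)%R.
Proof.
  intros HN Hcj HNb Hc Hs HRe H.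
  apply (filterlim_C_le (at_right 0) (fun t => C1 * y_reg0 a b c t + C2 * y_exp0 a b c t + (-(1)))).
  - apply (filterlim_C_eq _ _ (C1 * 1 + C2 * (0 * 1) + (-(1)))); [|ring].
    apply filterlim_C_plus; [apply _| |apply filterlim_C_const, _].
    apply filterlim_C_plus; [apply _| |].
    + apply filterlim_C_mult; [apply _|apply filterlim_C_const, _|apply y_reg0_lim, Hs].
    + apply filterlim_C_mult; [apply _|apply filterlim_C_const, _|].
      apply filterlim_C_mult; [apply _|apply rcpow_at_right_0, HRe|].
      rewrite <- (hcoef_0 (c - a) (c - b) (c - a - b + 1)). apply psum_at_right_0, subexp_hcoef, not_nonpos_S, Hs.
  - refine (filter_imp _ _ _ at_right_01). intros t Ht. rewrite <- (H t Ht).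
    apply (y_reg1_bound a b c N); assumption.
Qed.

Lemma connection_coef_lim (a b c : C) (C1 C2 : nat -> C) : ~ is_nonpos_int c -> ~ is_int (c - a - b) ->
  (forall n, connected a b (c + INR n) (C1 n) (C2 n)) ->
  filterlim C1 eventually (locally (RtoC 1)).
Proof.
  intros Hc Hs H. apply (filterlim_C_iff eventually). intros eps He.
  set (L := (Cmod a + Cmod b + 3 * Cmod a * Cmod b + 2 * Cmod a + 2 * Cmod b + 1)%R).
  set (K := (2 * Cmod a * Cmod b / eps)%R).
  assert (hAB : (0 <= Cmod a * Cmod b)%R) by (apply Rmult_le_pos; apply Cmod_ge_0).
  assert (hK : (0 <= K)%R) by (unfold K; apply Rmult_le_pos; [lra|left; apply Rinv_0_lt_compat; lra]).
  destruct (INR_eventually_ge (Cmod c + Rmax L 0 + K + 1)) as [N1 HN1].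
  destruct (INR_eventually_ge (1 - Re (c - a - b))) as [N2 HN2].
  exists (max N1 N2). intros n Hn.
  specialize (HN1 n ltac:(lia)). specialize (HN2 n ltac:(lia)).
  assert (l1 := Rmax_l L 0). assert (l2 := Rmax_r L 0).
  set (N := (INR n - Cmod c)%R).
  assert (HNK : (K + 1 <= N)%R) by (unfold N; lra).
  assert (B : (Cmod (C1 n - 1) <= Cmod a * Cmod b / N * 2)%R).
  { apply (connection_coef_bound a b (c + INR n) (C1 n) (C2 n) N).
    - lra.
    - intros j. replace (c + INR n + INR j) with (c + INR (n + j)) by (rewrite plus_INR, RtoC_plus; ring).
      assert (h := Cmod_plus_INR_ge c (n + j)). rewrite plus_INR in h at 1. unfold N. lra.
    - fold L. unfold N. lra.
    - apply nonpos_int_plus_nat, Hc.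
    - replace (c + INR n - a - b) with (c - a - b + INR n) by ring. apply not_int_plus_nat, Hs.
    - replace (c + INR n - a - b) with (c - a - b + INR n) by ring. rewrite re_plus, re_RtoC. lra.
    - apply H. }
  eapply Rle_lt_trans; [exact B|].
  apply (Rmult_lt_reg_r N); [lra|].
  replace (Cmod a * Cmod b / N * 2 * N)%R with (K * eps)%R by (unfold K; field; lra).
  nra.
Qed.

(** * The exponential series *)

Definition ecoef (w : C) (n : nat) : C := w ^ n / INR (fact n).

Lemma ecoef_S w n : INR (S n) * ecoef w (S n) = w * ecoef w n.
Proof. unfold ecoef. rewrite fact_S_C, Cpow_S. field. nz. Qed.

Lemma subexp_ecoef (w : C) : subexp (ecoef w).
Proof.
  apply subexp_ratio. intros e He.
  destruct (INR_eventually_ge (Cmod w)) as [N HN]. exists N. intros n Hn.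
  assert (h := HN n Hn). assert (E := f_equal Cmod (ecoef_S w n)).
  rewrite !Cmod_mult, Cmod_R, Rabs_pos_eq in E by apply pos_INR.
  assert (h1 := pos_INR n). rewrite S_INR in E.
  assert (c0 := Cmod_ge_0 (ecoef w n)). assert (c1 := Cmod_ge_0 (ecoef w (S n))).
  assert (Cmod (ecoef w (S n)) <= Cmod (ecoef w n))%R; [|nra].
  apply (Rmult_le_reg_l (INR n + 1)); [lra|]. rewrite E. apply Rmult_le_compat_r; lra.
Qed.

Lemma cder_Cexp_lin (al : C) t : cder (fun s => Cexp (al * RtoC s)) t (al * Cexp (al * RtoC t)).
Proof.
  unfold Cexp. split.
  - apply (is_derive_ext (fun s => exp (Re al * s) * cos (Im al * s))%R).
    + intros s. rewrite re_scal_r, im_scal_r. reflexivity.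
    + auto_derive; [exact I|].
      rewrite re_mult, re_scal_r, im_scal_r. simpl. ring.
  - apply (is_derive_ext (fun s => exp (Re al * s) * sin (Im al * s))%R).
    + intros s. rewrite re_scal_r, im_scal_r. reflexivity.
    + auto_derive; [exact I|].
      rewrite im_mult, re_scal_r, im_scal_r. simpl. ring.
Qed.

(** The product of the series at w t with exp (- w t) has derivative 0 and tends
    to 1 at t = 0.  Taking t = 1/2 and w = 2 z stays inside (0, 1). *)
Lemma Cexp_series (z : C) : is_series (fun n => z ^ n / INR (fact n)) (Cexp z).
Proof.
  (* Evaluating at t = 1/2 recovers z. *)
  set (w := 2 * z).
  set (f := fun t : R => psum (ecoef w) (RtoC t) * Cexp (- w * RtoC t)).
  assert (D : forall t, (0 < t < 1)%R -> cder f t 0).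
  { intros t Ht. eapply cder_eq.
    - apply cder_mult; [apply cder_psum; [apply subexp_ecoef|rewrite Rabs_pos_eq; lra]|apply cder_Cexp_lin].
    - rewrite (psum_ext (dcoef (ecoef w)) (fun n => w * ecoef w n)).
      + rewrite <- psum_scal; [ring|apply subexp_ecoef|apply Cmod_R_lt1, Ht].
      + apply subexp_dcoef, subexp_ecoef.
      + apply Cmod_R_lt1, Ht.
      + intros n. apply ecoef_S. }
  assert (E : f (1/2)%R = 1).
  { apply (filterlim_C_unique (at_right 0) (fun _ => f (1/2)%R)); [apply filterlim_C_const, _|].
    apply (filterlim_C_ext (at_right 0) f).
    - refine (filter_imp _ _ _ at_right_01). intros x Hx.
      apply (cder_zero_const f D); lra.
    - apply (filterlim_C_eq _ _ (1 * 1)); [|ring]. apply filterlim_C_mult; [apply _| |].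
      + replace (RtoC 1) with (ecoef w 0) by (unfold ecoef; simpl; field).
        apply psum_at_right_0, subexp_ecoef.
      + assert (c0 := cder_continuous _ _ _ (cder_Cexp_lin (- w) 0)). cbv beta in c0.
        rewrite Cmult_0_r, Cexp_0 in c0. apply filterlim_at_right, c0. }
  unfold f in E.
  assert (H1 := psum_is (ecoef w) (RtoC (1/2)) (subexp_ecoef w) (Cmod_R_lt1 (1/2) ltac:(lra))).
  replace (- w * RtoC (1/2)) with (- z) in E.
  2:{ unfold w. rewrite RtoC_div by lra. field. }
  assert (E2 : psum (ecoef w) (RtoC (1/2)) = Cexp z).
  { replace (psum (ecoef w) (RtoC (1/2))) with (psum (ecoef w) (RtoC (1/2)) * Cexp (- z) * Cexp z).
    - rewrite E. ring.
    - rewrite <- Cmult_assoc, <- Cexp_plus. replace (- z + z) with (RtoC 0) by ring. rewrite Cexp_0. ring. }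
  rewrite E2 in H1. eapply is_series_C_ext; [|exact H1].
  intros n. cbv beta. unfold ecoef, w. rewrite Cpow_mult_l.
  assert (E3 : RtoC 2 ^ n * RtoC (1/2) ^ n = 1).
  { rewrite <- Cpow_mult_l, <- RtoC_mult. replace (2 * (1/2))%R with 1%R by field. apply Cpow_1_l. }
  transitivity ((RtoC 2 ^ n * RtoC (1/2) ^ n) * z ^ n / INR (fact n)).
  - unfold Cdiv. ring.
  - rewrite E3. unfold Cdiv. ring.
Qed.

Lemma analytic_at_Cexp (z : C) : analytic_at Cexp z.
Proof.
  apply (analytic_at_pseries (fun n => / INR (fact n)) Cexp (Cmod z + 1) z); [|lra].
  intros w _. eapply is_series_C_ext; [|apply Cexp_series]. intros n. cbv beta. unfold Cdiv. cring.
Qed.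

Lemma analytic_continuous (f : C -> C) (z : C) : analytic_at f z -> filterlim f (locally z) (locally (f z)).
Proof.
  intros Hf. apply analytic_at_iff in Hf. destruct Hf as [r [a [Hr Ha]]].
  destruct (pseries_near_0 a r _ Hr Ha) as [K [rho [Hrho [HK HB]]]]. cbv beta in HB.
  assert (a0 : a 0%nat = f z).
  { apply (is_series_C_unique _ _ _ (pseries_at_0 a)). specialize (Ha 0). rewrite Cplus_0_r in Ha. apply Ha.
    rewrite Cmod_0. exact Hr. }
  apply (filterlim_C_iff (locally z)). intros eps He.
  assert (Hd : (0 < Rmin rho (eps / (K + 1)))%R) by (apply Rmin_pos; [lra|apply Rdiv_lt_0_compat; lra]).
  assert (L := proj1 (filterlim_C_iff (locally z) (fun w => w) z) (fun P H => H) _ Hd).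
  refine (filter_imp (fun w : C => _) (fun w : C => _) _ L). intros w Hw.
  assert (h1 := Rmin_l rho (eps / (K + 1))). assert (h2 := Rmin_r rho (eps / (K + 1))).
  specialize (HB (w - z) ltac:(lra)). replace (z + (w - z)) with w in HB by cring. rewrite a0 in HB.
  eapply Rle_lt_trans; [exact HB|]. assert (hc := Cmod_ge_0 (w - z)).
  apply Rle_lt_trans with ((K + 1) * Cmod (w - z))%R; [nra|].
  replace eps with ((K + 1) * (eps / (K + 1)))%R by (field; lra).
  apply Rmult_lt_compat_l; lra.
Qed.

Lemma Cexp_remainder : exists K, (0 <= K)%R /\ forall w, (Cmod w <= 1)%R ->
  (Cmod (Cexp w - 1 - w) <= K * (Cmod w * Cmod w))%R.
Proof.
  assert (Hs := Cexp_series 1).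
  assert (A : ex_series (fun n => Cmod (/ INR (fact n)) * 1 ^ n)%R).
  { apply pseries_abs with 2%R; [lra|]. intros h _. exists (Cexp h).
    eapply is_series_C_ext; [|apply Cexp_series]. intros n; cbv beta; unfold Cdiv; cring. }
  assert (A2 : ex_series (fun n => Cmod (/ INR (fact (S (S n)))))).
  { apply (ex_series_incr_1 (fun n => Cmod (/ INR (fact (S n))))).
    apply (ex_series_incr_1 (fun n => Cmod (/ INR (fact n)))).
    eapply ex_series_ext; [|exact A]. intros n. cbv beta. rewrite pow1, Rmult_1_r. reflexivity. }
  exists (Series (fun n => Cmod (/ INR (fact (S (S n)))))). split.
  - apply Series_nonneg; [exact A2|]. intros; apply Cmod_ge_0.
  - intros w Hw.
    assert (S1 := Cexp_series w). apply is_series_C_incr_1 in S1. apply is_series_C_incr_1 in S1.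
    cbv beta in S1. 
    replace (Cexp w - w ^ 0 / INR (fact 0) - w ^ 1 / INR (fact 1)) with (Cexp w - 1 - w) in S1 by (simpl; field).
    rewrite <- Series_scal_r.
    apply (Cmod_series_le _ _ _ S1).
    + intros n. unfold Cdiv. rewrite Cmod_mult, !Cpow_S, !Cmod_mult, Rmult_comm.
      apply Rmult_le_compat_l; [apply Cmod_ge_0|].
      assert (h := Cmod_ge_0 w). rewrite Cmod_pow.
      assert (h2 : (Cmod w ^ n <= 1)%R) by (rewrite <- (pow1 n); apply pow_incr; lra).
      rewrite <- Rmult_assoc. rewrite <- (Rmult_1_r (Cmod w * Cmod w)) at 2.
      apply Rmult_le_compat_l; [apply Rmult_le_pos; exact h|exact h2].
    + apply ex_series_scal_r, A2.
Qed.

(** * The reciprocal Gamma function *)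
(** The sequence whose limit defines [rGamma]. *)
Definition euler_gauss (n : nat) (z : C) : C := poch z (S n) / (INR (fact n) * Cpower (INR n) z).

Lemma Cpower_nat (n : nat) (z : C) : (0 < n)%nat -> Cpower (INR n) z = rcpow z (INR n).
Proof.
  intros Hn. assert (h := lt_0_INR n Hn). unfold Cpower, rcpow. f_equal. f_equal.
  unfold Clog, Carg. rewrite Cmod_R, Rabs_pos_eq by lra. rewrite im_RtoC, re_RtoC.
  destruct (Rle_dec 0 0) as [_|f]; [|lra].
  unfold Rdiv. rewrite Rinv_r by lra. rewrite acos_1. reflexivity.
Qed.

Lemma euler_gauss_eq n z : (0 < n)%nat -> euler_gauss n z = poch z (S n) / (INR (fact n) * rcpow z (INR n)).
Proof. intros H. unfold euler_gauss. rewrite Cpower_nat by exact H. reflexivity. Qed.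

Lemma rcpow_mult_base z x y : (0 < x)%R -> (0 < y)%R -> rcpow z (x * y) = rcpow z x * rcpow z y.
Proof.
  intros Hx Hy. unfold rcpow. rewrite ln_mult by assumption. rewrite <- Cexp_plus. f_equal.
  rewrite RtoC_plus. ring.
Qed.

Lemma euler_gauss_step n z : (0 < n)%nat ->
  euler_gauss (S n) z = euler_gauss n z * ((1 + z / INR (S n)) * rcpow z (INR n / INR (S n))).
Proof.
  intros Hn. rewrite !euler_gauss_eq by lia.
  assert (h := lt_0_INR n Hn). assert (h1 := lt_0_INR (S n) ltac:(lia)).
  assert (E : rcpow z (INR n) = rcpow z (INR n / INR (S n)) * rcpow z (INR (S n))).
  { rewrite <- rcpow_mult_base; [|apply Rdiv_lt_0_compat; assumption|exact h1]. f_equal. field. lra. }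
  rewrite E, (poch_S z (S n)), fact_S_C.
  assert (N1 := rcpow_neq_0 z (INR n / INR (S n))). assert (N2 := rcpow_neq_0 z (INR (S n))).
  field. nz.
Qed.

Lemma ln_one_minus_bound (x : R) : (0 < x <= 1 / 2)%R -> (Rabs (ln (1 - x) + x) <= 2 * (x * x))%R.
Proof.
  intros Hx.
  assert (h1 : (ln (1 - x) <= - x)%R).
  { rewrite <- (ln_exp (- x)). apply ln_le; [lra|]. assert (h := exp_ineq1_le (- x)). lra. }
  assert (h2 : (- (x + 2 * (x * x)) <= ln (1 - x))%R).
  { assert (E : (ln (1 - x) = - ln (/ (1 - x)))%R) by (rewrite ln_Rinv; lra).
    rewrite E. apply Ropp_le_contravar. rewrite <- (ln_exp (x + 2 * (x * x))).
    assert (hp : (0 < / (1 - x))%R) by (apply Rinv_0_lt_compat; lra).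
    apply ln_le; [exact hp|].
    apply Rle_trans with (1 + (x + 2 * (x * x)))%R; [|apply exp_ineq1_le].
    apply (Rmult_le_reg_r (1 - x)); [lra|]. rewrite Rinv_l by lra. nra. }
  unfold Rabs; destruct Rcase_abs; lra.
Qed.

(** Consecutive terms have ratio (1 + z/m) (1 - 1/m)^z = 1 + O(1/m^2), uniformly
    for bounded z: the terms z/m and z ln (1 - 1/m) cancel to first order. *)
Lemma euler_gauss_ratio_bound (R0 : R) : (0 <= R0)%R -> exists (K : R) (M : nat), (0 <= K)%R /\ (1 <= M)%nat /\
  forall z n, (Cmod z <= R0)%R -> (M <= n)%nat ->
   (Cmod ((1 + z / INR (S n)) * rcpow z (INR n / INR (S n)) - 1) <= K / (INR (S n) * INR (S n)))%R.
Proof.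
  intros HR. destruct Cexp_remainder as [K0 [HK0 HE]].
  destruct (INR_eventually_ge (2 * R0)) as [M1 HM1].
  exists (2 * R0 + 2 * (R0 * R0) + (1 + R0) * (K0 * (4 * (R0 * R0))))%R, (S M1).
  split; [|split; [lia|]].
  { assert (0 <= R0 * R0)%R by nra. assert (0 <= K0 * (4 * (R0 * R0)))%R by nra. nra. }
  intros z n Hz Hn.
  assert (hm := HM1 (S n) ltac:(lia)).
  assert (hn : (1 <= INR n)%R) by (apply (le_INR 1); lia).
  set (m := INR (S n)) in *. assert (m1 : (m = INR n + 1)%R) by apply S_INR.
  assert (hm2 : (2 <= m)%R) by lra.
  set (x := (/ m)%R).
  assert (hx : (0 < x <= 1 / 2)%R).
  { split; [apply Rinv_0_lt_compat; lra|]. unfold x. replace (1/2)%R with (/ 2)%R by field. apply Rinv_le_contravar; lra. }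
  assert (mx : (m * x = 1)%R) by (unfold x; field; lra).
  assert (Ex : (INR n / m = 1 - x)%R) by (unfold x; rewrite m1; field; lra).
  rewrite Ex. set (u := ln (1 - x)).
  assert (hu := ln_one_minus_bound x hx). fold u in hu.
  assert (hu2 : (Rabs u <= 2 * x)%R).
  { replace u with ((u + x) + (- x))%R by ring. eapply Rle_trans; [apply Rabs_triang|].
    rewrite Rabs_Ropp, (Rabs_pos_eq x) by lra. nra. }
  unfold rcpow. fold u. set (w := z * RtoC u).
  assert (c0 := Cmod_ge_0 z).
  assert (hw : (Cmod w <= R0 * (2 * x))%R).
  { unfold w. rewrite Cmod_mult, Cmod_R. apply Rmult_le_compat; [exact c0|apply Rabs_pos|exact Hz|exact hu2]. }
  assert (hw1 : (Cmod w <= 1)%R).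
  { eapply Rle_trans; [exact hw|]. rewrite <- mx. rewrite <- Rmult_assoc. apply Rmult_le_compat_r; lra. }
  assert (hd := HE w hw1). set (d := Cexp w - 1 - w) in *.
  replace (z / RtoC m) with (z * RtoC x) by (unfold x; rewrite RtoC_inv by lra; reflexivity).
  (* The first-order terms combine to z (u + x) with u = ln (1 - x) = - x + O(x^2). *)
  replace ((1 + z * RtoC x) * Cexp w - 1) with
    (z * RtoC (u + x) + (z * RtoC x * w + (1 + z * RtoC x) * d)).
  2:{ unfold d, w. rewrite RtoC_plus. ring. }
  eapply Rle_trans; [apply Cmod_triangle|].
  eapply Rle_trans; [apply Rplus_le_compat_l, Cmod_triangle|]. rewrite !Cmod_mult, !Cmod_R, (Rabs_pos_eq x) by lra.
  assert (cw := Cmod_ge_0 w).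
  assert (b1 : (Cmod z * Rabs (u + x) <= R0 * (2 * (x * x)))%R).
  { apply Rmult_le_compat; [exact c0|apply Rabs_pos|exact Hz|exact hu]. }
  assert (b2 : (Cmod z * x * Cmod w <= R0 * x * (R0 * (2 * x)))%R).
  { apply Rmult_le_compat; [nra|exact cw| |exact hw]. apply Rmult_le_compat_r; lra. }
  assert (b3 : (Cmod (1 + z * RtoC x) <= 1 + R0)%R).
  { eapply Rle_trans; [apply Cmod_triangle|]. rewrite Cmod_1, Cmod_mult, Cmod_R, (Rabs_pos_eq x) by lra. nra. }
  assert (b4 : (Cmod d <= K0 * (4 * (R0 * R0)) * (x * x))%R).
  { eapply Rle_trans; [exact hd|].
    assert (Cmod w * Cmod w <= (R0 * (2 * x)) * (R0 * (2 * x)))%R by (apply Rmult_le_compat; assumption).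
    apply Rle_trans with (K0 * ((R0 * (2 * x)) * (R0 * (2 * x))))%R; [apply Rmult_le_compat_l; assumption|].
    right; ring. }
  assert (b5 : (Cmod (1 + z * RtoC x) * Cmod d <= (1 + R0) * (K0 * (4 * (R0 * R0)) * (x * x)))%R).
  { apply Rmult_le_compat; [apply Cmod_ge_0|apply Cmod_ge_0|exact b3|exact b4]. }
  replace ((2 * R0 + 2 * (R0 * R0) + (1 + R0) * (K0 * (4 * (R0 * R0)))) / (m * m))%R with
    ((2 * R0 + 2 * (R0 * R0) + (1 + R0) * (K0 * (4 * (R0 * R0)))) * (x * x))%R by (unfold x; field; lra).
  lra.
Qed.

Lemma ex_series_inv_sq (K : R) : (0 <= K)%R -> ex_series (fun n => K / (INR (S n) * INR (S n)))%R.
Proof.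
  intros HK.
  apply ex_series_le_pos with (fun n => K * (2 / (INR (S n) * INR (S (S n)))))%R.
  - intros n. assert (h := lt_0_INR (S n) ltac:(lia)). rewrite (S_INR (S n)). set (x := INR (S n)) in *.
    assert (hx : (1 <= x)%R) by (unfold x; apply (le_INR 1); lia).
    split.
    + apply Rmult_le_pos; [lra|]. left; apply Rinv_0_lt_compat; nra.
    + unfold Rdiv. apply Rmult_le_compat_l; [exact HK|].
      apply (Rmult_le_reg_r (x * x * (x + 1))); [nra|].
      replace (/ (x * x) * (x * x * (x + 1)))%R with (x + 1)%R by (field; lra).
      replace (2 * / (x * (x + 1)) * (x * x * (x + 1)))%R with (2 * x)%R by (field; lra). lra.
  - apply (ex_series_scal K (fun n => 2 / (INR (S n) * INR (S (S n))))%R).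
    apply telescoping_series.
Qed.

Lemma exp_mono (x y : R) : (x <= y)%R -> (exp x <= exp y)%R.
Proof. intros [H| ->]; [left; apply exp_increasing, H|right; reflexivity]. Qed.

(** An infinite product with summable deviations from 1 has bounded partial
    products. *)
Lemma product_growth_bound (r : nat -> C) (e : nat -> R) (N : nat) :
  (forall n, (0 <= e n)%R) -> ex_series e ->
  (forall n, (N <= n)%nat -> (Cmod (r (S n) - r n) <= e n * Cmod (r n))%R) ->
  forall n, (N <= n)%nat -> (Cmod (r n) <= Cmod (r N) * exp (Series e))%R.
Proof.
  intros He Hex H.
  assert (Hr := Cmod_ge_0 (r N)).
  assert (P : forall n, (N <= n)%nat -> (Cmod (r (S n)) <= Cmod (r N) * exp (sum_n e n))%R).
  { assert (st : forall n, (N <= n)%nat -> (Cmod (r (S n)) <= Cmod (r n) * exp (e n))%R).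
    { intros n Hn. replace (r (S n)) with ((r (S n) - r n) + r n) by ring.
      eapply Rle_trans; [apply Cmod_triangle|]. specialize (H n Hn).
      assert (h1 := exp_ineq1_le (e n)). assert (h3 := Cmod_ge_0 (r n)). nra. }
    intros n Hn. induction Hn as [|n Hn IH].
    - eapply Rle_trans; [apply st; lia|]. apply Rmult_le_compat_l; [exact Hr|].
      apply exp_mono. destruct N as [|N]; [rewrite rsum_0; lra|]. rewrite rsum_S.
      assert (h := rsum_pos e He N). lra.
    - eapply Rle_trans; [apply st; lia|]. rewrite rsum_S, exp_plus, <- Rmult_assoc.
      apply Rmult_le_compat_r; [left; apply exp_pos|exact IH]. }
  intros n Hn. destruct (Nat.eq_dec n N) as [->|hn].
  - assert (h := Series_nonneg e Hex He). assert (h1 := exp_ineq1_le (Series e)). nra.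
  - destruct n as [|n]; [lia|]. eapply Rle_trans; [apply P; lia|].
    apply Rmult_le_compat_l; [exact Hr|]. apply exp_mono, rsum_le_Series; assumption.
Qed.

Lemma ex_series_shift_n (b : nat -> R) n : ex_series b -> ex_series (fun k => b (n + k)%nat).
Proof. apply ex_series_incr_n. Qed.

Lemma telescoping_lim (r : nat -> C) (b : nat -> R) (N : nat) :
  (forall n, (0 <= b n)%R) -> ex_series b ->
  (forall n, (N <= n)%nat -> (Cmod (r (S n) - r n) <= b n)%R) ->
  exists L, filterlim r eventually (locally L) /\
    forall n, (N <= n)%nat -> (Cmod (L - r n) <= Series (fun k => b (n + k)%nat))%R.
Proof.
  intros Hb Hex H.
  assert (Hpart : forall n m, sum_n (fun k => r (S (n + k)) - r (n + k)%nat) m = r (n + S m)%nat - r n).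
  { intros n m. induction m as [|m IH].
    - rewrite csum_0. rewrite Nat.add_0_r. replace (n + 1)%nat with (S n) by lia. reflexivity.
    - rewrite csum_S, IH. replace (n + S (S m))%nat with (S (n + S m)) by lia. cring. }
  assert (A : abs_summable (fun k => r (S (N + k)) - r (N + k)%nat)).
  { apply abs_summable_le with (fun k => b (N + k)%nat); [|apply ex_series_shift_n, Hex].
    intros k. apply H. lia. }
  set (L := r N + Csum (fun k => r (S (N + k)) - r (N + k)%nat)).
  assert (HL : filterlim r eventually (locally L)).
  { apply (filterlim_C_iff eventually). intros eps He.
    destruct (proj1 (filterlim_C_iff eventually _ _) (abs_summable_is _ A) eps He) as [N1 HN1].
    exists (N + S N1)%nat. intros n Hn. specialize (HN1 (n - N - 1)%nat ltac:(lia)).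
    replace (r n - L) with (sum_n (fun k => r (S (N + k)) - r (N + k)%nat) (n - N - 1) - Csum (fun k => r (S (N + k)) - r (N + k)%nat)); [exact HN1|].
    rewrite Hpart. replace (N + S (n - N - 1))%nat with n by lia. unfold L. ring. }
  exists L. split; [exact HL|]. intros n Hn.
  apply (filterlim_C_le eventually (fun m => r m - r n)).
  - apply (filterlim_C_ext eventually (fun m => r m + - r n)); [apply filter_forall; intros m; reflexivity|].
    apply filterlim_C_plus; [apply _|exact HL|apply filterlim_C_const, _].
  - exists (S n). intros m Hm.
    replace (r m - r n) with (sum_n (fun k => r (S (n + k)) - r (n + k)%nat) (m - n - 1)).
    2:{ rewrite Hpart. replace (n + S (m - n - 1))%nat with m by lia. reflexivity. }
    eapply Rle_trans; [apply Cmod_sum_le|].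
    eapply Rle_trans; [|apply (rsum_le_Series (fun k => b (n + k)%nat)); [intros; apply Hb|apply ex_series_shift_n, Hex]].
    apply rsum_le. intros k _. apply H. lia.
Qed.

Lemma tail_small (b : nat -> R) : (forall n, (0 <= b n)%R) -> ex_series b ->
  forall eps, (0 < eps)%R -> exists N, forall n, (N <= n)%nat -> (Series (fun k => b (n + k)%nat) <= eps)%R.
Proof.
  intros Hb Hex eps He. destruct (ex_series_tail b Hex eps He) as [N HN].
  exists (S N). intros n Hn. apply Series_bound; [apply ex_series_shift_n, Hex|].
  intros m.
  assert (P : sum_n (fun k => b (n + k)%nat) m = (sum_n b (n + m) - sum_n b (n - 1))%R).
  { induction m as [|m IH].
    - rewrite rsum_0, Nat.add_0_r. destruct n as [|n]; [lia|].
      replace (S n - 1)%nat with n by lia. rewrite rsum_S.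
      match goal with |- @eq _ ?x ?y => change (@eq R x y) end. ring.
    - rewrite rsum_S, IH. replace (n + S m)%nat with (S (n + m)) by lia. rewrite rsum_S.
      match goal with |- @eq _ ?x ?y => change (@eq R x y) end. ring. }
  rewrite P. destruct (HN (n - 1)%nat (n + m)%nat ltac:(lia)) as [h|h]; [|lia].
  revert h; unfold Rabs; destruct Rcase_abs; lra.
Qed.

Lemma Cmod_poch_le (z : C) (R0 : R) n : (Cmod z <= R0)%R -> (Cmod (poch z n) <= (R0 + INR n) ^ n)%R.
Proof.
  intros Hz. assert (hz := Cmod_ge_0 z). 
  assert (H : forall m, (m <= n)%nat -> (Cmod (poch z m) <= (R0 + INR n) ^ m)%R).
  { induction m as [|m IH]; intros Hm.
    - simpl. rewrite Cmod_1. lra.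
    - rewrite poch_S, Cmod_mult. simpl. rewrite Rmult_comm.
      apply Rmult_le_compat; try apply Cmod_ge_0; [|apply IH; lia].
      eapply Rle_trans; [apply Cmod_triangle|]. rewrite Cmod_R, Rabs_pos_eq by apply pos_INR.
      assert (h : (INR m <= INR n)%R) by (apply le_INR; lia). lra. }
  apply H. lia.
Qed.

Lemma euler_gauss_locally_bounded (n : nat) (R0 : R) : (1 <= n)%nat -> exists B, (0 <= B)%R /\
  forall z, (Cmod z <= R0)%R -> (Cmod (euler_gauss n z) <= B)%R.
Proof.
  intros Hn. assert (hn : (1 <= INR n)%R) by (apply (le_INR 1); lia).
  assert (hl : (0 <= ln (INR n))%R) by (rewrite <- ln_1; apply ln_le; lra).
  exists (Rabs ((R0 + INR (S n)) ^ S n) * exp (R0 * ln (INR n)))%R. split.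
  { apply Rmult_le_pos; [apply Rabs_pos|left; apply exp_pos]. }
  intros z Hz. rewrite euler_gauss_eq by lia.
  assert (N1 := rcpow_neq_0 z (INR n)).
  replace (poch z (S n) / (INR (fact n) * rcpow z (INR n))) with
    (poch z (S n) * (/ INR (fact n) * rcpow (- z) (INR n))).
  2:{ replace (rcpow (- z) (INR n)) with (/ rcpow z (INR n)).
      - field. nz.
      - assert (E : rcpow z (INR n) * rcpow (- z) (INR n) = 1).
        { rewrite <- rcpow_add, <- (rcpow_0 (INR n)). f_equal. ring. }
        replace (rcpow (- z) (INR n)) with (/ rcpow z (INR n) * (rcpow z (INR n) * rcpow (- z) (INR n))) by (field; exact N1).
        rewrite E. ring. }
  rewrite !Cmod_mult. apply Rmult_le_compat; try apply Cmod_ge_0.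
  - apply Rmult_le_pos; apply Cmod_ge_0.
  - eapply Rle_trans; [apply Cmod_poch_le, Hz|apply Rle_abs].
  - rewrite <- (Rmult_1_l (exp _)). apply Rmult_le_compat; try apply Cmod_ge_0.
    + assert (f0 := INR_fact_lt_0 n). rewrite <- RtoC_inv, Cmod_R, Rabs_pos_eq by (try (left; apply Rinv_0_lt_compat); lra).
      rewrite <- Rinv_1. apply Rinv_le_contravar; [lra|]. apply (le_INR 1), lt_O_fact.
    + unfold rcpow. rewrite Cmod_Cexp, re_scal_r. apply exp_mono. apply Rmult_le_compat_r; [exact hl|].
      rewrite re_opp. assert (h := re_le_Cmod z). revert h; unfold Rabs; destruct Rcase_abs; lra.
Qed.

(** Convergence locally uniform in z, which yields the continuity of [rGamma]. *)
Lemma euler_gauss_conv (R0 : R) : (0 <= R0)%R -> forall eps, (0 < eps)%R -> exists N, forall z, (Cmod z <= R0)%R ->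
   filterlim (fun n => euler_gauss n z) eventually (locally (rGamma z)) /\
   forall n, (N <= n)%nat -> (Cmod (rGamma z - euler_gauss n z) <= eps)%R.
Proof.
  intros HR eps He.
  destruct (euler_gauss_ratio_bound R0 HR) as [K [M [HK [HM HKM]]]].
  destruct (euler_gauss_locally_bounded M R0 HM) as [B [HB HBM]].
  set (e := fun n => (K / (INR (S n) * INR (S n)))%R).
  assert (e0 : forall n, (0 <= e n)%R).
  { intros n. apply Rmult_le_pos; [exact HK|]. left. apply Rinv_0_lt_compat.
    apply Rmult_lt_0_compat; apply lt_0_INR; lia. }
  assert (ee : ex_series e) by (apply ex_series_inv_sq, HK).
  set (B1 := (B * exp (Series e))%R).
  assert (HB1 : (0 <= B1)%R) by (apply Rmult_le_pos; [exact HB|left; apply exp_pos]).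
  set (b := fun n => (B1 * e n)%R).
  assert (b0 : forall n, (0 <= b n)%R) by (intros n; apply Rmult_le_pos; [exact HB1|apply e0]).
  assert (bb : ex_series b) by apply (ex_series_scal B1 e ee).
  destruct (tail_small b b0 bb eps He) as [N HN].
  exists (max N M). intros z Hz.
  assert (St : forall n, (M <= n)%nat -> (Cmod (euler_gauss (S n) z - euler_gauss n z) <= e n * Cmod (euler_gauss n z))%R).
  { intros n Hn. rewrite euler_gauss_step by lia.
    set (q := (1 + z / INR (S n)) * rcpow z (INR n / INR (S n))).
    replace (euler_gauss n z * q - euler_gauss n z) with ((q - 1) * euler_gauss n z) by ring.
    rewrite Cmod_mult. apply Rmult_le_compat_r; [apply Cmod_ge_0|]. apply HKM; assumption. }
  destruct (telescoping_lim (fun n => euler_gauss n z) b M b0 bb) as [L [L1 L2]].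
  { intros n Hn. eapply Rle_trans; [apply St, Hn|]. unfold b. rewrite Rmult_comm.
    apply Rmult_le_compat_r; [apply e0|].
    eapply Rle_trans; [apply (product_growth_bound (fun n => euler_gauss n z) e M e0 ee St n Hn)|].
    apply Rmult_le_compat_r; [left; apply exp_pos|apply HBM, Hz]. }
  assert (E : rGamma z = L) by (apply Clim_seq_unique, L1).
  rewrite E. split; [exact L1|]. intros n Hn.
  eapply Rle_trans; [apply L2; lia|]. apply HN. lia.
Qed.

Lemma euler_gauss_lim (z : C) : filterlim (fun n => euler_gauss n z) eventually (locally (rGamma z)).
Proof.
  destruct (euler_gauss_conv (Cmod z) (Cmod_ge_0 z) 1%R ltac:(lra)) as [N H]. apply (H z). lra.
Qed.

Lemma analytic_rcpow (t : R) (z : C) : analytic_at (fun z => rcpow z t) z.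
Proof.
  unfold rcpow. apply (analytic_at_comp Cexp (fun z => z * RtoC (ln t))); [|apply analytic_at_Cexp].
  apply analytic_at_mult; [apply analytic_at_id|apply analytic_at_const].
Qed.

Lemma analytic_poch (n : nat) (z : C) : analytic_at (fun z => poch z n) z.
Proof.
  induction n as [|n IH].
  - exact (analytic_at_const 1 z).
  - apply (analytic_at_mult (fun z => poch z n) (fun z => z + INR n)); [exact IH|].
    apply analytic_at_plus; [apply analytic_at_id|apply analytic_at_const].
Qed.

Lemma analytic_euler_gauss (n : nat) (z : C) : (1 <= n)%nat -> analytic_at (euler_gauss n) z.
Proof.
  intros Hn. apply (analytic_at_ext (fun z => poch z (S n) * / (INR (fact n) * rcpow z (INR n))) _ z 1); [lra| |].
  - intros w _. rewrite euler_gauss_eq by lia. reflexivity.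
  - apply (analytic_at_mult (fun z => poch z (S n))); [apply analytic_poch|].
    apply (analytic_at_comp (fun w => / w) (fun z => INR (fact n) * rcpow z (INR n))).
    + apply analytic_at_scal, analytic_rcpow.
    + apply analytic_at_inv. apply Cmult_neq_0; [apply fact_neq_0C|apply rcpow_neq_0].
Qed.

Lemma rGamma_continuous (z : C) : filterlim rGamma (locally z) (locally (rGamma z)).
Proof.
  apply (filterlim_C_iff (locally z)). intros eps He.
  assert (hz := Cmod_ge_0 z).
  destruct (euler_gauss_conv (Cmod z + 1) ltac:(lra) (eps / 4)%R ltac:(lra)) as [N HN].
  assert (C0 := analytic_continuous _ _ (analytic_euler_gauss (S N) z ltac:(lia))).
  assert (D1 := proj1 (filterlim_C_iff (locally z) _ _) C0 (eps / 4)%R ltac:(lra)).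
  assert (D2 := proj1 (filterlim_C_iff (locally z) (fun w => w) z) (fun P H => H) 1%R ltac:(lra)).
  refine (filter_imp (fun w : C => _ /\ _) (fun w : C => _) _ (filter_and _ _ D1 D2)). intros w [h1 h2].
  assert (hw : (Cmod w <= Cmod z + 1)%R).
  { replace w with ((w - z) + z) by ring. eapply Rle_trans; [apply Cmod_triangle|]. lra. }
  destruct (HN w hw) as [_ e1]. destruct (HN z ltac:(lra)) as [_ e2].
  specialize (e1 (S N) ltac:(lia)). specialize (e2 (S N) ltac:(lia)).
  replace (rGamma w - rGamma z) with ((rGamma w - euler_gauss (S N) w) + ((euler_gauss (S N) w - euler_gauss (S N) z) + - (rGamma z - euler_gauss (S N) z))) by ring.
  eapply Rle_lt_trans; [apply Cmod_triangle|].
  eapply Rle_lt_trans; [apply Rplus_le_compat_l, Cmod_triangle|]. rewrite Cmod_opp. lra.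
Qed.

(** From some index on, the deviations of the remaining factors from 1 sum to at
    most 1/2, so the remaining product has modulus at least 1/2. *)
Lemma rGamma_neq_0 (z : C) : ~ is_nonpos_int z -> rGamma z <> 0.
Proof.
  intros Hz.
  destruct (euler_gauss_ratio_bound (Cmod z) (Cmod_ge_0 z)) as [K [M [HK [HM HKM]]]].
  set (e := fun n => (K / (INR (S n) * INR (S n)))%R).
  assert (e0 : forall n, (0 <= e n)%R).
  { intros n. apply Rmult_le_pos; [exact HK|]. left. apply Rinv_0_lt_compat.
    apply Rmult_lt_0_compat; apply lt_0_INR; lia. }
  assert (ee : ex_series e) by (apply ex_series_inv_sq, HK).
  destruct (tail_small e e0 ee (1/2)%R ltac:(lra)) as [N1 HN1].
  set (N := max N1 M).
  assert (T := HN1 N ltac:(unfold N; lia)).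
  assert (P : forall k, (Cmod (euler_gauss N z) * (1 - sum_n (fun j => e (N + j)%nat) k) <= Cmod (euler_gauss (N + S k)%nat z))%R).
  { assert (St : forall n, (N <= n)%nat -> (Cmod (euler_gauss n z) * (1 - e n) <= Cmod (euler_gauss (S n) z))%R).
    { intros n Hn. rewrite euler_gauss_step by (unfold N in Hn; lia). rewrite Cmod_mult.
      apply Rmult_le_compat_l; [apply Cmod_ge_0|].
      set (q := (1 + z / INR (S n)) * rcpow z (INR n / INR (S n))).
      assert (h : (Cmod (q - 1) <= e n)%R) by (apply HKM; [lra|unfold N in Hn; lia]).
      assert (h1 := Cmod_triangle q (- (q - 1))). replace (q + - (q - 1)) with (RtoC 1) in h1 by ring.
      rewrite Cmod_1, Cmod_opp in h1. lra. }
    assert (hb : forall k, (sum_n (fun j => e (N + j)%nat) k <= 1/2)%R).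
    { intros k. eapply Rle_trans; [apply rsum_le_Series; [intros; apply e0|apply ex_series_shift_n, ee]|exact T]. }
    induction k as [|k IH].
    - rewrite rsum_0, Nat.add_0_r. replace (N + 1)%nat with (S N) by lia. apply St. lia.
    - assert (hs := St (N + S k)%nat ltac:(lia)). replace (N + S (S k))%nat with (S (N + S k)) by lia.
      eapply Rle_trans; [|exact hs].
      assert (hbk := hb (S k)). rewrite rsum_S in *.
      assert (hp : (0 <= sum_n (fun j => e (N + j)%nat) k)%R) by (apply rsum_pos; intros; apply e0).
      assert (hek := e0 (N + S k)%nat). assert (hr := Cmod_ge_0 (euler_gauss N z)).
      set (s := sum_n (fun j => e (N + j)%nat) k) in *. set (ek := e (N + S k)%nat) in *.
      apply Rle_trans with (Cmod (euler_gauss N z) * (1 - s) * (1 - ek))%R.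
      + rewrite Rmult_assoc. apply Rmult_le_compat_l; [exact hr|].
        change (plus s ek) with (s + ek)%R. nra.
      + apply Rmult_le_compat_r; [|exact IH]. change (s + ek <= 1/2)%R in hbk. lra. }
  assert (N0 : euler_gauss N z <> 0).
  { rewrite euler_gauss_eq by (unfold N; lia). apply Cmult_neq_0; [apply poch_neq_0, Hz|].
    intros E. assert (D : RtoC (INR (fact N)) * rcpow z (INR N) <> 0) by (apply Cmult_neq_0; [apply fact_neq_0C|apply rcpow_neq_0]).
    apply C1_nz. rewrite <- (Cinv_r _ D), E. ring. }
  assert (p0 := proj1 (Cmod_gt_0 _) N0).
  intros E.
  assert (L := proj1 (filterlim_C_iff eventually _ _) (euler_gauss_lim z) (Cmod (euler_gauss N z) / 2)%R ltac:(lra)).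
  destruct L as [N2 HN2]. specialize (HN2 (N + S N2)%nat ltac:(lia)). rewrite E in HN2.
  replace (euler_gauss (N + S N2) z - 0) with (euler_gauss (N + S N2)%nat z) in HN2 by ring.
  specialize (P N2).
  assert (hb : (sum_n (fun j => e (N + j)%nat) N2 <= 1/2)%R).
  { eapply Rle_trans; [apply rsum_le_Series; [intros; apply e0|apply ex_series_shift_n, ee]|exact T]. }
  nra.
Qed.

Lemma filterlim_inv_nat (z : C) : filterlim (fun n => INR n / (z + 1 + INR n)) eventually (locally (RtoC 1)).
Proof.
  apply (filterlim_C_iff eventually). intros eps He.
  destruct (INR_eventually_ge (Cmod (z + 1) + Cmod (z + 1) / eps + 1)) as [N HN].
  exists N. intros n Hn. specialize (HN n Hn).
  assert (h := Cmod_plus_INR_ge (z + 1) n). assert (c0 := Cmod_ge_0 (z + 1)).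
  assert (d0 : (0 <= Cmod (z + 1) / eps)%R) by (apply Rmult_le_pos; [exact c0|left; apply Rinv_0_lt_compat; lra]).
  assert (hp : (0 < Cmod (z + 1 + INR n))%R) by lra.
  assert (N0 : z + 1 + INR n <> 0) by (apply Cmod_gt_0; exact hp).
  replace (INR n / (z + 1 + INR n) - 1) with (- ((z + 1) / (z + 1 + INR n))) by (field; exact N0).
  rewrite Cmod_opp, Cmod_div by exact N0.
  apply (Rmult_lt_reg_r (Cmod (z + 1 + INR n))); [exact hp|].
  unfold Rdiv at 1. rewrite Rmult_assoc, Rinv_l, Rmult_1_r by lra.
  apply Rlt_le_trans with (eps * (Cmod (z + 1) / eps + 1))%R.
  - replace (eps * (Cmod (z + 1) / eps + 1))%R with (Cmod (z + 1) + eps)%R by (field; lra). lra.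
  - apply Rmult_le_compat_l; lra.
Qed.

Lemma rGamma_S (z : C) : rGamma z = z * rGamma (z + 1).
Proof.
  apply (filterlim_C_unique eventually (fun n => euler_gauss n z)); [apply euler_gauss_lim|].
  apply (filterlim_C_ext eventually (fun n => z * euler_gauss n (z + 1) * (INR n / (z + 1 + INR n)))).
  - destruct (INR_eventually_ge (Cmod (z + 1) + 1)) as [N HN].
    exists (S N). intros n Hn. specialize (HN n ltac:(lia)).
    assert (h := Cmod_plus_INR_ge (z + 1) n).
    assert (N0 : z + 1 + INR n <> 0) by (apply Cmod_gt_0; lra).
    assert (h0 := lt_0_INR n ltac:(lia)).
    rewrite !euler_gauss_eq by lia. rewrite (poch_S_l z), (poch_S (z + 1)), rcpow_S by exact h0.
    assert (N1 := rcpow_neq_0 z (INR n)). assert (N2 : RtoC (INR n) <> 0) by (apply RtoC_neq_0; lra).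
    field. nz.
  - apply (filterlim_C_eq _ _ (z * rGamma (z + 1) * 1)); [|ring].
    apply filterlim_C_mult; [apply _| |apply filterlim_inv_nat].
    apply filterlim_C_mult; [apply _|apply filterlim_C_const, _|apply euler_gauss_lim].
Qed.

Lemma rGamma_poch (z : C) n : rGamma z = poch z n * rGamma (z + INR n).
Proof.
  induction n as [|n IH].
  - simpl. rewrite Cplus_0_r. ring.
  - rewrite IH, (rGamma_S (z + INR n)), poch_S, RtoC_INR_S, Cplus_assoc. ring.
Qed.

(** * The value of the connection coefficient *)
(** Iterating [connected_raise] n times gives the coefficient for c + n times
    (c-a)_n (c-b)_n / ((c)_n (c-a-b)_n), and this quotient is one of Euler-Gauss
    products in which the powers of n cancel. *)
Lemma connection_coef_value (a b c C1 C2 : C) : ~ is_nonpos_int c -> ~ is_int (c - a - b) ->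
  connected a b c C1 C2 -> C1 * (rGamma c * rGamma (c - a - b)) = rGamma (c - a) * rGamma (c - b).
Proof.
  intros Hc Hs H.
  assert (Hcn : forall n, ~ is_nonpos_int (c + INR n)) by (intros n; apply nonpos_int_plus_nat, Hc).
  assert (Hsn : forall n, ~ is_int (c + INR n - a - b)).
  { intros n. replace (c + INR n - a - b) with (c - a - b + INR n) by ring. apply not_int_plus_nat, Hs. }
  set (D := fun n => connection_coef a b (c + INR n)).
  assert (HD : forall n, connected a b (c + INR n) (D n) (connection_coef2 a b (c + INR n))).
  { intros n. apply connected_ex; [apply Hcn|apply Hsn]. }
  assert (D0 : D 0%nat = C1).
  { assert (H0 := HD 0%nat). simpl (INR 0) in H0. rewrite Cplus_0_r in H0.
    apply Ceq_minus. apply (connected_indep a b c (D 0%nat - C1) (connection_coef2 a b c - C2) Hs).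
    intros t Ht. specialize (H t Ht). specialize (H0 t Ht).
    transitivity (D 0%nat * y_reg0 a b c t + connection_coef2 a b c * y_exp0 a b c t - (C1 * y_reg0 a b c t + C2 * y_exp0 a b c t)); [ring|].
    rewrite <- H, <- H0. ring. }
  assert (Lim := connection_coef_lim a b c D _ Hc Hs HD).
  assert (Hs0 : ~ is_nonpos_int (c - a - b)) by apply not_int_not_nonpos, Hs.
  assert (Rel : forall n, C1 * (poch c n * poch (c - a - b) n) = poch (c - a) n * poch (c - b) n * D n).
  { induction n as [|n IH].
    - rewrite D0. simpl. ring.
    - assert (E := HD (S n)).
      replace (c + INR (S n)) with (c + INR n + 1) in E by (rewrite RtoC_INR_S; ring).
      assert (R := connected_raise a b (c + INR n) _ _ _ _ (Hcn n) (Hsn n) (HD n) E).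
      assert (N := nonpos_int_neq_0 _ (Hcn n)).
      rewrite !poch_S.
      transitivity ((C1 * (poch c n * poch (c - a - b) n)) * ((c + INR n) * (c - a - b + INR n))); [ring|].
      rewrite IH.
      transitivity (poch (c - a) n * poch (c - b) n * (c + INR n) * ((c + INR n - a - b) * D n)); [ring|].
      rewrite <- R. field. exact N. }
  apply (filterlim_C_unique eventually (fun n => C1 * (euler_gauss n c * euler_gauss n (c - a - b)))).
  - apply filterlim_C_mult; [apply _|apply filterlim_C_const, _|].
    apply filterlim_C_mult; [apply _|apply euler_gauss_lim|apply euler_gauss_lim].
  - apply (filterlim_C_ext eventually (fun n => euler_gauss n (c - a) * euler_gauss n (c - b) * D (S n))).
    + exists 1%nat. intros n Hn. rewrite !euler_gauss_eq by lia.
      assert (h0 := lt_0_INR n ltac:(lia)).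
      assert (N1 := rcpow_neq_0 c (INR n)). assert (N2 := rcpow_neq_0 (c - a - b) (INR n)).
      assert (N3 := rcpow_neq_0 (c - a) (INR n)). assert (N4 := rcpow_neq_0 (c - b) (INR n)).
      assert (F := fact_neq_0C n).
      assert (E : rcpow c (INR n) * rcpow (c - a - b) (INR n) = rcpow (c - a) (INR n) * rcpow (c - b) (INR n)).
      { rewrite <- !rcpow_add. f_equal. ring. }
      transitivity ((poch (c - a) (S n) * poch (c - b) (S n) * D (S n)) /
        (INR (fact n) * INR (fact n) * (rcpow (c - a) (INR n) * rcpow (c - b) (INR n)))); [field; nz|].
      rewrite <- Rel, <- E. field. nz.
    + apply (filterlim_C_eq _ _ (rGamma (c - a) * rGamma (c - b) * 1)); [|ring].
      apply filterlim_C_mult; [apply _| |].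
      * apply filterlim_C_mult; [apply _|apply euler_gauss_lim|apply euler_gauss_lim].
      * apply (filterlim_C_iff eventually). intros eps He.
        destruct (proj1 (filterlim_C_iff eventually _ _) Lim eps He) as [N HN].
        exists N. intros n Hn. apply HN. lia.
Qed.

(** * The inversion formula for 2F1 *)

Lemma binom_ode (al z : C) : (Cmod z < 1)%R ->
  (1 - z) * psum (dcoef (bcoef al)) z = al * binom_fun al z.
Proof.
  intros Hz. unfold binom_fun.
  assert (sb := subexp_bcoef al). assert (s1 := subexp_dcoef _ sb). assert (s2 := subexp_xcoef _ s1).
  replace ((1 - z) * psum (dcoef (bcoef al)) z) with
    (psum (dcoef (bcoef al)) z + (-(1)) * psum (xcoef (dcoef (bcoef al))) z) by (rewrite <- psum_x by assumption; ring).
  rewrite !psum_scal by assumption. rewrite psum_plus by (try apply subexp_scal; assumption).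
  apply psum_ext; [apply subexp_plus; [exact s1|apply subexp_scal, s2]|exact Hz|]. intros n.
  rewrite xcoef_dcoef. unfold dcoef. rewrite bcoef_rec. ring.
Qed.

(** The quotient of the two sides has derivative 0 and tends to 1 at t = 0. *)
Lemma binom_fun_real (a : C) (t : R) : (0 < t < 1)%R -> binom_fun (- a) (RtoC t) = rcpow a (1 - t).
Proof.
  intros Ht.
  set (f := fun t : R => binom_fun (- a) (RtoC t) * rcpow (- a) (1 - t)).
  assert (D : forall t, (0 < t < 1)%R -> cder f t 0).
  { intros x Hx. eapply cder_eq.
    - apply cder_mult; [apply cder_psum; [apply subexp_bcoef|rewrite Rabs_pos_eq; lra]|].
      apply (cder_flip (rcpow (- a))), cder_rcpow. lra.
    - assert (B := binom_ode (- a) (RtoC x) (Cmod_R_lt1 x Hx)).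
      assert (E1 : rcpow (- a) (1 - x) = rcpow (- a - 1) (1 - x) * (1 - RtoC x)).
      { rewrite <- RtoC_minus, <- rcpow_S by lra. f_equal. ring. }
      cbv beta. rewrite E1.
      transitivity (rcpow (- a - 1) (1 - x) * ((1 - RtoC x) * psum (dcoef (bcoef (- a))) (RtoC x) - (- a) * binom_fun (- a) (RtoC x))).
      + unfold binom_fun. ring.
      + rewrite B. ring. }
  assert (E : f t = 1).
  { apply (filterlim_C_unique (at_right 0) (fun _ => f t)); [apply filterlim_C_const, _|].
    apply (filterlim_C_ext (at_right 0) f).
    - refine (filter_imp _ _ _ at_right_01). intros x Hx. apply (cder_zero_const f D); assumption.
    - apply (filterlim_C_eq _ _ (1 * 1)); [|ring]. apply filterlim_C_mult; [apply _| |apply rcpow_one_minus_lim].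
      rewrite <- (bcoef_0 (- a)). apply psum_at_right_0, subexp_bcoef. }
  unfold f in E.
  assert (E2 : rcpow (- a) (1 - t) * rcpow a (1 - t) = 1).
  { rewrite <- rcpow_add, <- (rcpow_0 (1 - t)). f_equal. ring. }
  transitivity (binom_fun (- a) (RtoC t) * (rcpow (- a) (1 - t) * rcpow a (1 - t))); [rewrite E2; ring|].
  rewrite Cmult_assoc, E. ring.
Qed.

(** Pfaff's transformation for z = - (1 - t) / t, where 1 - z = 1 / t. *)
Lemma branch_neg_axis (a b c : C) (t : R) : ~ is_nonpos_int c -> (0 < t < 1)%R ->
  branch2F1 a b c (- RtoC ((1 - t) / t)) = rcpow a t * psum (hcoef a (c - b) c) (RtoC (1 - t)).
Proof.
  intros Hc Ht.
  assert (t0 : RtoC t <> 0) by (apply RtoC_neq_0; lra).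
  assert (E : - RtoC ((1 - t) / t) / (- RtoC ((1 - t) / t) - 1) = RtoC (1 - t)).
  { rewrite RtoC_div by lra. rewrite RtoC_minus. field. split; [exact t0|].
    replace (- (1 - RtoC t) - RtoC t) with (RtoC (-1)) by ring.
    apply RtoC_neq_0; lra. }
  rewrite branch_pfaff; [|exact Hc|].
  - rewrite E, binom_fun_real by lra. do 2 f_equal. ring.
  - rewrite re_opp, re_RtoC. assert (0 < (1 - t) / t)%R by (apply Rdiv_lt_0_compat; lra). lra.
Qed.

(** Pfaff's transformation with prefactor exponent a gives the coefficient of the
    first term, and the one with prefactor exponent b gives that of the second;
    linear independence of the two terms shows that the two formulas agree. *)
Lemma connection_neg_axis (a b c : C) : ~ is_nonpos_int c -> ~ is_int (a - b) ->
  exists A B, A * (rGamma c * rGamma (b - a)) = rGamma b * rGamma (c - a) /\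
    B * (rGamma c * rGamma (a - b)) = rGamma a * rGamma (c - b) /\
    forall t : R, (0 < t < 1)%R ->
      branch2F1 a b c (- RtoC ((1 - t) / t)) =
        A * (rcpow a t * psum (hcoef a (c - b) (a - b + 1)) (RtoC t)) +
        B * (rcpow b t * psum (hcoef b (c - a) (b - a + 1)) (RtoC t)).
Proof.
  intros Hc Hab.
  assert (Hba := not_int_swap a b Hab).
  assert (Hs : ~ is_int (c - a - (c - b))) by (replace (c - a - (c - b)) with (b - a) by ring; exact Hba).
  assert (Hs' : ~ is_int (c - b - (c - a))) by (replace (c - b - (c - a)) with (a - b) by ring; exact Hab).
  assert (N1 : ~ is_nonpos_int (a - b + 1)) by (apply not_nonpos_S, Hab).
  assert (N2 : ~ is_nonpos_int (b - a + 1)) by (apply not_nonpos_S, Hba).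
  assert (H := connected_ex a (c - b) c Hc Hs). assert (H' := connected_ex b (c - a) c Hc Hs').
  set (A := connection_coef a (c - b) c) in *. set (A2 := connection_coef2 a (c - b) c) in *.
  set (B := connection_coef b (c - a) c) in *. set (B2 := connection_coef2 b (c - a) c) in *.
  set (GA := fun t : R => psum (hcoef a (c - b) (a - b + 1)) (RtoC t)).
  set (GB := fun t : R => psum (hcoef b (c - a) (b - a + 1)) (RtoC t)).
  assert (V1 : forall t, (0 < t < 1)%R -> y_reg0 a (c - b) c t = GA t).
  { intros t Ht. unfold y_reg0, G_reg0, GA. replace (1 - (c - a - (c - b))) with (a - b + 1) by ring. reflexivity. }
  assert (V2 : forall t, (0 < t < 1)%R -> y_exp0 a (c - b) c t = rcpow (b - a) t * GB t).
  { intros t Ht. unfold y_exp0, G_exp0, GB. replace (c - a - (c - b)) with (b - a) by ring.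
    replace (c - (c - b)) with b by ring. f_equal.
    apply psum_ext; [apply subexp_hcoef, N2|apply Cmod_R_lt1, Ht|apply hcoef_sym]. }
  assert (V1' : forall t, (0 < t < 1)%R -> y_reg0 b (c - a) c t = GB t).
  { intros t Ht. unfold y_reg0, G_reg0, GB. replace (1 - (c - b - (c - a))) with (b - a + 1) by ring. reflexivity. }
  assert (V2' : forall t, (0 < t < 1)%R -> y_exp0 b (c - a) c t = rcpow (a - b) t * GA t).
  { intros t Ht. unfold y_exp0, G_exp0, GA. replace (c - b - (c - a)) with (a - b) by ring.
    replace (c - (c - a)) with a by ring. f_equal.
    apply psum_ext; [apply subexp_hcoef, N1|apply Cmod_R_lt1, Ht|apply hcoef_sym]. }
  assert (Eq1 : forall t, (0 < t < 1)%R -> branch2F1 a b c (- RtoC ((1 - t) / t)) =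
     A * (rcpow a t * GA t) + A2 * (rcpow b t * GB t)).
  { intros t Ht. rewrite branch_neg_axis by assumption. specialize (H t Ht). unfold y_reg1 in H. rewrite H, V1, V2 by exact Ht.
    replace (rcpow b t) with (rcpow a t * rcpow (b - a) t) by (rewrite <- rcpow_add; f_equal; ring). ring. }
  assert (Eq2 : forall t, (0 < t < 1)%R -> branch2F1 a b c (- RtoC ((1 - t) / t)) =
     B2 * (rcpow a t * GA t) + B * (rcpow b t * GB t)).
  { intros t Ht. rewrite branch_sym; [|exact Hc|].
    - rewrite branch_neg_axis by assumption. specialize (H' t Ht). unfold y_reg1 in H'. rewrite H', V1', V2' by exact Ht.
      replace (rcpow a t) with (rcpow b t * rcpow (a - b) t) by (rewrite <- rcpow_add; f_equal; ring). ring.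
    - intros [_ h]. rewrite re_opp, re_RtoC in h.
      assert (0 < (1 - t) / t)%R by (apply Rdiv_lt_0_compat; lra). lra. }
  assert (EB : A2 = B).
  { apply Ceq_minus. apply (connected_indep a (c - b) c (A - B2) (A2 - B) Hs).
    intros t Ht. rewrite V1, V2 by exact Ht.
    assert (E := Eq2 t Ht). rewrite (Eq1 t Ht) in E.
    assert (P := rcpow_neq_0 a t).
    replace (rcpow b t) with (rcpow a t * rcpow (b - a) t) in E by (rewrite <- rcpow_add; f_equal; ring).
    transitivity (/ rcpow a t * (A * (rcpow a t * GA t) + A2 * (rcpow a t * rcpow (b - a) t * GB t) -
       (B2 * (rcpow a t * GA t) + B * (rcpow a t * rcpow (b - a) t * GB t)))); [field; exact P|].
    rewrite E. ring. }
  exists A, B. split; [|split].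
  - assert (V := connection_coef_value a (c - b) c A A2 Hc Hs H).
    replace (c - a - (c - b)) with (b - a) in V by ring. replace (c - (c - b)) with b in V by ring.
    rewrite V. ring.
  - assert (V := connection_coef_value b (c - a) c B B2 Hc Hs' H').
    replace (c - b - (c - a)) with (a - b) in V by ring. replace (c - (c - a)) with a in V by ring.
    rewrite V. ring.
  - intros t Ht. rewrite Eq1 by exact Ht. rewrite EB. reflexivity.
Qed.

(** Pfaff's transformation of the series in z = - 1 / r, which lies in the disc
    and in the half plane Re z < 1/2. *)
Lemma inverse_pfaff (a b c : C) (r : R) : ~ is_nonpos_int (a - b + 1) -> (1 < r)%R ->
  rcpow a (/ (1 + r)) * psum (hcoef a (c - b) (a - b + 1)) (RtoC (/ (1 + r))) =
  rcpow (- a) r * psum (hcoef a (a - c + 1) (a - b + 1)) (- RtoC (/ r)).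
Proof.
  intros HN Hr.
  assert (hr : (0 < / r < 1)%R).
  { apply inv_lt_1. lra. }
  assert (h1 : (0 < / (1 + r) < 1)%R).
  { apply inv_lt_1. lra. }
  rewrite <- (branch_gauss a (a - c + 1) (a - b + 1)); [|exact HN|rewrite Cmod_opp, Cmod_R, Rabs_pos_eq; lra].
  rewrite branch_pfaff; [|exact HN|rewrite re_opp, re_RtoC; lra].
  replace (a - b + 1 - (a - c + 1)) with (c - b) by ring.
  assert (E : - RtoC (/ r) / (- RtoC (/ r) - 1) = RtoC (/ (1 + r))).
  { rewrite !RtoC_inv by lra. rewrite RtoC_plus. 
    assert (n1 : RtoC r <> 0) by (apply RtoC_neq_0; lra).
    assert (n2 : 1 + RtoC r <> 0) by (rewrite <- RtoC_plus; apply RtoC_neq_0; lra).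
    field. repeat split; try assumption.
    intros e. apply n2. match type of e with ?l = _ => replace (1 + RtoC r) with (- l) by ring end.
    rewrite e. ring. }
  rewrite E, binom_fun_real by exact h1. rewrite Cmult_assoc. f_equal.
  replace (/ (1 + r))%R with (/ r * (1 - / (1 + r)))%R at 1 by (field; lra).
  rewrite rcpow_mult_base by lra. f_equal.
  unfold rcpow. rewrite ln_Rinv, RtoC_opp by lra. f_equal. ring.
Qed.

Lemma Cexp_Clog (w : C) : w <> 0 -> Cexp (Clog w) = w.
Proof.
  intros H. assert (h := proj1 (Cmod_gt_0 w) H).
  assert (S := Cmod_mult_self w).
  set (u := (Re w / Cmod w)%R).
  assert (hu : (Re w = Cmod w * u)%R) by (unfold u; field; lra).
  assert (hb : (-1 <= u <= 1)%R).
  { assert (h1 := re_le_Cmod w). unfold u. split; apply (Rmult_le_reg_r (Cmod w)); try lra;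
    unfold Rdiv; rewrite Rmult_assoc, Rinv_l by lra; revert h1; unfold Rabs; destruct Rcase_abs; lra. }
  assert (hs : (Cmod w * sqrt (1 - u²) = Rabs (Im w))%R).
  { rewrite <- (sqrt_Rsqr_abs (Im w)). rewrite <- (sqrt_Rsqr (Cmod w)) at 1 by lra.
    rewrite <- sqrt_mult_alt by apply Rle_0_sqr. f_equal. unfold Rsqr.
    rewrite hu in S. lra. }
  apply C_eq_parts; unfold Cexp, Clog, Carg; simpl; rewrite exp_ln by exact h; fold (Im w); fold u.
  - destruct (Rle_dec 0 (Im w)); rewrite ?cos_neg, cos_acos by exact hb; symmetry; exact hu.
  - destruct (Rle_dec 0 (Im w)) as [hi|hi]; rewrite ?sin_neg, sin_acos by exact hb.
    + rewrite hs. apply Rabs_pos_eq, hi.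
    + rewrite Ropp_mult_distr_r_reverse, hs. rewrite Rabs_left by lra. ring.
Qed.

(** The domain of s = log (-x). *)
Definition strip (s : C) : Prop := (0 < Re s)%R /\ (- PI < Im s < PI)%R.

Lemma strip_cut s : strip s -> cut_plane (- Cexp s).
Proof.
  intros [H1 H2] [E h].
  rewrite im_opp in E. rewrite re_opp in h. 
  change (- (exp (Re s) * sin (Im s)) = 0)%R in E. change (1 <= - (exp (Re s) * cos (Im s)))%R in h.
  assert (he := exp_pos (Re s)).
  assert (hs : sin (Im s) = 0%R).
  { apply (Rmult_eq_reg_l (exp (Re s))); lra. }
  assert (hi : Im s = 0%R).
  { destruct (Rtotal_order (Im s) 0) as [l|[e|g]]; [|exact e|].
    - assert (p := sin_gt_0 (- Im s) ltac:(lra) ltac:(lra)). rewrite sin_neg in p. lra.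
    - assert (p := sin_gt_0 (Im s) g ltac:(lra)). lra. }
  rewrite hi, cos_0 in h. lra.
Qed.

Lemma strip_inv s : strip s -> (Cmod (- Cexp (- s)) < 1)%R.
Proof.
  intros [H1 _]. rewrite Cmod_opp, Cmod_Cexp, re_opp, <- exp_0. apply exp_increasing. lra.
Qed.

Lemma strip_segment s t : strip s -> (0 <= t <= 1)%R -> strip (segment 1 s t).
Proof.
  intros [H1 H2] Ht. unfold segment, strip. unfold Cminus.
  rewrite re_plus, im_plus, re_scal_l, im_scal_l, re_plus, im_plus, re_opp, im_opp. simpl (Re 1). simpl (Im 1).
  assert (P := PI_RGT_0). split; [|split].
  - destruct (Rle_lt_dec (Re s) 1); nra.
  - destruct (Rle_lt_dec (Im s) 0); nra.
  - destruct (Rle_lt_dec (Im s) 0); nra.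
Qed.

Lemma inverse_term_analytic (al : C) (u : nat -> C) (s : C) : subexp u -> strip s ->
  analytic_at (fun s => Cexp (- al * s) * psum u (- Cexp (- s))) s.
Proof.
  intros Hu Hs.
  assert (Hid : forall k, analytic_at (fun s => k * s) s) by (intros k; apply analytic_at_scal, analytic_at_id).
  apply analytic_at_mult.
  - apply (analytic_at_comp Cexp (fun s => - al * s)); [apply Hid|apply analytic_at_Cexp].
  - apply (analytic_at_comp (psum u) (fun s => - Cexp (- s))).
    + apply (analytic_at_ext (fun s => -(1) * Cexp (-(1) * s)) _ s 1); [lra| |].
      * intros w _. replace (-(1) * w) with (- w) by ring. ring.
      * apply analytic_at_scal. apply (analytic_at_comp Cexp (fun s => -(1) * s)); [apply Hid|apply analytic_at_Cexp].
    + apply psum_analytic; [exact Hu|apply strip_inv, Hs].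
Qed.

Lemma Cexp_real (x : R) : Cexp (RtoC x) = RtoC (exp x).
Proof. unfold Cexp, RtoC; simpl. rewrite cos_0, sin_0. f_equal; ring. Qed.

Lemma rcpow_exp (al : C) (x : R) : rcpow al (exp x) = Cexp (al * RtoC x).
Proof. unfold rcpow. rewrite ln_exp. reflexivity. Qed.

(** Both sides are analytic functions of s = log (-x) in the half strip; on its
    real axis x runs over the negative reals below -1, where
    [connection_neg_axis] and [inverse_pfaff] apply. *)
Theorem hyp2F1_inversion (a b c : C) : ~ is_nonpos_int c -> ~ is_int (a - b) ->
  exists A B, A * (rGamma c * rGamma (b - a)) = rGamma b * rGamma (c - a) /\
    B * (rGamma c * rGamma (a - b)) = rGamma a * rGamma (c - b) /\
    forall x, (Rabs (Carg (- x)) < PI)%R -> (1 < Cmod x)%R ->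
      hyp2F1 a b c x =
        A * (Cpower (- x) (- a) * psum (hcoef a (a - c + 1) (a - b + 1)) (/ x)) +
        B * (Cpower (- x) (- b) * psum (hcoef b (b - c + 1) (b - a + 1)) (/ x)).
Proof.
  intros Hc Hab.
  assert (Hba := not_int_swap a b Hab).
  assert (N1 : ~ is_nonpos_int (a - b + 1)) by (apply not_nonpos_S, Hab).
  assert (N2 : ~ is_nonpos_int (b - a + 1)) by (apply not_nonpos_S, Hba).
  destruct (connection_neg_axis a b c Hc Hab) as [A [B [HA [HB H]]]].
  exists A, B. split; [exact HA|split; [exact HB|]].
  set (ua := hcoef a (a - c + 1) (a - b + 1)). set (ub := hcoef b (b - c + 1) (b - a + 1)).
  assert (sa : subexp ua) by apply subexp_hcoef, N1. assert (sb : subexp ub) by apply subexp_hcoef, N2.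
  set (f := fun s => branch2F1 a b c (- Cexp s) - (A * (Cexp (- a * s) * psum ua (- Cexp (- s))) +
     B * (Cexp (- b * s) * psum ub (- Cexp (- s))))).
  assert (Fan : forall s, strip s -> analytic_at f s).
  { intros s Hs. apply analytic_at_minus.
    - apply (analytic_at_comp (branch2F1 a b c) (fun s => - Cexp s)).
      + apply (analytic_at_ext (fun s => -(1) * Cexp s) _ s 1); [lra|intros w _; ring|].
        apply analytic_at_scal, analytic_at_Cexp.
      + apply branch_analytic; [exact Hc|apply strip_cut, Hs].
    - apply analytic_at_plus; apply analytic_at_scal, inverse_term_analytic; assumption. }
  assert (Freal : forall y : R, (0 < y)%R -> f (RtoC y) = 0).
  { intros y Hy. set (r := exp y).
    assert (hr : (1 < r)%R) by (unfold r; rewrite <- exp_0; apply exp_increasing; exact Hy).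
    unfold f. rewrite <- RtoC_opp, !Cexp_real, exp_Ropp. fold r. rewrite <- !rcpow_exp. fold r.
    assert (ht : (0 < / (1 + r) < 1)%R).
    { apply inv_lt_1. lra. }
    assert (E := H _ ht).
    replace ((1 - / (1 + r)) / / (1 + r))%R with r in E by (field; lra).
    rewrite E. unfold ua, ub. rewrite <- !inverse_pfaff by assumption. ring. }
  assert (Fnear : zero_near f 1).
  { apply analytic_zero_near.
    - apply Fan. split; simpl; assert (P := PI_RGT_0); lra.
    - intros eps He. exists (RtoC (1 + eps / 2)). split; [|split].
      + intros E. apply RtoC_inj in E. lra.
      + rewrite <- RtoC_minus, Cmod_R. replace (1 + eps / 2 - 1)%R with (eps / 2)%R by ring. rewrite Rabs_pos_eq; lra.
      + apply Freal. lra. }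
  intros x Harg Hx.
  assert (x0 : x <> 0) by (apply Cmod_gt_0; lra).
  assert (mx0 : - x <> 0).
  { intros E. apply x0. replace x with (- - x) by ring. rewrite E. ring. }
  set (s := Clog (- x)).
  assert (Es : Cexp s = - x) by apply Cexp_Clog, mx0.
  assert (Hs : strip s).
  { split.
    - unfold s, Clog. simpl. rewrite Cmod_opp, <- ln_1. apply ln_increasing; lra.
    - unfold s, Clog. simpl. apply Rabs_def2 in Harg. lra. }
  assert (F0 : f s = 0).
  { apply zero_near_at. apply (identity_segment f 1 s); [|exact Fnear].
    intros t Ht. apply Fan, strip_segment; assumption. }
  assert (Ei : - Cexp (- s) = / x).
  { assert (E : Cexp s * Cexp (- s) = 1).
    { rewrite <- Cexp_plus. replace (s + - s) with (RtoC 0) by ring. apply Cexp_0. }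
    rewrite Es in E. transitivity (/ x * (- x * Cexp (- s))); [field; exact x0|]. rewrite E. ring. }
  unfold f in F0. rewrite Ei in F0. rewrite Es in F0. replace (- - x) with x in F0 by ring.
  apply Ceq_minus in F0.
  rewrite hyp2F1_branch; [|exact Hc|].
  - exact F0.
  - replace x with (- Cexp s) by (rewrite Es; ring). apply strip_cut, Hs.
Qed.

(** * The scaled 1F1 as an entire function *)

Lemma poch_reflect (B : C) k : poch (1 - B) k = (-(1)) ^ k * poch (B - INR k) k.
Proof.
  induction k as [|k IH].
  - simpl. ring.
  - rewrite (poch_S (1 - B)), IH, poch_S_l, Cpow_S, RtoC_INR_S.
    replace (B - (INR k + 1) + 1) with (B - INR k) by ring. ring.
Qed.

Lemma m1_sqr k : (-(1)) ^ k * (-(1)) ^ k = 1.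
Proof. rewrite <- Cpow_mult_l. replace (-(1) * -(1)) with (RtoC 1) by ring. apply Cpow_1_l. Qed.

Lemma poch_rGamma (B : C) k : poch (1 - B) k * rGamma B = (-(1)) ^ k * rGamma (B - INR k).
Proof.
  rewrite (rGamma_poch (B - INR k) k), poch_reflect.
  replace (B - INR k + INR k) with B by ring. ring.
Qed.

Lemma rGamma_locally_bounded (R0 : R) : (0 <= R0)%R -> exists M, (0 < M)%R /\
  forall w, (Cmod w <= R0)%R -> (Cmod (rGamma w) <= M)%R.
Proof.
  intros HR. destruct (euler_gauss_conv R0 HR 1%R ltac:(lra)) as [N HN].
  destruct (euler_gauss_locally_bounded (S N) R0 ltac:(lia)) as [B [HB HBB]].
  exists (B + 1)%R. split; [lra|]. intros w Hw. destruct (HN w Hw) as [_ e].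
  specialize (e (S N) ltac:(lia)). specialize (HBB w Hw).
  replace (rGamma w) with ((rGamma w - euler_gauss (S N) w) + euler_gauss (S N) w) by ring.
  eapply Rle_trans; [apply Cmod_triangle|]. lra.
Qed.

(** 1/Gamma (w + n) decreases faster than every geometric sequence, by the
    functional equation. *)
Lemma rGamma_decay (R0 L : R) : (0 <= R0)%R -> (0 < L)%R -> exists M, (0 < M)%R /\
  forall w n, (Cmod w <= R0)%R -> (Cmod (rGamma (w + INR n)) * L ^ n <= M)%R.
Proof.
  intros HR HL.
  destruct (INR_eventually_ge (R0 + L)) as [N HN].
  destruct (rGamma_locally_bounded (R0 + INR N)) as [M [HM HB]].
  { assert (h := pos_INR N). lra. }
  set (Q := Rmax 1 L).
  assert (Q1 : (1 <= Q)%R) by apply Rmax_l.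
  assert (HQ : (L <= Q)%R) by apply Rmax_r.
  assert (Small : forall w n, (n <= N)%nat -> (Cmod w <= R0)%R -> (Cmod (rGamma (w + INR n)) * L ^ n <= M * Q ^ N)%R).
  { intros w n Hn Hw. apply Rmult_le_compat; [apply Cmod_ge_0|apply pow_le; lra| |].
    - apply HB. eapply Rle_trans; [apply Cmod_triangle|]. rewrite Cmod_R, Rabs_pos_eq by apply pos_INR.
      apply le_INR in Hn. lra.
    - apply Rle_trans with (Q ^ n)%R; [apply pow_incr; lra|apply Rle_pow; [exact Q1|exact Hn]]. }
  exists (M * Q ^ N)%R. split.
  { apply Rmult_lt_0_compat; [exact HM|apply pow_lt; lra]. }
  intros w n Hw. destruct (Nat.le_gt_cases n N) as [h|h]; [apply Small; assumption|].
  induction n as [|n IH]; [lia|].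
  destruct (Nat.eq_dec n N) as [e|ne].
  - subst n. clear IH h. assert (s := Small w N (le_n _) Hw).
    assert (hn := HN N (le_n _)). assert (g := Cmod_plus_INR_ge w N).
    assert (E := f_equal Cmod (rGamma_S (w + INR N))). rewrite Cmod_mult in E.
    rewrite RtoC_INR_S, Cplus_assoc. eapply Rle_trans; [|exact s]. rewrite E. simpl.
    assert (p := pow_le L N ltac:(lra)). assert (q := Cmod_ge_0 (rGamma (w + INR N + 1))).
    rewrite <- Rmult_assoc. apply Rmult_le_compat_r; [exact p|]. rewrite Rmult_comm. apply Rmult_le_compat_r; lra.
  - assert (s := IH ltac:(lia)).
    assert (hn := HN n ltac:(lia)). assert (g := Cmod_plus_INR_ge w n).
    assert (E := f_equal Cmod (rGamma_S (w + INR n))). rewrite Cmod_mult in E.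
    rewrite RtoC_INR_S, Cplus_assoc. eapply Rle_trans; [|exact s]. rewrite E. simpl.
    assert (p := pow_le L n ltac:(lra)). assert (q := Cmod_ge_0 (rGamma (w + INR n + 1))).
    rewrite <- Rmult_assoc. apply Rmult_le_compat_r; [exact p|]. rewrite Rmult_comm. apply Rmult_le_compat_r; lra.
Qed.

(** The terms of 1F1[A; w; z] / Gamma (w), which make sense for every w. *)
Definition reg_term (A z w : C) (m : nat) : C := bcoef A m * rGamma (w + INR m) * z ^ m.

Lemma reg_bound (A z : C) (R0 : R) : (0 <= R0)%R -> exists M : nat -> R, ex_series M /\
  forall w m, (Cmod w <= R0)%R -> (Cmod (reg_term A z w m) <= M m)%R.
Proof.
  intros HR. assert (hz := Cmod_ge_0 z).
  (* The factor 4 outweighs the bound 2^m on the binomial coefficients. *)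
  destruct (rGamma_decay R0 (4 * (Cmod z + 1)) HR ltac:(lra)) as [M [HM HB]].
  destruct (subexp_bcoef A 2%R ltac:(lra)) as [M' [HM' HB']].
  exists (fun m => M' * M * (1 / 2) ^ m)%R. split.
  - apply ex_series_geom_scal. lra.
  - intros w m Hw. unfold reg_term. rewrite !Cmod_mult, Cmod_pow.
    specialize (HB w m Hw). specialize (HB' m).
    set (L := (4 * (Cmod z + 1))%R) in *.
    assert (pL : (0 < L ^ m)%R) by (apply pow_lt; unfold L; lra).
    assert (G := Cmod_ge_0 (rGamma (w + INR m))).
    assert (p2 : (0 <= 2 ^ m)%R) by (apply pow_le; lra).
    assert (pz : (Cmod z ^ m <= (L / 4) ^ m)%R) by (apply pow_incr; unfold L; lra).
    assert (pz0 := pow_le (Cmod z) m hz).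
    apply Rle_trans with (M' * 2 ^ m * Cmod (rGamma (w + INR m)) * (L / 4) ^ m)%R.
    + apply Rmult_le_compat; [apply Rmult_le_pos; [apply Cmod_ge_0|exact G]|exact pz0| |exact pz].
      apply Rmult_le_compat_r; [exact G|exact HB'].
    + unfold Rdiv. rewrite !Rpow_mult_distr, pow1.
      replace ((/ 4) ^ m)%R with ((/ 2) ^ m * (/ 2) ^ m)%R by (rewrite <- Rpow_mult_distr; f_equal; field).
      assert (E2 : (2 ^ m * (/ 2) ^ m = 1)%R) by (rewrite <- Rpow_mult_distr; replace (2 * / 2)%R with 1%R by field; apply pow1).
      assert (ph : (0 < (/ 2) ^ m)%R) by (apply pow_lt; lra).
      replace (M' * 2 ^ m * Cmod (rGamma (w + INR m)) * (L ^ m * ((/ 2) ^ m * (/ 2) ^ m)))%R with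
        (M' * (Cmod (rGamma (w + INR m)) * L ^ m) * (/ 2) ^ m * (2 ^ m * (/ 2) ^ m))%R by ring.
      rewrite E2, Rmult_1_r, Rmult_1_l. apply Rmult_le_compat_r; [lra|].
      apply Rmult_le_compat_l; [lra|exact HB].
Qed.

Lemma reg_summable (A z w : C) : abs_summable (reg_term A z w).
Proof.
  destruct (reg_bound A z (Cmod w) (Cmod_ge_0 w)) as [M [HM HB]].
  apply abs_summable_le with M; [|exact HM]. intros m. apply HB. lra.
Qed.

Lemma scaled1F1_raw_nonint (k : nat) (A z B : C) : ~ is_int B ->
  scaled1F1_raw k A z B = (-(1)) ^ k * Csum (reg_term A z (B - INR k)).
Proof.
  intros HB. unfold scaled1F1_raw. rewrite poch_rGamma.
  assert (HBk : ~ is_nonpos_int (B - INR k)).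
  { apply not_int_not_nonpos, not_int_minus_nat, HB. }
  assert (E : is_series (fun m => poch A m / poch (B - INR k) m * (z ^ m / INR (fact m)))
     (Csum (reg_term A z (B - INR k)) / rGamma (B - INR k))).
  { assert (N := rGamma_neq_0 _ HBk).
    replace (Csum (reg_term A z (B - INR k)) / rGamma (B - INR k)) with
      (/ rGamma (B - INR k) * Csum (reg_term A z (B - INR k))) by (unfold Cdiv; ring).
    eapply is_series_C_ext; [|apply is_series_C_scal, abs_summable_is, reg_summable].
    intros m. cbv beta. unfold reg_term, bcoef.
    assert (P := rGamma_poch (B - INR k) m). assert (p := poch_neq_0 (B - INR k) m HBk).
    rewrite P.
    assert (N' : rGamma (B - INR k + INR m) <> 0).
    { intros e. apply N. rewrite P, e. ring. }
    field. nz. }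
  unfold hyp1F1. rewrite (Csum_unique _ _ E).
  assert (N := rGamma_neq_0 _ HBk). field. exact N.
Qed.

Lemma locally'_proper (z : C) : ProperFilter (locally' z).
Proof.
  split.
  - intros P HP. unfold locally', within in HP.
    destruct HP as [d Hd]. exists (z + RtoC (d / 2)).
    assert (hd := cond_pos d).
    apply Hd.
    + split; simpl.
      * change (Rabs (Re z + d / 2 - Re z) < d)%R. replace (Re z + d / 2 - Re z)%R with (d / 2)%R by ring.
        rewrite Rabs_pos_eq; lra.
      * change (Rabs (Im z + 0 - Im z) < d)%R. replace (Im z + 0 - Im z)%R with 0%R by ring.
        rewrite Rabs_R0; lra.
    + intros E. assert (E2 : RtoC (d / 2) = 0).
      { replace (RtoC (d / 2)) with ((z + RtoC (d / 2)) - z) by ring. rewrite E. ring. }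
      apply RtoC_inj in E2. lra.
  - apply within_filter. apply locally_filter.
Qed.

Lemma locally'_dist (z : C) (d : R) : (0 < d)%R ->
  locally' z (fun w : C => w <> z /\ (Cmod (w - z) < d)%R).
Proof.
  intros Hd. unfold locally', within.
  assert (D2 := proj1 (filterlim_C_iff (locally z) (fun w => w) z) (fun P H => H) d Hd).
  refine (filter_imp (fun w : C => _) (fun w : C => _) _ D2). intros w h1 h2. split; assumption.
Qed.

Lemma int_isolated (z w : C) : is_int z -> w <> z -> (Cmod (w - z) < 1)%R -> ~ is_int w.
Proof.
  intros [n Hn] Hne Hd [m Hm]. apply Hne. rewrite Hn, Hm in *.
  rewrite <- RtoC_minus, <- minus_IZR, Cmod_R, <- abs_IZR in Hd. apply lt_IZR in Hd.
  replace m with n by lia. reflexivity.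
Qed.

(** Off the integers this is the functional equation of Gamma.  At an integer,
    the series is dominated uniformly near B and its terms are continuous, so
    the limit may be taken termwise. *)
Lemma scaled1F1_eq (k : nat) (A z B : C) :
  scaled1F1 k A z B = (-(1)) ^ k * Csum (reg_term A z (B - INR k)).
Proof.
  unfold scaled1F1, Ciota.
  assert (PF := locally'_proper B).
  destruct (Classical_Prop.classic (is_int B)) as [HB|HB].
  - assert (L : filterlim (scaled1F1_raw k A z) (locally' B)
        (locally ((-(1)) ^ k * Csum (reg_term A z (B - INR k))))).
    { apply (filterlim_C_ext (locally' B) (fun w => (-(1)) ^ k * Csum (reg_term A z (w - INR k)))).
      - refine (filter_imp (fun w : C => _) (fun w : C => _) _ (locally'_dist B 1 Rlt_0_1)).
        intros w [h1 h2]. symmetry. apply scaled1F1_raw_nonint. apply (int_isolated B); assumption.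
      - apply filterlim_C_mult; [apply _|apply filterlim_C_const, _|].
        destruct (reg_bound A z (Cmod (B - INR k) + 1)) as [M [HM HMB]].
        { assert (h := Cmod_ge_0 (B - INR k)). lra. }
        apply (tannery (locally' B) (fun w m => reg_term A z (w - INR k) m) (reg_term A z (B - INR k)) M).
        + exact HM.
        + refine (filter_imp (fun w : C => _) (fun w : C => _) _ (locally'_dist B 1 Rlt_0_1)).
          intros w [h1 h2] m. apply HMB.
          replace (w - INR k) with ((w - B) + (B - INR k)) by ring.
          eapply Rle_trans; [apply Cmod_triangle|]. lra.
        + intros m. unfold reg_term.
          apply filterlim_C_mult; [apply _| |apply filterlim_C_const, _].
          apply filterlim_C_mult; [apply _|apply filterlim_C_const, _|].
          apply (filterlim_comp _ _ _ (fun w : C => w - INR k + INR m) rGamma (locally' B) (locally (B - INR k + INR m)));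
            [|apply rGamma_continuous].
          apply (filterlim_C_iff (locally' B)). intros eps He.
          refine (filter_imp (fun w : C => _) (fun w : C => _) _ (locally'_dist B eps He)).
          intros w [h1 h2]. replace (w - INR k + INR m - (B - INR k + INR m)) with (w - B) by ring. exact h2.
        + apply filter_forall. intros w. apply abs_summable_is, reg_summable.
        + apply abs_summable_is, reg_summable. }
    apply (@iota_unique C_AbsRing C_CompleteNormedModule).
    + intros v [_ Hv]. specialize (Hv HB). apply (filterlim_C_unique (locally' B) (scaled1F1_raw k A z)); assumption.
    + split; [intros h; contradiction|intros _; exact L].
  - apply (@iota_unique C_AbsRing C_CompleteNormedModule).
    + intros v [Hv _]. rewrite (Hv HB). apply scaled1F1_raw_nonint, HB.
    + split; [intros _; symmetry; apply scaled1F1_raw_nonint, HB|intros h; contradiction].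
Qed.

Lemma rGamma_quot_up (al be : C) : ~ is_int be -> subexp (fun n => rGamma (al + INR n) / rGamma (be + INR n)).
Proof.
  intros Hbe. apply subexp_ratio. intros e He.
  destruct (ratio_eventually be al e He) as [N1 HN1].
  destruct (INR_eventually_ge (Cmod al + 1)) as [N2 HN2].
  exists (max N1 N2). intros n Hn. specialize (HN1 n ltac:(lia)). specialize (HN2 n ltac:(lia)).
  assert (g := Cmod_plus_INR_ge al n).
  assert (N0 : al + INR n <> 0) by (apply Cmod_gt_0; lra).
  assert (Hb : ~ is_nonpos_int (be + INR n)) by (apply not_int_not_nonpos, not_int_plus_nat, Hbe).
  assert (G := rGamma_neq_0 _ Hb). assert (G1 := rGamma_neq_0 _ (nonpos_int_S _ Hb)).
  assert (B0 := nonpos_int_neq_0 _ Hb).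
  rewrite !RtoC_INR_S, !Cplus_assoc.
  assert (Ea := rGamma_S (al + INR n)). assert (Eb := rGamma_S (be + INR n)).
  replace (rGamma (al + INR n + 1) / rGamma (be + INR n + 1)) with
    ((be + INR n) / (al + INR n) * (rGamma (al + INR n) / rGamma (be + INR n))).
  2:{ rewrite Ea, Eb. field. nz. }
  rewrite Cmod_mult. apply Rmult_le_compat_r; [apply Cmod_ge_0|].
  rewrite Cmod_div by exact N0. assert (p := proj1 (Cmod_gt_0 _) N0).
  apply (Rmult_le_reg_r (Cmod (al + INR n))); [exact p|].
  unfold Rdiv. rewrite Rmult_assoc, Rinv_l by lra. lra.
Qed.

Lemma rGamma_quot_down (al be : C) : ~ is_int be -> subexp (fun n => rGamma (al - INR n) / rGamma (be - INR n)).
Proof.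
  intros Hbe.
  assert (Hb : ~ is_nonpos_int (1 - be)).
  { apply not_nonpos_1_minus, Hbe. }
  assert (G := rGamma_neq_0 _ (not_int_not_nonpos _ Hbe)).
  eapply subexp_ext; [|apply subexp_mult; [apply (subexp_poch_ratio (1 - al) (1 - be) Hb)|apply (subexp_const (rGamma al / rGamma be))]].
  intros n. cbv beta.
  assert (E1 := poch_rGamma al n). assert (E2 := poch_rGamma be n).
  assert (M1 := m1_sqr n). assert (p := poch_neq_0 (1 - be) n Hb).
  assert (m0 : (-(1)) ^ n <> 0).
  { intros e. apply C1_nz. rewrite <- M1, e. ring. }
  assert (F : forall w, rGamma (w - INR n) = (-(1)) ^ n * (poch (1 - w) n * rGamma w)).
  { intros w. rewrite poch_rGamma, Cmult_assoc, M1. ring. }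
  rewrite !F. field. nz.
Qed.

(** The quotient depends on n - k alone; it grows subexponentially in both
    directions. *)
Lemma rGamma_quot_bound (al be : C) (q : R) : ~ is_int be -> (1 < q)%R -> exists M, (0 < M)%R /\
  forall n k : nat, (Cmod (rGamma (al - INR k + INR n) / rGamma (be - INR k + INR n)) <= M * (q ^ n * q ^ k))%R.
Proof.
  intros Hbe Hq.
  destruct (rGamma_quot_up al be Hbe q Hq) as [M1 [HM1 H1]].
  destruct (rGamma_quot_down al be Hbe q Hq) as [M2 [HM2 H2]].
  exists (M1 + M2)%R. split; [lra|]. intros n k.
  assert (p1 := pow_R1_Rle q n ltac:(lra)). assert (p2 := pow_R1_Rle q k ltac:(lra)).
  destruct (Nat.le_gt_cases k n) as [h|h].
  - replace (al - INR k + INR n) with (al + INR (n - k)) by (rewrite minus_INR, RtoC_minus by exact h; ring).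
    replace (be - INR k + INR n) with (be + INR (n - k)) by (rewrite minus_INR, RtoC_minus by exact h; ring).
    eapply Rle_trans; [apply H1|].
    assert (p3 : (q ^ (n - k) <= q ^ n)%R) by (apply Rle_pow; [lra|lia]).
    assert (p4 : (0 < q ^ (n - k))%R) by (apply pow_lt; lra).
    apply Rmult_le_compat; [lra|lra|lra|]. nra.
  - replace (al - INR k + INR n) with (al - INR (k - n)) by (rewrite minus_INR, RtoC_minus by lia; ring).
    replace (be - INR k + INR n) with (be - INR (k - n)) by (rewrite minus_INR, RtoC_minus by lia; ring).
    eapply Rle_trans; [apply H2|].
    assert (p3 : (q ^ (k - n) <= q ^ k)%R) by (apply Rle_pow; [lra|lia]).
    assert (p4 : (0 < q ^ (k - n))%R) by (apply pow_lt; lra).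
    apply Rmult_le_compat; [lra|lra|lra|]. nra.
Qed.

Lemma ex_series_exp (M r : R) : (0 <= r)%R -> ex_series (fun n => M * (r ^ n / INR (fact n)))%R.
Proof.
  intros Hr. apply (ex_series_scal M (fun n => r ^ n / INR (fact n))%R).
  assert (H := subexp_ecoef (RtoC (2 * r))).
  assert (A := subexp_summable _ (RtoC (1/2)) H ltac:(rewrite Cmod_R, Rabs_pos_eq; lra)).
  eapply ex_series_ext; [|exact A]. intros n. cbv beta. unfold ecoef.
  assert (f := INR_fact_lt_0 n).
  rewrite Cmod_mult, Cmod_div, !Cmod_pow, !Cmod_R by apply fact_neq_0C.
  rewrite !Rabs_pos_eq by lra.
  unfold Rdiv. rewrite !Rpow_mult_distr.
  assert (E2 : (2 ^ n * (/ 2) ^ n = 1)%R) by (rewrite <- Rpow_mult_distr; replace (2 * / 2)%R with 1%R by field; apply pow1).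
  rewrite pow1, Rmult_1_l.
  transitivity (r ^ n * / INR (fact n) * (2 ^ n * (/ 2) ^ n))%R; [rring|rewrite E2; rring].
Qed.

Lemma Cpower_shift (x a : C) n : x <> 0 -> Cpower (- x) (- (a + INR n)) = Cpower (- x) (- a) * ((-(1)) ^ n * (/ x) ^ n).
Proof.
  intros Hx.
  assert (mx0 : - x <> 0).
  { intros E. apply Hx. replace x with (- - x) by ring. rewrite E. ring. }
  induction n as [|n IH].
  - simpl. rewrite Cplus_0_r. ring.
  - assert (E : Cpower (- x) (- (a + INR (S n))) * (- x) = Cpower (- x) (- (a + INR n))).
    { unfold Cpower. rewrite <- (Cexp_Clog (- x)) at 2 by exact mx0. rewrite <- Cexp_plus. f_equal.
      rewrite RtoC_INR_S. ring. }
    rewrite IH in E.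
    transitivity (Cpower (- x) (- (a + INR (S n))) * (- x) * (- / x)); [field; exact Hx|].
    rewrite E, !Cpow_S. ring.
Qed.

(** * Rearranging the double series *)

(** The n-th row is the first term of the inversion formula for
    2F1[a+n, b; c+n; x], with X = 1/x. *)
Definition double1 (a b c X y : C) (n j : nat) : C :=
  y ^ n / INR (fact n) * (poch a (n + j) / poch (a - b + 1) (n + j)) * X ^ (n + j) * bcoef (a - c + 1) j * rGamma (c - a).

(** The n-th row is the second term of the inversion formula for
    2F1[a+n, b; c+n; x].  The Gamma quotient replaces (a-b-k)_n so that rows and
    columns can be bounded together. *)
Definition double2 (a b c X y : C) (n k : nat) : C :=
  y ^ n / INR (fact n) * bcoef b k * X ^ k *
  (rGamma (a - b) * (rGamma (c - b - INR k + INR n) / rGamma (a - b - INR k + INR n))).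

(** A rate q > 1 that leaves room for the two factors q^k produced by the
    coefficients of each double series. *)
Lemma exists_growth_rate (r : R) : (0 <= r < 1)%R -> exists q, (1 < q)%R /\ (q * q * r < 1)%R.
Proof.
  intros Hr. destruct (sqrt_gt_1 (2 / (1 + r))) as [h1 h2].
  { apply (Rmult_lt_reg_r (1 + r)); [lra|]. unfold Rdiv. rewrite Rmult_assoc, Rinv_l; lra. }
  exists (sqrt (2 / (1 + r))). split; [exact h1|]. rewrite h2.
  apply (Rmult_lt_reg_r (1 + r)); [lra|]. replace (2 / (1 + r) * r * (1 + r))%R with (2 * r)%R by (field; lra). lra.
Qed.

Lemma double1_summable (a b c X y : C) : ~ is_int (a - b) -> (Cmod X < 1)%R ->
  (forall n, abs_summable (double1 a b c X y n)) /\
  ex_series (fun n => Series (fun j => Cmod (double1 a b c X y n j))).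
Proof.
  intros Hab HX. assert (hX := Cmod_ge_0 X). assert (hy := Cmod_ge_0 y).
  assert (N1 : ~ is_nonpos_int (a - b + 1)) by (apply not_nonpos_S, Hab).
  destruct (exists_growth_rate (Cmod X) ltac:(lra)) as [q [Hq1 Hq2]].
  destruct (subexp_poch_ratio a (a - b + 1) N1 q Hq1) as [M1 [HM1 H1]].
  destruct (subexp_bcoef (a - c + 1) q Hq1) as [M2 [HM2 H2]].
  set (G := Cmod (rGamma (c - a))). assert (hG : (0 <= G)%R) by apply Cmod_ge_0.
  set (r := (q * Cmod X * Cmod y)%R).
  assert (hr : (0 <= r)%R) by (unfold r; apply Rmult_le_pos; [nra|exact hy]).
  apply (product_bound_summable (double1 a b c X y) (fun n => M1 * M2 * G * (r ^ n / INR (fact n)))%R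
     (fun j => (q * q * Cmod X) ^ j)%R).
  - intros n j. unfold double1. rewrite !Cmod_mult, !Cmod_pow. fold G.
    rewrite Cmod_div by apply fact_neq_0C. rewrite Cmod_R, Cmod_pow.
    assert (f := INR_fact_lt_0 n). rewrite (Rabs_pos_eq (INR (fact n))) by lra.
    specialize (H1 (n + j)%nat). specialize (H2 j).
    apply Rle_trans with (Cmod y ^ n / INR (fact n) * (M1 * q ^ (n + j)) * Cmod X ^ (n + j) * (M2 * q ^ j) * G)%R.
    + assert (p1 : (0 <= Cmod y ^ n / INR (fact n))%R).
      { apply Rmult_le_pos; [apply pow_le, hy|left; apply Rinv_0_lt_compat; lra]. }
      assert (p2 := pow_le (Cmod X) (n + j) hX).
      apply Rmult_le_compat_r; [exact hG|].
      apply Rmult_le_compat; [|apply Cmod_ge_0| |exact H2].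
      * apply Rmult_le_pos; [apply Rmult_le_pos; [exact p1|apply Cmod_ge_0]|exact p2].
      * apply Rmult_le_compat_r; [exact p2|]. apply Rmult_le_compat_l; [exact p1|exact H1].
    + right. unfold r. rewrite !pow_add, !Rpow_mult_distr. unfold Rdiv. ring.
  - intros n. assert (f := INR_fact_lt_0 n). apply Rmult_le_pos; [apply Rmult_le_pos; [nra|exact hG]|].
    apply Rmult_le_pos; [apply pow_le, hr|left; apply Rinv_0_lt_compat; lra].
  - intros j. apply pow_le. apply Rmult_le_pos; [nra|exact hX].
  - apply ex_series_exp, hr.
  - apply ex_series_geom. rewrite Rabs_pos_eq; [exact Hq2|]. apply Rmult_le_pos; [nra|exact hX].
Qed.

Lemma double2_summable (a b c X y : C) : ~ is_int (a - b) -> (Cmod X < 1)%R ->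
  (forall n, abs_summable (double2 a b c X y n)) /\
  ex_series (fun n => Series (fun j => Cmod (double2 a b c X y n j))).
Proof.
  intros Hab HX. assert (hX := Cmod_ge_0 X). assert (hy := Cmod_ge_0 y).
  destruct (exists_growth_rate (Cmod X) ltac:(lra)) as [q [Hq1 Hq2]].
  destruct (rGamma_quot_bound (c - b) (a - b) q Hab Hq1) as [M1 [HM1 H1]].
  destruct (subexp_bcoef b q Hq1) as [M2 [HM2 H2]].
  set (G := Cmod (rGamma (a - b))). assert (hG : (0 <= G)%R) by apply Cmod_ge_0.
  set (r := (q * Cmod y)%R).
  assert (hr : (0 <= r)%R) by (unfold r; nra).
  apply (product_bound_summable (double2 a b c X y) (fun n => M1 * M2 * G * (r ^ n / INR (fact n)))%R
     (fun j => (q * q * Cmod X) ^ j)%R).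
  - intros n k. unfold double2. rewrite !Cmod_mult, !Cmod_pow. fold G.
    rewrite (Cmod_div (y ^ n)) by apply fact_neq_0C. rewrite Cmod_R, Cmod_pow.
    assert (f := INR_fact_lt_0 n). rewrite (Rabs_pos_eq (INR (fact n))) by lra.
    specialize (H1 n k). specialize (H2 k).
    apply Rle_trans with (Cmod y ^ n / INR (fact n) * (M2 * q ^ k) * Cmod X ^ k * (G * (M1 * (q ^ n * q ^ k))))%R.
    + assert (p1 : (0 <= Cmod y ^ n / INR (fact n))%R).
      { apply Rmult_le_pos; [apply pow_le, hy|left; apply Rinv_0_lt_compat; lra]. }
      assert (p2 := pow_le (Cmod X) k hX).
      apply Rmult_le_compat.
      * apply Rmult_le_pos; [apply Rmult_le_pos; [exact p1|apply Cmod_ge_0]|exact p2].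
      * apply Rmult_le_pos; [exact hG|apply Cmod_ge_0].
      * apply Rmult_le_compat_r; [exact p2|]. apply Rmult_le_compat_l; [exact p1|exact H2].
      * apply Rmult_le_compat_l; [exact hG|exact H1].
    + right. unfold r. rewrite !Rpow_mult_distr. unfold Rdiv. ring.
  - intros n. assert (f := INR_fact_lt_0 n). apply Rmult_le_pos; [apply Rmult_le_pos; [nra|exact hG]|].
    apply Rmult_le_pos; [apply pow_le, hr|left; apply Rinv_0_lt_compat; lra].
  - intros j. apply pow_le. apply Rmult_le_pos; [nra|exact hX].
  - apply ex_series_exp, hr.
  - apply ex_series_geom. rewrite Rabs_pos_eq; [exact Hq2|]. apply Rmult_le_pos; [nra|exact hX].
Qed.

Lemma m1_neq_0 k : (-(1)) ^ k <> 0.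
Proof. intros e. apply C1_nz. rewrite <- (m1_sqr k), e. ring. Qed.

Lemma double1_diag (a b c X y : C) (k : nat) : ~ is_int (a - b) ->
  sum_n (fun n => double1 a b c X y n (k - n)) k =
  scaled1F1 k (- INR k) y (c - a) * (poch a k / poch (a - b + 1) k) * (X ^ k / INR (fact k)).
Proof.
  intros Hab.
  assert (N1 : ~ is_nonpos_int (a - b + 1)) by (apply not_nonpos_S, Hab).
  rewrite scaled1F1_eq.
  assert (E : Csum (reg_term (- INR k) y (c - a - INR k)) = sum_n (reg_term (- INR k) y (c - a - INR k)) k).
  { apply Csum_unique, is_series_finite. intros n Hn. unfold reg_term, bcoef.
    rewrite poch_neg_nat_0 by exact Hn. unfold Cdiv. cring. }
  rewrite E.
  transitivity (((-(1)) ^ k * (poch a k / poch (a - b + 1) k) * (X ^ k / INR (fact k))) *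
      sum_n (reg_term (- INR k) y (c - a - INR k)) k); [|cring].
  rewrite <- sum_n_scal_l_C. apply sum_n_ext_loc_C. intros n Hn.
  unfold double1, reg_term, bcoef.
  replace (n + (k - n))%nat with k by lia.
  assert (P := poch_neg_nat k n Hn).
  assert (F1 := fact_neq_0C k). assert (F2 := fact_neq_0C n). assert (F3 := fact_neq_0C (k - n)).
  assert (p := poch_neq_0 (a - b + 1) k N1).
  replace (poch (- INR k) n) with ((-(1)) ^ n * INR (fact k) / INR (fact (k - n))) by (rewrite <- P; field; exact F3).
  assert (Q := poch_rGamma (c - a) (k - n)).
  replace (1 - (c - a)) with (a - c + 1) in Q by ring.
  replace (c - a - INR (k - n)) with (c - a - INR k + INR n) in Q by (rewrite minus_INR, RtoC_minus by exact Hn; ring).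
  transitivity (y ^ n / INR (fact n) * (poch a k / poch (a - b + 1) k) * X ^ k * / INR (fact (k - n)) *
     (poch (a - c + 1) (k - n) * rGamma (c - a))); [field; nz|].
  rewrite Q.
  replace ((-(1)) ^ (k - n)) with ((-(1)) ^ k * (-(1)) ^ n).
  - field. nz.
  - replace ((-(1)) ^ k) with ((-(1)) ^ (k - n) * (-(1)) ^ n) by (rewrite <- Cpow_add_r; f_equal; lia).
    rewrite <- Cmult_assoc, m1_sqr. ring.
Qed.

Lemma double2_col (a b c X y : C) (k : nat) : ~ is_int (a - b) ->
  is_series (fun n => double2 a b c X y n k)
   (scaled1F1 k (a - b - INR k) y (c - b) * (poch b k / poch (b - a + 1) k) * (X ^ k / INR (fact k))).
Proof.
  intros Hab.
  assert (Hba := not_int_swap a b Hab).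
  assert (N2 : ~ is_nonpos_int (b - a + 1)) by (apply not_nonpos_S, Hba).
  rewrite scaled1F1_eq.
  replace ((-(1)) ^ k * Csum (reg_term (a - b - INR k) y (c - b - INR k)) * (poch b k / poch (b - a + 1) k) * (X ^ k / INR (fact k)))
   with (((-(1)) ^ k * (poch b k / poch (b - a + 1) k) * (X ^ k / INR (fact k))) * Csum (reg_term (a - b - INR k) y (c - b - INR k))) by ring.
  eapply is_series_C_ext; [|apply is_series_C_scal, abs_summable_is, reg_summable].
  intros n. cbv beta. unfold double2, reg_term, bcoef.
  assert (Hn : ~ is_int (a - b - INR k + INR n)).
  { apply not_int_plus_nat, not_int_minus_nat, Hab. }
  assert (G := rGamma_neq_0 _ (not_int_not_nonpos _ Hn)).
  assert (P := rGamma_poch (a - b - INR k) n).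
  assert (Q := poch_rGamma (a - b) k). replace (1 - (a - b)) with (b - a + 1) in Q by ring.
  assert (p := poch_neq_0 (b - a + 1) k N2). assert (F1 := fact_neq_0C k). assert (F2 := fact_neq_0C n).
  replace (poch (a - b - INR k) n) with (rGamma (a - b - INR k) / rGamma (a - b - INR k + INR n)) by (rewrite P; field; exact G).
  replace (rGamma (a - b - INR k)) with ((-(1)) ^ k * (poch (b - a + 1) k * rGamma (a - b))).
  2:{ rewrite Q, Cmult_assoc, m1_sqr. ring. }
  transitivity (((-(1)) ^ k * (-(1)) ^ k) * (poch b k * X ^ k * y ^ n * rGamma (a - b) * rGamma (c - b - INR k + INR n) /
     (INR (fact k) * INR (fact n) * rGamma (a - b - INR k + INR n)))); [field; nz|].
  rewrite m1_sqr. field. nz.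
Qed.

Lemma double1_row (a b c X y : C) (n : nat) : ~ is_int (a - b) -> (Cmod X < 1)%R ->
  is_series (double1 a b c X y n)
    (y ^ n / INR (fact n) * (poch a n / poch (a - b + 1) n) * X ^ n * rGamma (c - a) *
     psum (hcoef (a + INR n) (a - c + 1) (a + INR n - b + 1)) X).
Proof.
  intros Hab HX.
  assert (N1 : ~ is_nonpos_int (a - b + 1)) by (apply not_nonpos_S, Hab).
  assert (Nn : ~ is_nonpos_int (a + INR n - b + 1)).
  { apply not_nonpos_S. replace (a + INR n - b) with (a - b + INR n) by ring.
    apply not_int_plus_nat, Hab. }
  eapply is_series_C_ext; [|apply is_series_C_scal, psum_is; [apply subexp_hcoef, Nn|exact HX]].
  intros j. cbv beta. unfold double1, hcoef, bcoef.
  rewrite !poch_add. replace (a - b + 1 + INR n) with (a + INR n - b + 1) by ring.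
  rewrite Cpow_add_r.
  assert (p1 := poch_neq_0 _ n N1). assert (p2 := poch_neq_0 _ j Nn).
  field. nz.
Qed.

Lemma double2_row (a b c X y : C) (n : nat) : ~ is_int (a - b) -> (Cmod X < 1)%R ->
  is_series (double2 a b c X y n)
    (y ^ n / INR (fact n) * (rGamma (a - b) * rGamma (c + INR n - b) / rGamma (a + INR n - b)) *
     psum (hcoef b (b - (c + INR n) + 1) (b - (a + INR n) + 1)) X).
Proof.
  intros Hab HX.
  assert (Han : ~ is_int (a + INR n - b)).
  { replace (a + INR n - b) with (a - b + INR n) by ring. apply not_int_plus_nat, Hab. }
  assert (Nn : ~ is_nonpos_int (b - (a + INR n) + 1)).
  { apply not_nonpos_S, not_int_swap, Han. }
  assert (Gn := rGamma_neq_0 _ (not_int_not_nonpos _ Han)).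
  eapply is_series_C_ext; [|apply is_series_C_scal, psum_is; [apply subexp_hcoef, Nn|exact HX]].
  intros k. cbv beta. unfold double2, hcoef, bcoef.
  assert (Q1 := poch_rGamma (c + INR n - b) k). assert (Q2 := poch_rGamma (a + INR n - b) k).
  replace (1 - (c + INR n - b)) with (b - (c + INR n) + 1) in Q1 by ring.
  replace (1 - (a + INR n - b)) with (b - (a + INR n) + 1) in Q2 by ring.
  replace (c - b - INR k + INR n) with (c + INR n - b - INR k) by ring.
  replace (a - b - INR k + INR n) with (a + INR n - b - INR k) by ring.
  assert (p := poch_neq_0 _ k Nn). assert (m0 := m1_neq_0 k).
  replace (rGamma (c + INR n - b - INR k)) with ((-(1)) ^ k * (poch (b - (c + INR n) + 1) k * rGamma (c + INR n - b))).
  2:{ rewrite Q1, Cmult_assoc, m1_sqr. ring. }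
  replace (rGamma (a + INR n - b - INR k)) with ((-(1)) ^ k * (poch (b - (a + INR n) + 1) k * rGamma (a + INR n - b))).
  2:{ rewrite Q2, Cmult_assoc, m1_sqr. ring. }
  field. nz.
Qed.

(** The factors depending on n in the connection coefficients are absorbed by
    (a)_n / (c)_n through the functional equation of Gamma. *)
Lemma Phi1_term_rows (a b c x y : C) (n : nat) :
  ~ is_nonpos_int c -> ~ is_int (a - b) -> (Rabs (Carg (- x)) < PI)%R -> (1 < Cmod x)%R ->
  Phi1_term a b c x y n =
    Gamma c * Gamma (b - a) * rGamma b * Cpower (- x) (- a) * Csum (double1 a b c (/ x) y n) +
    Gamma c * Gamma (a - b) * rGamma a * Cpower (- x) (- b) * Csum (double2 a b c (/ x) y n).
Proof.
  intros Hc Hab Harg Hx.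
  assert (x0 : x <> 0) by (apply Cmod_gt_0; lra).
  assert (HX : (Cmod (/ x) < 1)%R).
  { rewrite Cmod_inv by exact x0. apply inv_lt_1. lra. }
  assert (Hba := not_int_swap a b Hab).
  assert (Hcn : ~ is_nonpos_int (c + INR n)).
  { apply nonpos_int_plus_nat, Hc. }
  assert (Han : ~ is_int (a + INR n - b)).
  { replace (a + INR n - b) with (a - b + INR n) by ring. apply not_int_plus_nat, Hab. }
  assert (Hban : ~ is_int (b - (a + INR n))).
  { apply not_int_swap, Han. }
  destruct (hyp2F1_inversion (a + INR n) b (c + INR n) Hcn Han) as [A [B [HA [HB H]]]].
  assert (G1 := rGamma_neq_0 _ Hcn). assert (G2 := rGamma_neq_0 _ (not_int_not_nonpos _ Hban)).
  assert (G3 := rGamma_neq_0 _ (not_int_not_nonpos _ Han)).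
  assert (G4 := rGamma_neq_0 _ Hc). assert (G5 := rGamma_neq_0 _ (not_int_not_nonpos _ Hba)).
  assert (G6 := rGamma_neq_0 _ (not_int_not_nonpos _ Hab)).
  assert (EA : A = rGamma b * rGamma (c - a) / (rGamma (c + INR n) * rGamma (b - (a + INR n)))).
  { replace (c + INR n - (a + INR n)) with (c - a) in HA by ring. rewrite <- HA. field. nz. }
  assert (EB : B = rGamma (a + INR n) * rGamma (c + INR n - b) / (rGamma (c + INR n) * rGamma (a + INR n - b))).
  { rewrite <- HB. field. nz. }
  rewrite (Csum_unique _ _ (double1_row a b c (/ x) y n Hab HX)), (Csum_unique _ _ (double2_row a b c (/ x) y n Hab HX)).
  unfold Phi1_term. rewrite (H x Harg Hx), Cpower_shift by exact x0.
  replace (a + INR n - (c + INR n) + 1) with (a - c + 1) by ring.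
  set (U := psum (hcoef (a + INR n) (a - c + 1) (a + INR n - b + 1)) (/ x)).
  set (V := psum (hcoef b (b - (c + INR n) + 1) (b - (a + INR n) + 1)) (/ x)).
  rewrite EA, EB. unfold Gamma.
  assert (P1 := rGamma_poch c n). assert (P2 := rGamma_poch a n).
  assert (P3 := poch_rGamma (b - a) n).
  replace (1 - (b - a)) with (a - b + 1) in P3 by ring. replace (b - a - INR n) with (b - (a + INR n)) in P3 by ring.
  assert (p1 := poch_neq_0 c n Hc). assert (F := fact_neq_0C n).
  assert (N1 : ~ is_nonpos_int (a - b + 1)) by (apply not_nonpos_S, Hab).
  assert (p2 := poch_neq_0 _ n N1).
  replace (rGamma (b - (a + INR n))) with ((-(1)) ^ n * (poch (a - b + 1) n * rGamma (b - a))).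
  2:{ rewrite P3, Cmult_assoc, m1_sqr. ring. }
  rewrite P1, P2. assert (m0 := m1_neq_0 n). field. nz.
Qed.

(* Since 1 - (c - a) = a - c + 1, the factor (a-c+1)_k / Gamma(c-a) * 1F1[-k; c-a-k; y]
   is [scaled1F1 k (- INR k) y (c - a)]; similarly with b in place of a. *)
Theorem theorem3p1 (a b c x y : C)
  (hc : ~ is_nonpos_int c) (hab : ~ is_int (a - b))
  (harg : (Rabs (Carg (- x)) < PI)%R) (hx : (1 < Cmod x)%R) :
  let S1 := fun k : nat =>
    scaled1F1 k (- INR k) y (c - a)
    * (poch a k / poch (a - b + 1) k) * (/ x ^ k / INR (fact k)) in
  let S2 := fun k : nat =>
    scaled1F1 k (a - b - INR k) y (c - b)
    * (poch b k / poch (b - a + 1) k) * (/ x ^ k / INR (fact k)) in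
  ex_series (Phi1_term a b c x y) /\ ex_series S1 /\ ex_series S2 /\
  Phi1 a b c x y =
    Gamma c * Gamma (b - a) * rGamma b * Cpower (- x) (- a) * Csum S1
    + Gamma c * Gamma (a - b) * rGamma a * Cpower (- x) (- b) * Csum S2.
Proof.
  intros S1 S2.
  assert (x0 : x <> 0) by (apply Cmod_gt_0; lra).
  assert (HX : (Cmod (/ x) < 1)%R).
  { rewrite Cmod_inv by exact x0. apply inv_lt_1. lra. }
  destruct (double1_summable a b c (/ x) y hab HX) as [A1 A2].
  destruct (fubini_diag _ A1 A2) as [T1 [R1 [D1 _]]].
  destruct (double2_summable a b c (/ x) y hab HX) as [B1 B2].
  destruct (fubini _ B1 B2) as [_ [_ [_ [T2 [R2 D2]]]]].
  assert (HS1 : is_series S1 T1).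
  { eapply is_series_C_ext; [|exact D1]. intros k. cbv beta. rewrite double1_diag by exact hab.
    unfold S1. rewrite Cpow_inv by exact x0. reflexivity. }
  assert (HS2 : is_series S2 T2).
  { eapply is_series_C_ext; [|exact D2]. intros k. cbv beta.
    rewrite (Csum_unique _ _ (double2_col a b c (/ x) y k hab)).
    unfold S2. rewrite Cpow_inv by exact x0. reflexivity. }
  assert (HP : is_series (Phi1_term a b c x y)
    (Gamma c * Gamma (b - a) * rGamma b * Cpower (- x) (- a) * T1
     + Gamma c * Gamma (a - b) * rGamma a * Cpower (- x) (- b) * T2)).
  { eapply is_series_C_ext; [|apply is_series_C_plus; apply is_series_C_scal; [exact R1|exact R2]].
    intros n. symmetry. apply Phi1_term_rows; assumption. }
  split; [eexists; exact HP|]. split; [eexists; exact HS1|]. split; [eexists; exact HS2|].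
  unfold Phi1. rewrite (Csum_unique _ _ HP), (Csum_unique _ _ HS1), (Csum_unique _ _ HS2). reflexivity.
Qed.
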